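(* Let $\gamma>0$ and let $m$ be a positive integer. Let $X_m^{(s)}$ be the space of spherically symmetric functions $u=u(|x|):\mathbb{R}^2\to\mathbb{C}$ with $$\int_{\mathbb{R}^2}\Big(|\partial_r u|^2+\frac{m^2}{r^2}|u|^2+|u|^2+\ln(1+r)|u|^2\Big)dx<\infty,\quad r=|x|,$$ and define $$E_m(u)=\int_{\mathbb{R}^2}\Big(|\partial_r u|^2+\frac{m^2}{r^2}|u|^2\Big)dx+\frac{\gamma}{4\pi}\int_{\mathbb{R}^2}\int_{\mathbb{R}^2}\ln(|x-y|)|u(x)|^2|u(y)|^2\,dx\,dy,$$ $N(u)=\int_{\mathbb{R}^2}|u|^2dx$, and $e_m(\lambda)=\inf\{E_m(u):u\in X_m^{(s)},N(u)=\lambda\}$. Then for every $\lambda>0$ there exists a nonnegative $u_\lambda\in X_m^{(s)}$ with $N(u_\lambda)=\lambda$ and $E_m(u_\lambda)=e_m(\lambda)$.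
   Context: $\gamma>0$ is a fixed coupling constant. *)

(* Defs.v *)
From HB Require Import structures.
From mathcomp Require Import all_boot all_order all_algebra.
From mathcomp Require Import all_classical all_reals all_analysis.
Set Implicit Arguments. Unset Strict Implicit. Unset Printing Implicit Defensive.
Import Order.TTheory GRing.Theory Num.Theory.
Import numFieldNormedType.Exports.
Local Open Scope classical_set_scope.
Local Open Scope ring_scope.

(* Euclidean norm on R^2 = R * R (the library norm on a product is the max norm). *)
Definition eucl {R : realType} (x : R * R) : R := Num.sqrt (x.1 ^+ 2 + x.2 ^+ 2).

Definition leb2 {R : realType} := (@lebesgue_measure R \x @lebesgue_measure R)%E.

(* A spherically symmetric function u(x) = v(|x|) : R^2 -> C, given by the real
   and imaginary parts of its radial profile, together with (the real and
   imaginary parts of) its radial derivative d_r u. *)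
Record radial (R : realType) := Radial {
  re_p : R -> R ;
  im_p : R -> R ;
  dre_p : R -> R ;
  dim_p : R -> R
}.

(* dv is the (weak) derivative of v on (0, oo): v is locally absolutely
   continuous on (0,oo) with v b - v a = \int_a^b dv. *)
Definition radial_deriv {R : realType} (v dv : R -> R) : Prop :=
  measurable_fun setT v /\ measurable_fun setT dv /\
  forall a b : R, 0 < a -> a < b ->
    (@lebesgue_measure R).-integrable `[a, b] (fun t => (dv t)%:E) /\
    ((v b - v a)%:E = \int[@lebesgue_measure R]_(t in `[a, b]) (dv t)%:E)%E.

Definition abs2u {R : realType} (u : radial R) (x : R * R) : R :=
  re_p u (eucl x) ^+ 2 + im_p u (eucl x) ^+ 2.
Definition abs2du {R : realType} (u : radial R) (x : R * R) : R :=
  dre_p u (eucl x) ^+ 2 + dim_p u (eucl x) ^+ 2.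

Definition in_Xms {R : realType} (m : nat) (u : radial R) : Prop :=
  radial_deriv (re_p u) (dre_p u) /\ radial_deriv (im_p u) (dim_p u) /\
  (\int[leb2]_x (abs2du u x + (m%:R ^+ 2 / eucl x ^+ 2) * abs2u u x
                 + abs2u u x + ln (1 + eucl x) * abs2u u x)%:E < +oo)%E.

Definition Nmass {R : realType} (u : radial R) : \bar R :=
  (\int[leb2]_x (abs2u u x)%:E)%E.

Definition Em {R : realType} (gamma : R) (m : nat) (u : radial R) : \bar R :=
  (\int[leb2]_x (abs2du u x + (m%:R ^+ 2 / eucl x ^+ 2) * abs2u u x)%:E
   + (gamma / (4 * pi))%:E *
     \int[leb2]_x \int[leb2]_y
        (ln (eucl (x - y)) * abs2u u x * abs2u u y)%:E)%E.

Definition em {R : realType} (gamma : R) (m : nat) (lambda : R) : \bar R :=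
  ereal_inf [set Em gamma m u | u in [set u : radial R | in_Xms m u /\ Nmass u = lambda%:E]].

(* Main.v *)
(* The infimum is attained by the direct method, working with the profile
   w = |u| only.

   Coercivity: write ln = ln^+ - ln^-.  Averaging over y and -y gives
   int ln^+|x-y| P(y) dy >= (lambda/2) ln^+|x|, while ln^- only sees small
   distances; as |u|^2 is bounded pointwise by the kinetic energy, the ln^- part
   is absorbed by half of that energy.  A minimizing sequence therefore has
   bounded kinetic energy and bounded int ln^+|x| |u|^2.

   Compactness: bounded radial energy makes the moduli w_n equicontinuous on
   (0, oo), so a subsequence converges pointwise to some p, and the logarithmic
   weight prevents loss of mass.  Fatou's lemma gives lower semicontinuity of the
   centrifugal term and, after adding a multiple of ln^-|x-y| to make the kernel
   nonnegative, of the potential term.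

   Kinetic term: replace int |dw/dr|^2 r dr by the dyadic sums
   sum_l l (w((l+1)/2^j) - w(l/2^j))^2.  They are dominated by the kinetic energy
   and pass to pointwise limits; conversely (F. Riesz) a bound S on all of them
   produces a weak derivative g of w with int g^2 r dr <= S.  This also yields a
   competitor of finite energy, from a piecewise linear hat. *)

(* The route avoids weak compactness in a Sobolev space and the chain rule for [|u|]. Dyadic sums
   see only point values, so they are continuous under pointwise convergence, and the reverse
   triangle inequality carries them from [u] to its modulus. Lower semicontinuity must hold with the
   sharp constant, because in the end the limits of the separate terms have to add up to the infimum
   exactly. This is why a cell is weighted by its left end point: the sums then lie below the energy
   with constant 1, and nothing is lost as the level grows, since left end points tend to [r].

   The pointwise bound on [|u|^2] is where [m > 0] enters. Radial and centrifugal energy are both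
   invariant under dilations of the plane, so the bound is uniform in [r] and linear in the energy.
   Linearity allows the absorption for every mass and every [gamma]: the coefficient is made small
   by cutting the negative part of the logarithm at a short distance. *)
Require Import Defs.
From HB Require Import structures.
From mathcomp Require Import all_boot all_order all_algebra.
From mathcomp Require Import all_classical all_reals all_analysis.
From mathcomp Require Import ring lra measurable_realfun.
Set Implicit Arguments. Unset Strict Implicit. Unset Printing Implicit Defensive.
Import Order.TTheory GRing.Theory Num.Theory.
Import numFieldNormedType.Exports.
Local Open Scope classical_set_scope.
Local Open Scope ring_scope.
Import HBNNSimple.

(** * Polar coordinates in the plane *)

Section density.
Context d (T : measurableType d) (R : realType).
Variables (mu nu : {measure set T -> \bar R}) (k : T -> R).
Hypotheses (mk : measurable_fun setT k) (k0 : forall x, 0 <= k x).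
Hypothesis nuE : forall A, measurable A -> nu A = (\int[mu]_(x in A) (k x)%:E)%E.

Lemma ge0_integral_density (f : T -> \bar R) :
  measurable_fun setT f -> (forall x, 0 <= f x)%E ->
  (\int[nu]_x f x = \int[mu]_x ((k x)%:E * f x))%E.
Proof.
move=> mf f0.
pose h := nnsfun_approx measurableT mf.
have hcvg x : (h n x)%:E @[n --> \oo] --> f x.
  by apply: (cvg_nnsfun_approx measurableT mf).
have mkE : measurable_fun setT (EFin \o k) by exact/measurable_EFinP.
transitivity (limn (fun n => \int[nu]_x (h n x)%:E))%E.
  rewrite -monotone_convergence//=.
  - by apply: eq_integral => x _; apply/esym/cvg_lim => //; exact: hcvg.
  - by move=> n; exact/measurable_EFinP/measurable_funP.
  - by move=> n y _; rewrite lee_fin.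
  - by move=> y _ m n mn; rewrite lee_fin; exact/lefP/nd_nnsfun_approx.
transitivity (limn (fun n => \int[mu]_x ((k x)%:E * (h n x)%:E)))%E; last first.
  rewrite -monotone_convergence//=.
  - apply: eq_integral => x _; apply/cvg_lim => //.
    by apply: cvgeZl => //; exact: hcvg.
  - move=> n; apply: emeasurable_funM => //.
    exact/measurable_EFinP/measurable_funP.
  - by move=> n y _; rewrite mule_ge0// lee_fin.
  - move=> y _ m n mn; rewrite lee_wpmul2l ?lee_fin//.
    exact/lefP/nd_nnsfun_approx.
(* For a simple function both sides are finite sums over its range, so only indicators remain, where
   [nuE] applies. *)
congr (limn _); apply/funext => n.
under eq_integral do rewrite fimfunE -fsumEFin//.
rewrite ge0_integral_fsum//; last 2 first.
  - by move=> y; exact/measurable_EFinP/measurable_funM.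
  - by move=> y x _; rewrite nnfun_muleindic_ge0.
transitivity (\int[mu]_x (\sum_(r \in range (h n))
    ((k x)%:E * (r * \1_(h n @^-1` [set r]) x)%:E)))%E; last first.
  apply: eq_integral => x _; rewrite [in RHS]fimfunE -fsumEFin//.
  rewrite ge0_mule_fsumr// => r.
  by rewrite EFinM; exact: nnfun_muleindic_ge0.
rewrite ge0_integral_fsum//; last 2 first.
  - move=> r; apply: emeasurable_funM => //.
    exact/measurable_EFinP/measurable_funM.
  - by move=> r x _; apply: mule_ge0; [rewrite lee_fin|rewrite EFinM; exact: nnfun_muleindic_ge0].
apply: eq_fsbigr => r; rewrite inE => -[x0 _ hr].
have r0 : 0 <= r by rewrite -hr.
rewrite integralZl_indic_nnsfun// integral_indic// setIT nuE//.
rewrite -ge0_integralZl_EFin//; last 2 first.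
  - by move=> x _; rewrite lee_fin.
  - exact: measurable_funTS.
rewrite integral_mkcond; apply: eq_integral => x _.
rewrite patchE indicE; case: ifPn => _.
  by rewrite mulr1 muleC.
by rewrite mulr0 mule0.
Qed.

End density.

Section density_measure.
Context d (T : measurableType d) (R : realType).
Variables (mu : {measure set T -> \bar R}) (k : T -> R).
Hypotheses (mk : measurable_fun setT k) (k0 : forall x, 0 <= k x).

(** Given the structure of a measure, so that it can be identified with another measure by comparing
    both on a generating family. *)
Definition density_fun (A : set T) : \bar R := (\int[mu]_(x in A) (k x)%:E)%E.

Let density0 : density_fun set0 = 0%E.
Proof. by rewrite /density_fun integral_set0. Qed.

Let density_ge0 A : (0 <= density_fun A)%E.
Proof. by apply: integral_ge0 => x _; rewrite lee_fin. Qed.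

Let density_sigma_additive : semi_sigma_additive density_fun.
Proof.
move=> A mA tA mUA; rewrite /density_fun ge0_integral_bigcup//=.
- apply: is_cvg_ereal_nneg_natsum_cond => n _ _; exact: density_ge0.
- by apply/measurable_EFinP; exact: measurable_funTS.
- by move=> x _; rewrite lee_fin.
Qed.

HB.instance Definition _ := isMeasure.Build _ _ _ density_fun
  density0 density_ge0 density_sigma_additive.

Definition density_measure : {measure set T -> \bar R} := density_fun.

End density_measure.

Section image_measure.
Context d1 d2 (T1 : measurableType d1) (T2 : measurableType d2) (R : realType).
Variables (mu : {measure set T1 -> \bar R}) (phi : T1 -> T2).
Hypothesis mphi : measurable_fun setT phi.

Definition image_measure : {measure set T2 -> \bar R} :=
  measure_function_pushforward__canonical__measure_function_Measure mu mphi.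

Lemma ge0_integral_image (nu : {measure set T2 -> \bar R}) (f : T2 -> \bar R) :
  (forall A, measurable A -> mu (phi @^-1` A) = nu A) ->
  measurable_fun setT f -> (forall x, 0 <= f x)%E ->
  (\int[mu]_x f (phi x) = \int[nu]_x f x)%E.
Proof.
move=> munu mf f0.
rewrite -[RHS](@eq_measure_integral _ _ _ _ nu (pushforward mu phi)); last first.
  by move=> A mA _; rewrite -munu.
by rewrite (@ge0_integral_pushforward _ _ _ _ _ _ mphi mu setT f)// preimage_setT.
Qed.

End image_measure.

Lemma measurable_preimageT d1 d2 (T1 : measurableType d1)
    (T2 : measurableType d2) (f : T1 -> T2) (A : set T2) :
  measurable_fun setT f -> measurable A -> measurable (f @^-1` A).
Proof. by move=> mf mA; rewrite -[X in measurable X]setTI; exact: mf. Qed.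

HB.instance Definition _ (R : realType) := Measure.on (@leb2 R).

Section scaling.
Context {R : realType}.
Notation leb := (@lebesgue_measure R).
Notation mR := (measurableTypeR R).

Lemma lebesgue_measure_scale (a : R) (A : set R) : 0 < a -> measurable A ->
  leb ( *%R a @^-1` A) = (a^-1%:E * leb A)%E.
Proof.
move=> a0 mA.
have ma : measurable_fun [set: measurableTypeR R] ( *%R a : _ -> measurableTypeR R) by exact: mulrl_measurable.
(* The image of Lebesgue measure under multiplication by [a] divides lengths by [a]; the factor [a]
   restores them, and uniqueness identifies [m1] with Lebesgue measure. *)
pose m1 := mscale (NngNum (ltW a0)) (image_measure leb ma).
have : leb A = m1 A.
  apply: lebesgue_measure_unique => // _ [[x y] _ <-] /=.
  rewrite /m1 /mscale /= /pushforward.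
  have -> : *%R a @^-1` [set` `]x, y]] = [set` `](x / a), (y / a)]].
    by apply/seteqP; split => z /=; rewrite !in_itv/= ltr_pdivrMr// ler_pdivlMr// mulrC.
  rewrite !lebesgue_measure_itv/= !lte_fin.
  rewrite ltr_pM2r ?invr_gt0//; case: ifPn => _; last by rewrite mule0.
  by rewrite -EFinB -EFinM; congr EFin; field; rewrite gt_eqF.
rewrite /m1 /mscale /= /pushforward => ->.
by rewrite muleA -EFinM mulVf ?gt_eqF// mul1e.
Qed.

(** The map is a reflection, the form needed for [x - y] with [y] as variable of integration. It
    turns []x, y]] into an interval that is half-open on the other side, of the same length. *)
Lemma leb_shift (a : R) (A : set R) : measurable A ->
  leb ((fun x => a - x) @^-1` A) = leb A.
Proof.
move=> mA.
have ma : measurable_fun [set: measurableTypeR R] ((fun x : R => a - x) : _ -> measurableTypeR R) by exact: measurable_funB.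
apply/esym.
apply: (@lebesgue_measure_unique _ (image_measure leb ma)) => // _ [[x y] _ <-] /=.
rewrite /pushforward /=.
have -> : (fun x => a - x) @^-1` [set` `]x, y]] = [set` `[(a - y), (a - x)[].
  apply/seteqP; split => z /=; rewrite !in_itv/= => /andP[? ?]; apply/andP; split; lra.
rewrite !lebesgue_measure_itv/= !lte_fin ltrD2l ltrN2; case: ifPn => // _.
by rewrite -!EFinB; congr EFin; ring.
Qed.

Lemma measurable_eucl : measurable_fun [set: mR * mR] (@eucl R : _ -> mR).
Proof.
have ms : measurable_fun [set: R] (@Num.sqrt R).
  by apply: continuous_measurable_fun; apply: sqrt_continuous.
apply: (measurableT_comp ms).
by apply: measurable_funD; apply: measurable_funX; [exact: measurable_fst|exact: measurable_snd].
Qed.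

Lemma leb2X (A B : set mR) : measurable A -> measurable B ->
  leb2 (A `*` B) = (leb A * leb B)%E.
Proof. exact: product_measure1E. Qed.

Lemma leb2_reflect (x : R * R) (A : set (mR * mR)) : measurable A ->
  leb2 ((fun y : R * R => x - y) @^-1` A) = leb2 A.
Proof.
move=> mA.
have ma : measurable_fun [set: mR * mR] ((fun y : R * R => x - y) : _ -> mR * mR).
  apply/measurable_fun_pairP; split => /=.
    by apply: measurable_funB => //; exact: measurable_fst.
  by apply: measurable_funB => //; exact: measurable_snd.
apply/esym; apply: (@product_measure_unique _ _ _ _ _ leb leb (image_measure leb2 ma)) => //.
move=> B C mB mC /=; rewrite /pushforward.
rewrite (_ : _ @^-1` _ = ((fun t => x.1 - t) @^-1` B) `*` ((fun t => x.2 - t) @^-1` C)); last first.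
  by apply/seteqP; split => -[y1 y2].
have ms (a : R) : measurable_fun [set: mR] ((fun t : R => a - t) : mR -> mR).
  exact: measurable_funB.
rewrite [LHS]leb2X; first by rewrite !leb_shift.
  exact: measurable_preimageT (ms _) mB.
exact: measurable_preimageT (ms _) mC.
Qed.

Lemma leb2_scale (a : R) (A : set (mR * mR)) : 0 < a -> measurable A ->
  leb2 ((fun y : R * R => (a * y.1, a * y.2)) @^-1` A) = ((a ^- 2)%:E * leb2 A)%E.
Proof.
move=> a0 mA.
have ma : measurable_fun [set: mR * mR] ((fun y : R * R => (a * y.1, a * y.2)) : _ -> mR * mR).
  apply/measurable_fun_pairP; split => /=.
    by apply: measurable_funM => //; exact: measurable_fst.
  by apply: measurable_funM => //; exact: measurable_snd.
have a20 : 0 <= a ^+ 2 by exact: sqr_ge0.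
have : leb2 A = mscale (NngNum a20) (image_measure leb2 ma) A.
  apply: (@product_measure_unique _ _ _ _ _ leb leb) => //.
  move=> B C mB mC /=; rewrite /mscale /= /pushforward.
  rewrite (_ : _ @^-1` _ = ( *%R a @^-1` B) `*` ( *%R a @^-1` C)); last first.
    by apply/seteqP; split => -[y1 y2].
  have ms : measurable_fun [set: mR] ( *%R a : mR -> mR) by exact: mulrl_measurable.
  rewrite [in LHS]leb2X.
  - rewrite !lebesgue_measure_scale//.
    rewrite (muleACA (a^-1)%:E) -EFinM (muleA (a ^+ 2)%:E) -EFinM.
    have -> : a ^+ 2 * (a^-1 / a) = 1 by field; rewrite gt_eqF.
    by rewrite mul1e.
  - exact: measurable_preimageT ms mB.
  - exact: measurable_preimageT ms mC.
rewrite /mscale /= /pushforward => ->.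
by rewrite muleA -EFinM mulVf ?mul1e// sqrf_eq0 gt_eqF.
Qed.

Lemma ge0_integral_reflect (x : R * R) (f : R * R -> \bar R) :
  measurable_fun [set: mR * mR] f -> (forall y, 0 <= f y)%E ->
  (\int[leb2]_y f (x - y)%R = \int[leb2]_y f y)%E.
Proof.
move=> mf f0.
have mx : measurable_fun [set: mR * mR] ((fun y : R * R => x - y) : _ -> mR * mR).
  apply/measurable_fun_pairP; split => /=.
    by apply: measurable_funB => //; exact: measurable_fst.
  by apply: measurable_funB => //; exact: measurable_snd.
exact: (ge0_integral_image mx (leb2_reflect x) mf f0).
Qed.

Lemma eucl_ge0 (x : R * R) : 0 <= eucl x. Proof. exact: sqrtr_ge0. Qed.

Lemma eucl_scale (a : R) (x : R * R) : 0 <= a -> eucl (a * x.1, a * x.2) = a * eucl x.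
Proof.
move=> a0; rewrite /eucl /= !exprMn -mulrDr sqrtrM ?sqr_ge0//.
by rewrite sqrtr_sqr ger0_norm.
Qed.

Definition disk_area : R := fine (leb2 [set x : R * R | eucl x < 1]).

Lemma measurable_disk (r : R) : measurable [set x : mR * mR | eucl x < r].
Proof.
have -> : [set x : mR * mR | eucl x < r] = @eucl R @^-1` `]-oo, r[.
  by apply/seteqP; split => x /=; rewrite in_itv.
by apply: measurable_preimageT => //; exact: measurable_eucl.
Qed.

(** Comparison with squares, from outside here and from inside in [square_subset], shows that
    [disk_area] is finite and positive. *)
Lemma disk_subset (r : R) : [set x : R * R | eucl x < r] `<=` `]-r, r[ `*` `]-r, r[.
Proof.
move=> [x y] /=; rewrite /eucl/= => h.
have r0 : 0 < r by rewrite (le_lt_trans _ h)// sqrtr_ge0.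
have sq z : z ^+ 2 <= x ^+ 2 + y ^+ 2 -> -r < z < r.
  move=> hz; rewrite -ltr_norml; apply: le_lt_trans h.
  by rewrite -sqrtr_sqr ler_sqrt// addr_ge0 ?sqr_ge0.
by rewrite !in_itv/=; split; apply: sq; rewrite ?lerDl ?lerDr sqr_ge0.
Qed.

Lemma square_subset (r : R) : `]-r, r[ `*` `]-r, r[ `<=` [set x : R * R | eucl x < 2 * r].
Proof.
move=> [x y] /=; rewrite !in_itv/= -!ltr_norml => -[hx hy].
have r0 : 0 < r by rewrite (le_lt_trans _ hx).
rewrite /eucl/= -[ltRHS]ger0_norm; last by rewrite mulr_ge0 ?ltW.
rewrite -sqrtr_sqr ltr_sqrt; last by rewrite exprn_gt0 ?mulr_gt0.
have h z : `|z| < r -> z ^+ 2 < r ^+ 2.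
  by move=> hz; rewrite -real_normK ?num_real// ltr_pXn2r ?nnegrE// ltW.
have := h _ hx; have := h _ hy => ? ?.
by rewrite exprMn; have := sqr_ge0 r => ?; lra.
Qed.

Lemma leb2_square (r : R) : 0 < r -> leb2 (`]-r, r[ `*` `]-r, r[ : set (R * R)) = ((2 * r) ^+ 2)%:E.
Proof.
move=> r0; rewrite leb2X//= lebesgue_measure_itv/= lte_fin.
by rewrite (_ : -r < r) ?gtrN// -EFinB -EFinM; congr EFin; ring.
Qed.

(** For the product of two copies of [leb2], over which the potential becomes a single integral, and
    for Tonelli's theorem there. *)
Lemma leb2_sigma_finite : sigma_finite setT (@leb2 R).
Proof.
exists (fun n => `]-n.+1%:R, n.+1%:R[ `*` `]-n.+1%:R, n.+1%:R[).
  apply/esym; rewrite -subTset => -[x y] _.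
  exists (Num.truncn (Num.max `|x : R| `|y : R|)) => //=; rewrite !in_itv/= -!ltr_norml.
  by have := truncnS_gt (Num.max `|x : R| `|y : R|); rewrite gt_max => /andP[-> ->].
move=> n; split; first exact: measurableX.
by rewrite leb2_square ?ltry.
Qed.

HB.instance Definition _ :=
  Measure_isSigmaFinite.Build _ _ _ (@leb2 R) leb2_sigma_finite.

Lemma disk_areaE : leb2 [set x : R * R | eucl x < 1] = disk_area%:E.
Proof.
rewrite /disk_area fineK// ge0_fin_numE ?measure_ge0//.
apply: (@le_lt_trans _ _ (leb2 (`]-1, 1[ `*` `]-1, 1[ : set (R * R)))).
  apply: le_measure; rewrite ?inE.
  - exact: measurable_disk.
  - exact: measurableX.
  - exact: disk_subset.
by rewrite leb2_square ?ltry.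
Qed.

Lemma disk_area_gt0 : 0 < disk_area.
Proof.
rewrite -lte_fin -disk_areaE.
apply: (@lt_le_trans _ _ (leb2 (`]-(2^-1), 2^-1[ `*` `]-(2^-1), 2^-1[ : set (R * R)))).
  by rewrite leb2_square// lte_fin; lra.
apply: le_measure; rewrite ?inE.
- exact: measurableX.
- exact: measurable_disk.
- by have := @square_subset 2^-1; rewrite divff.
Qed.

Lemma leb2_disk (r : R) : 0 < r ->
  leb2 [set x : R * R | eucl x < r] = (r ^+ 2 * disk_area)%:E.
Proof.
move=> r0; rewrite EFinM -disk_areaE.
have := @leb2_scale r^-1 [set x : R * R | eucl x < 1].
rewrite invr_gt0 => /(_ r0 (measurable_disk 1)).
rewrite exprVn invrK => <-; congr leb2; apply/seteqP; split => x /=.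
  by rewrite eucl_scale ?invr_ge0 ?ltW// mulrC ltr_pdivrMr// mul1r.
by rewrite eucl_scale ?invr_ge0 ?ltW// mulrC ltr_pdivrMr// mul1r.
Qed.

Lemma integral_linear (c x : R) : 0 < x ->
  (\int[leb]_(r in `[0%R, x]) (2 * c * r)%:E = (x ^+ 2 * c)%:E)%E.
Proof.
move=> x0.
pose F (r : R) := c * r ^+ 2.
have dF (r : R) : is_derive r (1 : R) F (2 * c * r).
  by apply: is_derive_eq; rewrite /GRing.scale/=; ring.
have cF : continuous F.
  move=> r; apply: differentiable_continuous; apply/derivable1_diffP.
  by have [] := dF r.
rewrite (@continuous_FTC2 _ _ F)//.
- by rewrite /F expr0n/= mulr0 sube0 mulrC.
- apply: continuous_subspaceT => r.
  by apply: cvgM; [exact: cvg_cst|exact: cvg_id].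
- split.
  + by move=> r _; have [] := dF r.
  + by apply: cvg_at_right_filter; exact: cF.
  + by apply: cvg_at_left_filter; exact: cF.
- by move=> r _; rewrite derive1E; apply: derive_val.
Qed.

(** The length of the circle of radius [r], as the derivative of the area of the disk; [Num.max]
    extends it by [0] to negative [r]. *)
Definition radial_density (r : R) := 2 * disk_area * Num.max 0 r.

Lemma measurable_radial_density : measurable_fun [set: mR] (radial_density : mR -> mR).
Proof. by apply: measurable_funM => //; exact: measurable_maxr. Qed.

Lemma radial_density_ge0 r : 0 <= radial_density r.
Proof.
by rewrite /radial_density mulr_ge0 ?mulr_ge0 ?(ltW disk_area_gt0)// le_max lexx.
Qed.

(** The rays []-oo, x[] generate the Borel sets and are closed under intersection. The preimage of
    such a ray under [eucl] is a disk, or empty, so both measures agree on them. *)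
Lemma image_leb2_eucl (A : set mR) : measurable A ->
  image_measure leb2 measurable_eucl A =
  (\int[leb]_(r in A) (radial_density r)%:E)%E.
Proof.
move=> mA.
have h := @measure_unique _ R mR (@RGenInftyO.G R) (fun n => `]-oo, n%:R[%classic)
  (@RGenInftyO.measurableE R) _ _ _ (image_measure leb2 measurable_eucl)
  (density_measure leb measurable_radial_density radial_density_ge0).
apply: h => //.
- move=> _ _ [x ->] [y ->]; exists (Num.min x y).
  by apply/seteqP; split => z /=; rewrite !in_itv/= lt_min => /andP.
- by move=> n; exists n%:R.
- rewrite -subTset => x _; exists (Num.truncn x).+1 => //=.
  by rewrite in_itv/= truncnS_gt.
- move=> _ [x ->]; rewrite /= /density_measure /pushforward.
  have -> : @eucl R @^-1` `]-oo, x[ = [set y | eucl y < x].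
    by apply/seteqP; split => y /=; rewrite in_itv.
  have [x0|x0] := leP x 0.
    rewrite (_ : [set y | _] = set0); last first.
      by rewrite -subset0 => y /=; rewrite ltNge (le_trans x0) ?eucl_ge0.
    rewrite measure0; apply/esym/integral0_eq => r /=; rewrite in_itv/= => rx.
    by rewrite /radial_density max_l ?mulr0// (le_trans (ltW rx)).
  rewrite /density_fun leb2_disk// -integral_linear// -integral_itv_bndo_bndc; last first.
    by apply/measurable_EFinP; exact: mulrl_measurable.
  rewrite [LHS]integral_mkcond [RHS]integral_mkcond.
  apply: eq_integral => r _; rewrite !patchE /= !mem_setE !in_itv/=.
  have [r0|r0] := leP 0 r; rewrite /= ?andbT.
    by rewrite /radial_density max_r.
  by rewrite /radial_density max_l ?mulr0 ?if_same// ltW.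
- move=> n; rewrite /= /pushforward.
  have -> : @eucl R @^-1` `]-oo, n%:R[ = [set y | eucl y < n%:R].
    by apply/seteqP; split => y /=; rewrite in_itv.
  case: n => [|n]; last by rewrite leb2_disk// ltry.
  rewrite (_ : [set y | _] = set0) ?measure0//.
  by rewrite -subset0 => y /=; rewrite ltNge eucl_ge0.
Qed.

(* [disk_area] is not computed: the scaling of disks alone gives the density. *)
Lemma integral_radial (f : R -> \bar R) :
  measurable_fun [set: mR] f -> (forall r, 0 <= f r)%E ->
  (\int[leb2]_x f (eucl x) =
   \int[leb]_(r in `]0%R, +oo[) ((2 * disk_area * r)%:E * f r))%E.
Proof.
move=> mf f0.
rewrite (ge0_integral_image measurable_eucl (nu := image_measure leb2 measurable_eucl))//.
rewrite (ge0_integral_density measurable_radial_density radial_density_ge0 image_leb2_eucl)//.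
rewrite [RHS]integral_mkcond; apply: eq_integral => r _.
rewrite patchE mem_setE in_itv/= andbT /radial_density.
by case: ltP => [r0|r0]; rewrite ?mulr0 ?mul0e.
Qed.

End scaling.

(** * Riesz' characterization of the radial energy by dyadic increments *)

Lemma limn_einf_le (R : realType) (u : (\bar R)^nat) (c : R^nat) (l : R) :
  (forall n, u n <= (c n)%:E)%E -> c n @[n --> \oo] --> l ->
  (limn_einf u <= l%:E)%E.
Proof.
move=> uc cl.
have cl' : (c n)%:E @[n --> \oo] --> l%:E by apply: cvg_EFin => //; exact: nearW.
rewrite limn_einf_lim -(cvg_lim _ cl')//.
apply: lee_lim.
- exact: is_cvg_einfs.
- by apply/cvg_ex; exists l%:E.
- apply: nearW => n; apply: le_trans (uc n).
  by apply: ereal_inf_lbound; exists n => /=.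
Qed.

(** The form of Fatou's lemma behind every lower semicontinuity argument below: the bounds may vary
    with [n] as long as they converge. *)
Lemma fatou_le d (T : measurableType d) (R : realType)
    (mu : {measure set T -> \bar R}) (D : set T) (f_ : (T -> \bar R)^nat)
    (f : T -> \bar R) (c : R^nat) (l : R) :
  measurable D -> (forall n, measurable_fun D (f_ n)) -> measurable_fun D f ->
  (forall n x, D x -> 0 <= f_ n x)%E -> (forall x, D x -> 0 <= f x)%E ->
  {ae mu, forall x, D x -> (f x <= limn_einf (f_ ^~ x))%E} ->
  (forall n, \int[mu]_(x in D) f_ n x <= (c n)%:E)%E ->
  c n @[n --> \oo] --> l ->
  (\int[mu]_(x in D) f x <= l%:E)%E.
Proof.
move=> mD mf_ mf f_0 f0 ff_ fc cl.
apply: le_trans (limn_einf_le fc cl).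
apply: le_trans (fatou mu mD mf_ f_0).
apply: ae_ge0_le_integral => //.
- move=> x Dx; rewrite limn_einf_lim; apply: lime_ge.
    exact: is_cvg_einfs.
  by apply: nearW => n; apply: le_ereal_inf_tmp => _ [m _ <-]; exact: f_0.
- apply: measurableT_comp => //; apply: measurable_fun_limn_esup => n.
  exact: measurableT_comp.
Qed.

Lemma cvg_le_limn_einf (R : realType) (u : (\bar R)^nat) (l : \bar R) :
  u n @[n --> \oo] --> l -> (l <= limn_einf u)%E.
Proof. by move=> ul; have [->] := cvg_limn_einf_sup ul. Qed.

Lemma ae_sub d (T : measurableType d) (R : realType)
    (mu : {measure set T -> \bar R}) (P Q : T -> Prop) :
  (forall x, P x -> Q x) -> {ae mu, forall x, P x} -> {ae mu, forall x, Q x}.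
Proof. by move=> PQ; apply: filterS. Qed.

Lemma cvg_shiftl (R : realType) (u : R^nat) (N : nat) (l : R) :
  u n @[n --> \oo] --> l -> u (N + n)%N @[n --> \oo] --> l.
Proof. by move=> ul; exact: (cvg_comp (addn N) u (cvg_addnl N) ul). Qed.

Lemma measurable_invr (R : realType) : measurable_fun [set: R] (@GRing.inv R).
Proof.
rewrite -(setvU [set (0 : R)]); apply/measurable_funU => //.
  exact: measurableC.
split; last exact: measurable_fun_set1.
apply: open_continuous_measurable_fun.
  by rewrite openC; exact: closed_eq.
by move=> x; rewrite inE/= => /eqP x0; exact: inv_continuous.
Qed.

Section riesz.
Context {R : realType}.
Notation leb := (@lebesgue_measure R).
Notation mR := (measurableTypeR R).

Lemma measurable_truncn : measurable_fun [set: mR] (@Num.truncn R).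
Proof.
have h n : measurable [set r : mR | (Num.truncn (r : R) <= n)%N].
  have -> : [set r : mR | (Num.truncn (r : R) <= n)%N] = `]-oo, n.+1%:R[%classic.
    by apply/seteqP; split => r /=; rewrite in_itv/= truncn_le_nat.
  exact: measurable_itv.
move=> _ Y _; rewrite setTI.
have -> : @Num.truncn R @^-1` Y = \bigcup_(n in Y) [set r : mR | Num.truncn (r : R) = n].
  by apply/seteqP; split => r /=; [exists (Num.truncn r)|move=> [n Yn /= ->]].
apply: bigcup_measurable => -[|n] _.
  by rewrite (_ : [set r | _] = [set r : mR | (Num.truncn (r : R) <= 0)%N])//;
    apply/seteqP; split => r /=; [move=> ->|rewrite leqn0 => /eqP].
rewrite (_ : [set r | _] = [set r : mR | (Num.truncn (r : R) <= n.+1)%N] `\`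
  [set r : mR | (Num.truncn (r : R) <= n)%N]); first exact: measurableD.
apply/seteqP; split => r /=; first by move=> ->; split => //; rewrite ltnn.
by move=> [h1 h2]; apply/eqP; rewrite eqn_leq h1/= ltnNge; apply/negP.
Qed.

(** A step function on a uniform grid factors through the discrete type [nat], which makes it
    measurable whatever [phi] is. *)
Lemma measurable_cells (M : R) (phi : nat -> R) :
  measurable_fun [set: mR] ((fun r => phi (Num.truncn (M * r))) : mR -> mR).
Proof.
have mM : measurable_fun [set: mR] ( *%R M : mR -> mR) by exact: mulrl_measurable.
have mphi : measurable_fun [set: nat] (phi : nat -> mR) by [].
exact: (measurableT_comp mphi (measurableT_comp measurable_truncn mM)).
Qed.

Lemma truncn_cell (M r : R) (a b : nat) : 0 < M ->
  `[a%:R / M, b%:R / M[%classic r -> (a <= Num.truncn (M * r) < b)%N.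
Proof.
move=> M0; rewrite /= in_itv/= ler_pdivrMr// ltr_pdivlMr// mulrC => /andP[ar rb].
have Mr : 0 <= M * r by exact: le_trans ar.
by rewrite truncn_ge_nat// ar/= truncn_lt_nat// mulrC.
Qed.

Lemma integrable_cells (M : R) (phi : nat -> R) (a b : nat) : 0 < M ->
  leb.-integrable `[a%:R / M, b%:R / M[ (fun r => (phi (Num.truncn (M * r)))%:E).
Proof.
move=> M0; apply: measurable_bounded_integrable => //.
- by rewrite [ltLHS]lebesgue_measure_itv/=; case: ifPn => _; rewrite -?EFinB ltry.
- exact: measurable_funTS (measurable_cells M phi).
- exists (\sum_(l < b) `|phi l|); split; first exact: num_real.
  move=> y hy r /(truncn_cell M0)/andP[_ rb].
  apply: le_trans (ltW hy).
  by rewrite (bigD1 (Ordinal rb))//= lerDl sumr_ge0.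
Qed.

Lemma integral_cells (M : R) (phi : nat -> R) (a b : nat) : 0 < M -> (a <= b)%N ->
  (\int[leb]_(r in `[(a%:R / M)%R, (b%:R / M)%R[) (phi (Num.truncn (M * r)))%:E =
   (\sum_(a <= l < b) phi l / M)%:E)%E.
Proof.
move=> M0; elim: b => [|b IH].
  rewrite leqn0 => /eqP ->; rewrite big_geq// set_itvE; exact: integral_set0.
rewrite leq_eqVlt => /predU1P[->|].
  rewrite big_geq// set_itvE; exact: integral_set0.
rewrite ltnS => ab; rewrite big_nat_recr//= EFinD -IH//.
have le1 : a%:R / M <= b%:R / M by rewrite ler_pM2r ?invr_gt0// ler_nat.
have le2 : b%:R / M <= b.+1%:R / M by rewrite ler_pM2r ?invr_gt0// ler_nat.
have -> : `[a%:R / M, b.+1%:R / M[%classic =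
  `[a%:R / M, b%:R / M[ `|` `[b%:R / M, b.+1%:R / M[ :> set R.
  apply/seteqP; split => r /=; rewrite !in_itv/=.
    by move=> /andP[-> ->]; rewrite andbT; have [|] := ltP r (b%:R / M); [left|right].
  move=> [/andP[-> h]|/andP[h ->]].
    by rewrite (lt_le_trans h).
  by rewrite (le_trans le1).
rewrite integral_setU//=; last 2 first.
- by apply/measurable_EFinP; exact: measurable_funTS (measurable_cells M phi).
- apply/disj_setPS => r /= []; rewrite !in_itv/= => /andP[_ h1] /andP[h2 _].
  by move: h1; rewrite ltNge h2.
congr (_ + _)%E.
transitivity (\int[leb]_(r in `[(b%:R / M)%R, (b.+1%:R / M)%R[) (cst (phi b)%:E r))%E.
  apply: eq_integral => r; rewrite inE => /(truncn_cell M0).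
  by rewrite ltnS -eqn_leq => /eqP ->.
rewrite integral_cst//= lebesgue_measure_itv/= lte_fin ltr_pM2r ?invr_gt0// ltr_nat ltnSn.
rewrite -EFinB -EFinM -mulrBl; congr EFin.
by rewrite -natrB ?leqnSn// subSnn mul1r.
Qed.

Variable w : R -> R.

Definition cell (j l : nat) : R := w (l.+1%:R / 2 ^+ j) - w (l%:R / 2 ^+ j).
Definition idx (j : nat) (r : R) : nat := Num.truncn (2 ^+ j * r).
(** The derivative of the piecewise linear interpolation of [w] at the dyadic points of level
    [j]. *)
Definition slope (j : nat) (r : R) : R := 2 ^+ j * cell j (idx j r).
Definition knot (j : nat) (r : R) : R := (idx j r)%:R / 2 ^+ j.

(* Up to the factor [2 * disk_area], the radial Dirichlet energy on the disk of
   radius [N / 2^j] of the interpolation of [w] at the dyadic points of level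
   [j], the weight [r] being replaced by the left end point of each cell. *)
Definition energy (j N : nat) : R := \sum_(0 <= l < N) l%:R * cell j l ^+ 2.

Lemma exp2_gt0 (j : nat) : 0 < 2 ^+ j :> R. Proof. by rewrite exprn_gt0. Qed.

Lemma energy_ge0 j N : 0 <= energy j N.
Proof. by apply: sumr_ge0 => l _; rewrite mulr_ge0 ?sqr_ge0. Qed.

Lemma energy_mono j N N' : (N <= N')%N -> energy j N <= energy j N'.
Proof.
move=> NN'; rewrite /energy [leRHS](@big_cat_nat _ _ _ N)//= lerDl.
by apply: sumr_ge0 => l _; rewrite mulr_ge0 ?sqr_ge0.
Qed.

Lemma sum_cell j a b : (a <= b)%N ->
  \sum_(a <= l < b) cell j l = w (b%:R / 2 ^+ j) - w (a%:R / 2 ^+ j).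
Proof. by move=> ab; rewrite (telescope_sumr (fun l => w (l%:R / 2 ^+ j))). Qed.

Lemma idx_coarse i j r : (i <= j)%N -> idx i r = (idx j r %/ 2 ^ (j - i))%N.
Proof.
move=> ij; rewrite /idx.
have q0 : 0 < (2 ^ (j - i))%:R :> R by rewrite ltr0n expn_gt0.
have jq : 2 ^+ j = (2 ^ (j - i))%:R * 2 ^+ i :> R by rewrite natrX -exprD subnK.
(* [Num.truncn] is [0] on negative numbers, so all indices vanish there. *)
have [r0|r0] := leP 0 r; last first.
  have t0 k : Num.truncn (2 ^+ k * r) = 0%N.
    by apply/truncn0Pn; rewrite -ltNge (lt_trans _ ltr01)// pmulr_rlt0 ?exp2_gt0.
  by rewrite !t0 div0n.
apply/truncn_def/andP; split.
  rewrite -(ler_pM2l q0) mulrA -jq -natrM mulnC.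
  have h : (Num.truncn (2 ^+ j * r))%:R <= 2 ^+ j * r.
    by rewrite truncn_le mulr_ge0// ltW// exp2_gt0.
  by apply: le_trans h; rewrite ler_nat leq_divM.
rewrite -(ltr_pM2l q0) mulrA -jq -natrM.
apply: lt_le_trans (truncnS_gt _) _.
by rewrite ler_nat mulnC ltn_ceil// expn_gt0.
Qed.

(** The variance identity: since the [d s] add up to [D], the cross terms contribute
    [- 2 * q * D ^+ 2]. It expresses the orthogonality of a coarse slope to its refinements. *)
Lemma refine_block (q : nat) (d : nat -> R) (a b : nat) (D : R) :
  (b - a = q)%N -> (a <= b)%N -> \sum_(a <= s < b) d s = D ->
  \sum_(a <= s < b) (q%:R * d s - D) ^+ 2 =
  q%:R ^+ 2 * (\sum_(a <= s < b) d s ^+ 2) - q%:R * D ^+ 2.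
Proof.
move=> baq ab dD.
under eq_bigr do rewrite sqrrB.
rewrite big_split/= big_split/= sumrN.
rewrite [X in _ - X + _](_ : _ = 2 * q%:R * D ^+ 2); last first.
  by rewrite sumrMnl -mulr_suml -mulr_sumr dD; ring.
rewrite sumr_const_nat baq -mulr_natl mulr_sumr.
under eq_bigr do rewrite exprMn.
by ring.
Qed.

(** With the weight frozen at the left end point of a coarse cell, [refine_block] gives equality.
    The inequality comes from the fine cells, whose left end points lie further right. The left side
    is the integral of the squared difference of slopes with weight [knot i]. *)
Lemma energy_refine (i j N : nat) : (i <= j)%N ->
  \sum_(0 <= l < N * 2 ^ j) (((l %/ 2 ^ (j - i))%N%:R / 2 ^+ i) *
    (2 ^+ j * cell j l - 2 ^+ i * cell i (l %/ 2 ^ (j - i))%N) ^+ 2) / 2 ^+ j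
  <= energy j (N * 2 ^ j) - energy i (N * 2 ^ i).
Proof.
move=> ij; set q := (2 ^ (j - i))%N.
have q0 : (0 < q)%N by rewrite expn_gt0.
have jq : 2 ^+ j = q%:R * 2 ^+ i :> R by rewrite natrX -exprD subnK.
have -> : (N * 2 ^ j = (N * 2 ^ i) * q)%N.
  by rewrite -mulnA /q -expnD subnKC.
rewrite /energy !(big_nat_mul _ (N * 2 ^ i) q) -sumrB.
apply: ler_sum_nat => k _.
have kq : (k.+1 * q - k * q = q)%N by rewrite -mulnBl subSnn mul1n.
have kle : (k * q <= k.+1 * q)%N by rewrite leq_mul2r leqnSn orbT.
have sD : \sum_(k * q <= s < k.+1 * q) cell j s = cell i k.
  rewrite sum_cell// /cell jq; congr (w _ - w _); rewrite natrM; field;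
  by rewrite ?gt_eqF ?exp2_gt0 ?ltr0n.
have := refine_block kq kle sD.
set A := \sum_(_ <= s < _) _ ^+ 2 => HA.
rewrite (_ : \sum_(_ <= j0 < _) _ = k%:R / q%:R * A); last first.
  rewrite /A mulr_sumr; apply: eq_big_nat => l /andP[l1 l2].
  have -> : (l %/ q)%N = k.
    by apply/eqP; rewrite eqn_leq leq_divRL// l1 andbT -ltnS ltn_divLR.
  rewrite jq; field; rewrite ?gt_eqF ?exp2_gt0 ?ltr0n//.
rewrite HA.
have -> : k%:R / q%:R * (q%:R ^+ 2 * \sum_(k * q <= s < k.+1 * q) cell j s ^+ 2 - q%:R * cell i k ^+ 2)
  = k%:R * q%:R * (\sum_(k * q <= s < k.+1 * q) cell j s ^+ 2) - k%:R * cell i k ^+ 2.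
  by field; rewrite gt_eqF ?ltr0n.
rewrite lerD2r mulr_sumr; apply: ler_sum_nat => l /andP[l1 _].
by rewrite ler_wpM2r ?sqr_ge0// -natrM ler_nat.
Qed.

Variable S : R.
Hypothesis wS : forall j N, energy j N <= S.

Definition total (j : nat) : R := sup (range (energy j)).

Let has_sup_energy j : has_sup (range (energy j)).
Proof. by split; [exists (energy j 0%N); exists 0%N|exists S => _ [N _ <-]]. Qed.

Lemma le_total j N : energy j N <= total j.
Proof. by apply: (sup_upper_bound (has_sup_energy j)); exists N. Qed.

Lemma total_le j : total j <= S.
Proof. by apply: ge_sup => [|_ [N _ <-]//]; exists (energy j 0%N); exists 0%N. Qed.

Let has_sup_total : has_sup (range total).
Proof. by split; [exists (total 0%N); exists 0%N|exists S => _ [j _ <-]; exact: total_le]. Qed.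

Lemma measurable_slope j : measurable_fun [set: mR] (slope j : mR -> mR).
Proof. exact: (measurable_cells (2 ^+ j) (fun l => 2 ^+ j * cell j l)). Qed.

Lemma measurable_knot j : measurable_fun [set: mR] (knot j : mR -> mR).
Proof. exact: (measurable_cells (2 ^+ j) (fun l => l%:R / 2 ^+ j)). Qed.

Lemma knot_ge0 j r : 0 <= knot j r.
Proof. by rewrite divr_ge0// ltW// exp2_gt0. Qed.

Lemma knot_le j r : 0 <= r -> knot j r <= r.
Proof.
move=> r0; rewrite ler_pdivrMr ?exp2_gt0// mulrC truncn_le mulr_ge0//.
Qed.

Lemma knot_gt j r : r - (2 ^+ j)^-1 < knot j r.
Proof.
rewrite ltrBlDr /knot -[X in _ + X]mul1r -mulrDl ltr_pdivlMr ?exp2_gt0//.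
by rewrite mulrC natr1 truncnS_gt.
Qed.

Lemma integral_energy j N :
  (\int[leb]_(r in `[0%R, N%:R[) (knot j r * slope j r ^+ 2)%:E =
   (energy j (N * 2 ^ j))%:E)%E.
Proof.
pose phi l : R := l%:R / 2 ^+ j * (2 ^+ j * cell j l) ^+ 2.
have := @integral_cells (2 ^+ j) phi 0 (N * 2 ^ j)%N (exp2_gt0 j) isT.
rewrite mul0r natrM natrX mulfK ?gt_eqF ?exp2_gt0// => ->.
congr EFin; apply: eq_bigr => l _; rewrite /phi; field.
by rewrite gt_eqF ?exp2_gt0.
Qed.

Lemma integral_slope_diff i j N : (i <= j)%N ->
  (\int[leb]_(r in `[0%R, N%:R[) (knot i r * (slope j r - slope i r) ^+ 2)%:E
   <= (total j - total i)%:E)%E.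
Proof.
move=> ij; apply/lee_addgt0Pr => e e0.
(* The radius is enlarged until level [i] has reached its total up to [e]; otherwise the energy
   still missing at level [i] would enter the bound. *)
have [_ [N' _ <-] hN'] := sup_adherent e0 (has_sup_energy i).
pose M := maxn N N'.
pose f r : R := knot i r * (slope j r - slope i r) ^+ 2.
have mf : measurable_fun [set: mR] (f : mR -> mR).
  apply: measurable_funM; first exact: measurable_knot.
  by apply: measurable_funX; apply: measurable_funB; exact: measurable_slope.
apply: (@le_trans _ _ (\int[leb]_(r in `[0%R, M%:R[) (f r)%:E)%E).
  apply: ge0_subset_integral => //.
  - by apply/measurable_EFinP; exact: measurable_funTS.
  - by move=> r _; rewrite lee_fin mulr_ge0 ?knot_ge0 ?sqr_ge0.
  - by apply: subset_itvl; rewrite bnd_simp/= ler_nat leq_maxl.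
pose phi l : R := (l %/ 2 ^ (j - i))%N%:R / 2 ^+ i *
    (2 ^+ j * cell j l - 2 ^+ i * cell i (l %/ 2 ^ (j - i))%N) ^+ 2.
have := @integral_cells (2 ^+ j) phi 0 (M * 2 ^ j)%N (exp2_gt0 j) isT.
rewrite mul0r natrM natrX mulfK ?gt_eqF ?exp2_gt0// => h.
rewrite (_ : (\int[leb]_(r in _) _)%E =
  (\int[leb]_(r in `[0%R, M%:R[) (phi (Num.truncn (2 ^+ j * r)))%:E)%E); last first.
  by apply: eq_integral => r _; rewrite /f /knot /slope (idx_coarse r ij).
rewrite h -EFinD lee_fin; apply: le_trans (energy_refine M ij) _.
have := le_total j (M * 2 ^ j)%N.
have : energy i N' <= energy i (M * 2 ^ i)%N.
  apply: energy_mono; rewrite (leq_trans (leq_maxr N N'))//.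
  by rewrite leq_pmulr// expn_gt0.
by move: hN'; rewrite /total; lra.
Qed.

Lemma total_mono i j : (i <= j)%N -> total i <= total j.
Proof.
move=> ij; rewrite -subr_ge0 -lee_fin.
apply: le_trans (integral_slope_diff 0 ij).
by apply: integral_ge0 => r _; rewrite lee_fin mulr_ge0 ?knot_ge0 ?sqr_ge0.
Qed.

(** The totals increase and are bounded by [S]. Squared distances of order [4 ^- n] mean distances
    of order [2 ^- n], which are summable. *)
Lemma fast_subsequence : exists J : nat -> nat,
  [/\ forall n, (n <= J n)%N, forall n, (J n <= J n.+1)%N &
   forall n, total (J n.+1) - total (J n) <= (4 ^+ n)^-1].
Proof.
have hc n : exists j, sup (range total) - (4 ^+ n)^-1 < total j.
  have e0 : 0 < (4 ^+ n)^-1 :> R by rewrite invr_gt0 exprn_gt0.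
  by have [_ [j _ <-] hj] := sup_adherent e0 has_sup_total; exists j.
have [c hc'] := choice hc.
(* The partial sums make [J] monotone and at least [c n]; the summand [n] makes the levels tend to
   infinity. *)
exists (fun n => (n + \sum_(k < n.+1) c k)%N); split.
- by move=> n; exact: leq_addr.
- by move=> n; rewrite [in leqRHS]big_ord_recr/= addSn ltnW// ltnS leq_add2l leq_addr.
- move=> n; set a := (X in total X - _); set b := (X in _ - total X).
  have : total a <= sup (range total).
    by apply: (sup_upper_bound has_sup_total); exists a.
  have : total (c n) <= total b.
    by apply: total_mono; rewrite /b big_ord_recr/= addnA leq_addl.
  by have := hc' n; lra.
Qed.

Variable J : nat -> nat.
Hypotheses (Jn : forall n, (n <= J n)%N) (JS : forall n, (J n <= J n.+1)%N)
  (Jtotal : forall n, total (J n.+1) - total (J n) <= (4 ^+ n)^-1).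

Let h n := slope (J n).
(** Annuli on which the weight is bounded below and Lebesgue measure is finite, so that weighted
    square bounds give integrals of absolute values. They exhaust the positive half line. *)
Let D k : set R := `[k.+1%:R^-1, k.+1%:R[%classic.

Let mh n : measurable_fun [set: mR] (h n : mR -> mR).
Proof. exact: measurable_slope. Qed.

Let mD k : measurable (D k : set mR).
Proof. exact: measurable_itv. Qed.

Lemma knot_lb k n r : (2 * k.+1 <= n)%N -> D k r ->
  (2 * k.+1%:R)^-1 <= knot (J n) r.
Proof.
move=> kn; rewrite /D/= in_itv/= => /andP[r1 _].
apply: le_trans (ltW (knot_gt _ _)).
have k0 : 0 < k.+1%:R :> R by rewrite ltr0n.
have : (2 ^+ J n)^-1 <= (2 * k.+1%:R)^-1 :> R.
  rewrite lef_pV2 ?posrE ?exp2_gt0 ?mulr_gt0// -natrM -natrX ler_nat.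
  by rewrite (leq_trans kn)// (leq_trans (Jn n))// ltnW// ltn_expl.
have -> : (2 * k.+1%:R)^-1 = k.+1%:R^-1 / 2 :> R by rewrite invfM mulrC.
by move: r1; set a := k.+1%:R^-1; set b := _ ^-1; lra.
Qed.

(** In place of Cauchy-Schwarz, the pointwise bound [2 * |x| <= 2 ^+ n * x ^+ 2 + (2 ^+ n)^-1] is
    integrated. It is balanced so that, with squared distances of order [4 ^- n], each of the two
    terms contributes [K / 2 ^+ n]. *)
Lemma integral_h_diff k n : (2 * k.+1 <= n)%N ->
  (\int[leb]_(r in D k) `|h n.+1 r - h n r|%:E <=
   (2 * k.+1%:R / 2 ^+ n)%:E)%E.
Proof.
move=> kn; set K : R := k.+1%:R.
have K0 : 0 < K by rewrite ltr0n.
pose f r : R := knot (J n) r * (h n.+1 r - h n r) ^+ 2.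
have f0 r : 0 <= f r by rewrite mulr_ge0 ?knot_ge0 ?sqr_ge0.
have mf : measurable_fun [set: mR] (f : mR -> mR).
  apply: measurable_funM; first exact: measurable_knot.
  by apply: measurable_funX; apply: measurable_funB; exact: mh.
have n0 : 0 < 2 ^+ n :> R by exact: exp2_gt0.
have c0 : 0 <= 2 ^+ n * K by rewrite mulr_ge0// ltW.
have i0 : 0 <= (2 ^+ n)^-1 :> R by rewrite invr_ge0 ltW.
have D0K : D k `<=` `[0, K[.
  move=> r; rewrite /D/= !in_itv/= => /andP[r1 ->]; rewrite andbT.
  by apply: le_trans r1; rewrite invr_ge0.
apply: (@le_trans _ _ (\int[leb]_(r in `[0%R, K[) ((2 ^+ n * K)%:E * (f r)%:E + (2 ^+ n)^-1%:E))%E).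
  apply: (@le_trans _ _ (\int[leb]_(r in D k) ((2 ^+ n * K)%:E * (f r)%:E + (2 ^+ n)^-1%:E))%E).
    apply: ge0_le_integral => //.
    - apply/measurable_EFinP; apply: measurable_funTS.
      by apply: measurableT_comp => //; apply: measurable_funB; exact: mh.
    - apply: measurable_funTS; apply: emeasurable_funD => //.
      by apply: measurable_funeM; exact/measurable_EFinP.
    - move=> r Dr; rewrite -EFinM -EFinD lee_fin.
      have := knot_lb kn Dr; rewrite -/K => hk.
      have {hk} hk : 1 <= 2 * K * knot (J n) r.
        by rewrite -ler_pdivrMl ?mulr_gt0// mulr1.
      set x := h n.+1 r - h n r in f f0 mf *.
      have hx : x ^+ 2 <= 2 * K * f r.
        by rewrite /f mulrA ler_peMl// sqr_ge0.
      have : 0 <= (2 ^+ n * `|x| - 1) ^+ 2 by exact: sqr_ge0.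
      rewrite sqrrB1 exprMn real_normK ?num_real// => hq.
      have : 2 ^+ n * (2 * `|x|) <= 2 ^+ n * (2 ^+ n * x ^+ 2 + (2 ^+ n)^-1).
        rewrite mulrDr divff ?gt_eqF//; move: hq; rewrite expr2; lra.
      rewrite ler_pM2l// => hq2.
      have : 2 ^+ n * x ^+ 2 <= 2 ^+ n * (2 * K * f r) by rewrite ler_pM2l.
      by move: i0; lra.
  apply: ge0_subset_integral => //.
  - apply: measurable_funTS; apply: emeasurable_funD => //.
    by apply: measurable_funeM; exact/measurable_EFinP.
  - by move=> r _; rewrite adde_ge0 ?mule_ge0 ?lee_fin.
rewrite ge0_integralD//; last 2 first.
- by move=> r _; rewrite mule_ge0 ?lee_fin.
- by apply: measurable_funTS; apply: measurable_funeM; exact/measurable_EFinP.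
rewrite ge0_integralZl_EFin//; last 2 first.
- by move=> r _; rewrite lee_fin.
- by apply/measurable_EFinP; exact: measurable_funTS.
rewrite integral_cst//= lebesgue_measure_itv/= lte_fin K0 oppr0 adde0.
apply: (@le_trans _ _ ((2 ^+ n * K)%:E * ((4 ^+ n)^-1)%:E + (2 ^+ n)^-1%:E * K%:E))%E.
  apply: leeD => //; apply: lee_wpmul2l => //.
  apply: le_trans (integral_slope_diff k.+1 (JS n)) _.
  by rewrite lee_fin.
rewrite -!EFinM -EFinD lee_fin.
have -> : (4 : R) = 2 ^+ 2 by rewrite -natrX.
rewrite -exprM mulnC exprM le_eqVlt; apply/orP; left; apply/eqP.
by field; rewrite gt_eqF.
Qed.

Let n0 k := (2 * k.+1)%N.
(** A majorant on [D k] of all [h n] with [n >= n0 k]. Its integrability serves dominated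
    convergence, and at each point where it is finite the sequence [h n] converges. *)
Let G k (r : R) : \bar R :=
  (`|h (n0 k) r|%:E + \sum_(n <oo) `|h (n0 k + n).+1 r - h (n0 k + n) r|%:E)%E.

Let diff_ge0 k n r : (0 <= `|h (n0 k + n).+1 r - h (n0 k + n) r|%:E :> \bar R)%E.
Proof. by rewrite lee_fin. Qed.

Let mdiff k n (E : set mR) : measurable_fun E
  (fun r => `|h (n0 k + n).+1 r - h (n0 k + n) r|%:E : \bar R)%E.
Proof.
apply/measurable_EFinP; apply: measurable_funTS; apply: measurableT_comp => //.
by apply: measurable_funB; exact: mh.
Qed.

Lemma integrable_h k n : leb.-integrable (D k) (EFin \o h n).
Proof.
have := @integrable_cells (2 ^+ J n) (fun l => 2 ^+ J n * cell (J n) l) 0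
  (k.+1 * 2 ^ J n)%N (exp2_gt0 _).
rewrite mul0r natrM natrX mulfK ?gt_eqF ?exp2_gt0//.
move=> hi; apply: integrableS hi => //.
move=> r; rewrite /D/= !in_itv/= => /andP[r1 ->]; rewrite andbT.
by apply: le_trans r1; rewrite invr_ge0.
Qed.

Lemma integrable_G k : leb.-integrable (D k) (G k).
Proof.
have G0 r : (0 <= G k r)%E.
  by rewrite adde_ge0 ?lee_fin// nneseries_ge0// => n _ _; exact: diff_ge0.
have mS : measurable_fun (D k) (fun r =>
    \sum_(n <oo) `|h (n0 k + n).+1 r - h (n0 k + n) r|%:E)%E.
  by apply: ge0_emeasurable_sum => // n; move=> *; exact: mdiff.
have mh0 : measurable_fun (D k) (fun r => `|h (n0 k) r|%:E : \bar R)%E.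
  by apply/measurable_EFinP; apply: measurable_funTS; apply: measurableT_comp => //; exact: mh.
apply/integrableP; split; first exact: emeasurable_funD.
under eq_integral do rewrite gee0_abs//.
rewrite ge0_integralD//; last first.
  by move=> r _; rewrite nneseries_ge0// => n _ _; exact: diff_ge0.
apply: lte_add_pinfty.
  have /integrableP[_] := integrable_h k (n0 k).
  by [].
rewrite integral_nneseries//.
(* The bounds of [integral_h_diff] are dominated by a geometric series with sum [4 * k.+1%:R]. *)
apply: le_lt_trans (ltry (4 * k.+1%:R)).
apply: le_trans (epsilon_trick0 xpredT _); last by rewrite mulr_ge0.
apply: lee_nneseries => [n _ _|n _].
  by apply: integral_ge0 => r _; exact: diff_ge0.
apply: le_trans (integral_h_diff _) _; first by rewrite leq_addr.
rewrite lee_fin natrX exprS invfM mulrA.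
have -> : 4 * k.+1%:R / 2 = 2 * k.+1%:R :> R by field.
rewrite ler_wpM2l ?mulr_ge0// lef_pV2 ?posrE ?exp2_gt0//.
by rewrite ler_weXn2l ?leq_addl// ler1n.
Qed.

Lemma h_le_G k n r : (`|h (n0 k + n) r|%:E <= G k r)%E.
Proof.
have : (`|h (n0 k + n) r|%:E <= `|h (n0 k) r|%:E +
   \sum_(0 <= i < n) `|h (n0 k + i).+1 r - h (n0 k + i) r|%:E)%E.
  elim: n => [|n IH]; first by rewrite addn0 big_geq// adde0.
  rewrite big_nat_recr//= addeA.
  apply: le_trans (leeD IH (lexx _)); rewrite -EFinD lee_fin addnS.
  by rewrite -[X in `|X| <= _](subrK (h (n0 k + n) r)) addrC (le_trans (ler_normD _ _)).
move=> /le_trans; apply; apply: leeD => //.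
by apply: nneseries_lim_ge => i _ _; exact: diff_ge0.
Qed.

Lemma G_cvg k r : (G k r < +oo)%E -> cvgn (fun n => h n r).
Proof.
move=> Goo; pose d n := h (n0 k + n).+1 r - h (n0 k + n) r.
have Soo : (\sum_(n <oo) `|d n|%:E < +oo)%E.
  by apply: le_lt_trans Goo; rewrite leeDr.
have Sfin : (\sum_(n <oo) `|d n|%:E)%E \is a fin_num.
  by rewrite ge0_fin_numE// nneseries_ge0// => n _ _; exact: diff_ge0.
have : cvgn (series d).
  apply: normed_cvg; apply: nondecreasing_is_cvgn.
    apply/nondecreasing_seqP => n.
    by rewrite /= !seriesEnat/= big_nat_recr//= lerDl.
  exists (fine (\sum_(n <oo) `|d n|%:E)%E) => _ [n _ <-].
  rewrite -lee_fin fineK//= -sumEFin.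
  by apply: nneseries_lim_ge => i _ _; rewrite lee_fin.
move=> /cvg_ex[/= l dl].
apply/cvg_ex; exists (h (n0 k) r + l); rewrite -(cvg_shiftn (n0 k)) /=.
have -> : (fun n => h (n + n0 k)%N r) = (fun n => h (n0 k) r + series d n).
  apply/funext => n /=; rewrite /series/= /d.
  under eq_bigr do rewrite -addnS.
  rewrite (telescope_sumr (fun n => h (n0 k + n)%N r))// addn0 addrC subrK.
  by rewrite addnC.
by apply: cvgD => //; exact: cvg_cst.
Qed.

(** An upper limit is measurable and defined everywhere; it is the limit wherever the slopes
    converge, hence at almost every [r > 0]. *)
Let g (r : R) : R := fine (limn_esup (fun n => (h n r)%:E)).

Lemma measurable_g : measurable_fun [set: mR] (g : mR -> mR).
Proof.
apply: (@measurableT_comp _ _ _ _ _ _ (@fine R)) => //.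
by apply: measurable_fun_limn_esup => n; apply/measurable_EFinP; exact: mh.
Qed.

Lemma h_cvg r : cvgn (fun n => h n r) -> h n r @[n --> \oo] --> g r.
Proof.
move=> /cvg_ex[/= l hl]; suff -> : g r = l by [].
have hl' : (h n r)%:E @[n --> \oo] --> l%:E by apply: cvg_EFin => //; exact: nearW.
rewrite /g is_cvg_limn_esupE; first by rewrite (cvg_lim _ hl').
by apply/cvg_ex; exists l%:E.
Qed.

Lemma ae_cvg k : {ae leb, forall r, D k r -> h n r @[n --> \oo] --> g r}.
Proof.
have := integrable_ae (mD k) (integrable_G k); apply: filterS => r.
move=> /[apply] Gfin; apply/h_cvg/(@G_cvg k).
by rewrite ltey; move: Gfin; rewrite fin_numE => /andP[].
Qed.

Lemma knot_cvg (a : R) : 0 < a -> knot (J n) a @[n --> \oo] --> a.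
Proof.
move=> a0; apply/cvgrPdist_le => e e0; near=> n.
rewrite ger0_norm; last by rewrite subr_ge0 knot_le// ltW.
have := knot_gt (J n) a.
have : (2 ^+ J n)^-1 <= e.
  apply: (@le_trans _ _ (n.+1%:R^-1)).
    rewrite lef_pV2 ?posrE ?exp2_gt0 ?ltr0n// -natrX ler_nat.
    by rewrite (leq_ltn_trans (Jn n))// ltn_expl.
  by apply/ltW; near: n; exact: (near_infty_natSinv_lt (PosNum e0)).
by set x := _ ^-1; lra.
Unshelve. all: by end_near. Qed.

Let E a b n : set R := `[knot (J n) a, knot (J n) b[%classic.
Let mE a b n : measurable (E a b n : set mR). Proof. exact: measurable_itv. Qed.

(** The increments of the interpolation telescope between points of its own grid. Rounding [a] and
    [b] down to the grid makes the formula exact; the rounded points return to [a] and [b] in the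
    limit. *)
Lemma integral_h_knots a b n : 0 < a -> a < b ->
  (\int[leb]_(r in E a b n) (h n r)%:E =
   (w (knot (J n) b) - w (knot (J n) a))%:E)%E.
Proof.
move=> a0 ab; rewrite /E /knot.
have ab' : (idx (J n) a <= idx (J n) b)%N.
  rewrite truncn_ge_nat; last by rewrite mulr_ge0 ?ltW ?exp2_gt0// (lt_trans a0).
  apply: (@le_trans _ _ (2 ^+ J n * a)).
    by rewrite truncn_le mulr_ge0// ltW.
  by rewrite ler_pM2l ?exp2_gt0// ltW.
rewrite (@integral_cells (2 ^+ J n) (fun l => 2 ^+ J n * cell (J n) l))//.
rewrite -sum_cell//; congr EFin; apply: eq_bigr => l _.
by field; rewrite gt_eqF ?exp2_gt0.
Qed.

Hypothesis cw : forall r : R, 0 < r -> {for r, continuous w}.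

Lemma integral_g_co a b : 0 < a -> a < b ->
  leb.-integrable `[a, b[ (EFin \o g) /\
  (\int[leb]_(r in `[a, b[) (g r)%:E = (w b - w a)%:E)%E.
Proof.
move=> a0 ab; have b0 : 0 < b by exact: lt_trans ab.
(* [2 / a] rather than [1 / a]: rounding may move the left end point below [a], and the margin
   [a / 2] keeps it inside [D k]. *)
pose k := Num.truncn (Num.max (2 / a) b).
have : Num.max (2 / a) b < k.+1%:R by exact: truncnS_gt.
rewrite gt_max => /andP[ka kb].
have k0 : 0 < k.+1%:R :> R by rewrite ltr0n.
have ka' : k.+1%:R^-1 < a / 2 by rewrite -[ltRHS]invrK invf_div ltf_pV2 ?posrE// divr_gt0.
have ED n : E a b (n0 k + n) `<=` D k.
  move=> r; rewrite /E /D/= !in_itv/= => /andP[r1 r2]; apply/andP; split; last first.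
    by rewrite (lt_le_trans r2)// (le_trans (knot_le _ (ltW b0)))// ltW.
  apply: le_trans r1; apply: le_trans (ltW (knot_gt _ _)).
  have : (2 ^+ J (n0 k + n))^-1 <= (k.+1%:R)^-1 :> R.
    rewrite lef_pV2 ?posrE ?exp2_gt0// -natrX ler_nat.
    rewrite (leq_trans _ (ltnW (ltn_expl _ _)))//.
    rewrite (leq_trans _ (Jn _))// (leq_trans _ (leq_addr _ _))//.
    by rewrite /n0 leq_pmull.
  by move: ka'; set x := k.+1%:R^-1; set y := (2 ^+ J _)^-1; lra.
have abD : `[a, b[ `<=` D k.
  move=> r; rewrite /D/= !in_itv/= => /andP[r1 r2].
  rewrite (lt_trans r2 kb) andbT (le_trans (ltW ka'))//.
  by rewrite (le_trans _ r1)// ler_pdivrMr// ler_peMr ?ltW// ltr1n.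
pose F n : R -> \bar R := (EFin \o h (n0 k + n)) \_ (E a b (n0 k + n)).
have mF n : measurable_fun (D k) (F n : mR -> \bar R).
  apply/(measurable_restrict _ (mE _ _ _) (mD k)).
  by apply: measurable_funTS; apply/measurable_EFinP; exact: mh.
have mg' : measurable_fun [set: mR] (EFin \o g) by apply/measurable_EFinP; exact: measurable_g.
have mgab : measurable_fun (D k) ((EFin \o g) \_ `[a, b[ : mR -> \bar R).
  by apply/(measurable_restrict _ (measurable_itv _) (mD k)); exact: measurable_funTS.
have [] := @dominated_convergence _ _ _ leb (D k) (mD k) F
  ((EFin \o g) \_ `[a, b[) (G k) mF mgab.
- apply: ae_sub (ae_cvg k) => r /[apply] hr; rewrite /F.
  have hr' : h (n0 k + n)%N r @[n --> \oo] --> g r.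
    exact: (@cvg_shiftl _ (fun n => h n r)).
  have knot_shift x : 0 < x -> knot (J (n0 k + n)) x @[n --> \oo] --> x.
    by move=> x0; apply: (@cvg_shiftl _ (fun n => knot (J n) x)); exact: knot_cvg.
  rewrite patchE mem_setE in_itv/=.
  (* Rounded points never exceed the original ones and eventually exceed everything below them. So
     the indicators of the rounded intervals converge to that of [[a, b[] at every point, end points
     included. *)
  have [br|rb] := leP b r.
    rewrite andbF; apply: cvg_near_cst; apply: nearW => n.
    rewrite patchE mem_setE in_itv/= [X in _ && X]ltNge (le_trans (knot_le _ (ltW b0)) br).
    by rewrite andbF.
  rewrite andbT; have [ar|ra] := leP a r.
    apply: (@cvg_trans _ ((h (n0 k + n) r)%:E @[n --> \oo])).
      apply: near_eq_cvg; near=> n.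
      rewrite patchE mem_setE in_itv/= (le_trans (knot_le _ (ltW a0)) ar)/=.
      have -> : r < knot (J (n0 k + n)) b by near: n; exact: (cvgr_gt _ (knot_shift b b0)).
      by [].
    by apply: cvg_EFin => //; exact: nearW.
  apply: cvg_near_cst; near=> n; rewrite patchE mem_setE in_itv/= leNgt.
  have -> : r < knot (J (n0 k + n)) a by near: n; exact: (cvgr_gt _ (knot_shift a a0)).
  by [].
- exact: integrable_G.
- apply: aeW => r n _; rewrite /F patchE; case: ifPn => _; first exact: h_le_G.
  by rewrite abse0; apply: le_trans (h_le_G k 0 r); rewrite lee_fin.
move=> ig _ cvgF; split.
  rewrite (_ : `[a, b[%classic = D k `&` `[a, b[ :> set R); last by rewrite setIidr.
  by apply/(integrable_restrict leb (measurable_itv `[a, b[) (mD k)); exact: ig.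
have -> : (\int[leb]_(r in `[a, b[) (g r)%:E = \int[leb]_(r in D k) ((EFin \o g) \_ `[a, b[) r)%E.
  by rewrite -integral_mkcondr setIidr.
rewrite -(cvg_lim _ cvgF)//; apply/cvg_lim => //.
have -> : (fun n => \int[leb]_(r in D k) F n r)%E =
    (fun n => (w (knot (J (n0 k + n)) b) - w (knot (J (n0 k + n)) a))%:E).
  apply/funext => n; rewrite /F -integral_mkcondr setIidr//.
  exact: integral_h_knots.
apply: cvg_EFin; first exact: nearW.
apply: (@cvg_shiftl _ (fun n => w (knot (J n) b) - w (knot (J n) a))).
apply: cvgB.
  by apply: continuous_cvg; [exact: cw|exact: knot_cvg].
by apply: continuous_cvg; [exact: cw|exact: knot_cvg].
Unshelve. all: by end_near. Qed.

Lemma integral_g_cc a b : 0 < a -> a < b ->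
  leb.-integrable `[a, b] (EFin \o g) /\
  ((w b - w a)%:E = \int[leb]_(r in `[a, b]) (g r)%:E)%E.
Proof.
move=> a0 ab; have [_ Iab] := integral_g_co a0 ab; split; last first.
  rewrite -Iab; apply: integral_itv_bndo_bndc.
  by apply: measurable_funTS; apply/measurable_EFinP; exact: measurable_g.
(* A half-open interval that contains the closed one. *)
have [] := @integral_g_co a (b + 1) a0; first by rewrite (lt_trans ab)// ltrDl.
move=> + _; apply: integrableS => //.
by apply: subset_itvl; rewrite bnd_simp/= ltrDl.
Qed.

Lemma integral_g_sqr : (\int[leb]_(r in `]0%R, +oo[) (r * g r ^+ 2)%:E <= S%:E)%E.
Proof.
pose f n r := knot (J n) r * h n r ^+ 2.
have mf n : measurable_fun [set: mR] (f n : mR -> mR).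
  apply: measurable_funM; first exact: measurable_knot.
  by apply: measurable_funX; exact: mh.
have f0 n r : 0 <= f n r by rewrite mulr_ge0 ?knot_ge0 ?sqr_ge0.
(* Cutting at an integer radius makes [integral_energy] applicable; the cut recedes to infinity with
   [n]. *)
pose F n : R -> \bar R := (EFin \o f n) \_ `[0, n%:R[.
have mF n : measurable_fun [set: mR] (F n : mR -> \bar R).
  apply/(measurable_restrictT (EFin \o f n : mR -> \bar R) (measurable_itv `[0, n%:R[)).
  by apply: measurable_funTS; apply/measurable_EFinP; exact: mf.
apply: (@fatou_le _ _ _ leb _ F _ (fun=> S)) => //.
- by move=> n; apply: measurable_funTS.
- apply: measurable_funTS; apply/measurable_EFinP; apply: measurable_funM => //.
  by apply: measurable_funX; exact: measurable_g.
- move=> n r _; rewrite /F patchE; case: ifPn => // _.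
  by rewrite lee_fin.
- by move=> r; rewrite /= in_itv/= andbT => r0; rewrite lee_fin mulr_ge0 ?sqr_ge0// ltW.
- have : {ae leb, forall r, forall k, D k r -> h n r @[n --> \oo] --> g r}.
    by apply: ae_foralln => k; exact: ae_cvg.
  apply: ae_sub => r hr; rewrite /= in_itv/= andbT => r0.
  apply: cvg_le_limn_einf.
  have {}hr : h n r @[n --> \oo] --> g r.
    pose k := Num.truncn (Num.max r^-1 r).
    have : Num.max r^-1 r < k.+1%:R by exact: truncnS_gt.
    rewrite gt_max => /andP[k1 k2]; apply: (hr k).
    rewrite /D/= in_itv/= k2 andbT ltW// -[ltRHS]invrK ltf_pV2 ?posrE ?invr_gt0//.
  apply: (@cvg_trans _ ((f n r)%:E @[n --> \oo])).
    apply: near_eq_cvg; near=> n; rewrite /F patchE mem_setE in_itv/= (ltW r0)/=.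
    have -> : r < n%:R.
      by near: n; exact: nbhs_infty_gtr.
    by [].
  apply: cvg_EFin; first exact: nearW.
  apply: cvgM; first exact: knot_cvg.
  by under eq_cvg do rewrite expr2; rewrite expr2; apply: cvgM.
- move=> n; rewrite /F -integral_mkcondr.
  apply: (@le_trans _ _ (\int[leb]_(r in `[0%R, n%:R[) (f n r)%:E)%E).
    apply: ge0_subset_integral => //.
    + by apply: measurableI.
    + by apply: measurable_funTS; apply/measurable_EFinP; exact: mf.
    + by move=> r _; rewrite lee_fin.
  by rewrite (integral_energy (J n) n) lee_fin.
- exact: cvg_cst.
Unshelve. all: by end_near. Qed.

End riesz.

(* Bounded dyadic energies force the dyadic slopes to be Cauchy in L^2 (they
   form a martingale), and their limit is the weak derivative. *)
Lemma energy_bound_deriv (R : realType) (w : R -> R) (S : R) :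
  measurable_fun [set: measurableTypeR R] (w : _ -> measurableTypeR R) ->
  (forall r : R, 0 < r -> {for r, continuous w}) ->
  (forall j N, energy w j N <= S) ->
  exists g : R -> R, radial_deriv w g /\
    (\int[lebesgue_measure]_(r in `]0%R, +oo[) (r * g r ^+ 2)%:E <= S%:E)%E.
Proof.
move=> mw cw wS; have [J [Jn JS Jt]] := fast_subsequence wS.
exists (fun r => fine (limn_esup (fun n => (slope w (J n) r)%:E))); split.
- split=> //; split; first exact: measurable_g.
  by move=> a b a0 ab; exact: (integral_g_cc wS Jn JS Jt cw a0 ab).
- exact: (integral_g_sqr wS Jn JS Jt).
Qed.

(** * Estimates for the modulus of a radial function *)

Section energy_estimates.
Context {R : realType}.
Notation leb := (@lebesgue_measure R).
Notation mR := (measurableTypeR R).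

(** Cauchy-Schwarz with the weight lowered to [a]. It follows by integrating the tangent inequality
    [dv ^+ 2 >= 2 * m * dv - m ^+ 2], taken at the mean slope [m], where it gives the best
    constant. *)
Lemma deriv_increment (v dv : R -> R) (a b : R) : radial_deriv v dv ->
  0 < a -> a < b ->
  ((a * (v b - v a) ^+ 2 / (b - a))%:E <=
   \int[leb]_(r in `[a, b[) (r * dv r ^+ 2)%:E)%E.
Proof.
move=> [mv [mdv vdv]] a0 ab; have [idv Idv] := vdv a b a0 ab.
have L0 : 0 < b - a by rewrite subr_gt0.
set Dv := v b - v a in Idv *; pose m := Dv / (b - a).
have mq : measurable_fun [set: mR] ((fun r => r * dv r ^+ 2) : mR -> mR).
  by apply: measurable_funM => //; apply: measurable_funX.
have q0 r : a <= r -> (0 <= (r * dv r ^+ 2)%:E)%E.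
  by move=> ar; rewrite lee_fin mulr_ge0 ?sqr_ge0// (le_trans (ltW a0)).
have [qoo|] := ltP (\int[leb]_(r in `[a, b[) (r * dv r ^+ 2)%:E)%E +oo%E; last first.
  by rewrite leye_eq => /eqP ->; rewrite leey.
have iq : leb.-integrable `[a, b[ (EFin \o (fun r => r * dv r ^+ 2)).
  apply/integrableP; split; first by apply/measurable_EFinP; exact: measurable_funTS.
  apply: le_lt_trans qoo; rewrite le_eqVlt; apply/orP; left; apply/eqP.
  apply: eq_integral => r.
  by rewrite inE/= in_itv/= => /andP[ar _]; rewrite ger0_norm// -lee_fin q0.
have idv' : leb.-integrable `[a, b[ (EFin \o dv).
  by apply: integrableS idv => //; apply: subset_itvl; rewrite bnd_simp.
have ic : leb.-integrable `[a, b[ (EFin \o cst (m ^+ 2)).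
  apply: measurable_bounded_integrable => //.
    by rewrite [ltLHS]lebesgue_measure_itv/= lte_fin ab -EFinB ltry.
  exact: bounded_cst.
have i2 : leb.-integrable `[a, b[ (fun r => a%:E * ((2 * m)%:E * (dv r)%:E - (m ^+ 2)%:E))%E.
  apply: integrableZl => //; apply: integrableB => //.
  by apply: integrableZl.
have : (\int[leb]_(r in `[a, b[) (a%:E * ((2 * m)%:E * (dv r)%:E - (m ^+ 2)%:E)) <=
  \int[leb]_(r in `[a, b[) (r * dv r ^+ 2)%:E)%E.
  apply: le_integral => // r; rewrite inE/= in_itv/= => /andP[ar _].
  rewrite -(EFinM (2 * m)) -EFinD -(EFinM a) lee_fin.
  apply: (@le_trans _ _ (a * dv r ^+ 2)); last by rewrite ler_wpM2r ?sqr_ge0.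
  rewrite ler_pM2l//; have := sqr_ge0 (dv r - m); rewrite sqrrB; lra.
apply: le_trans.
rewrite integralZl//; last by apply: integrableB => //; exact: integrableZl.
rewrite integralB//; last exact: integrableZl.
rewrite integralZl// integral_cst//= lebesgue_measure_itv/= lte_fin ab.
have -> : (\int[leb]_(r in `[a, b[) (dv r)%:E = Dv%:E)%E.
  rewrite Idv; apply: integral_itv_bndo_bndc.
  by apply: measurable_funTS; exact/measurable_EFinP.
rewrite -(EFinD b) -(EFinM (m ^+ 2)) -(EFinM (2 * m)) -EFinB -(EFinM a) lee_fin le_eqVlt; apply/orP; left; apply/eqP.
by rewrite /m; field; rewrite gt_eqF.
Qed.

(** The reverse triangle inequality: passing to the modulus does not enlarge increments, so the
    modulus inherits the energy bounds without having its derivative computed. *)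
Lemma sqr_sqrtB_le (x y x' y' : R) :
  (Num.sqrt (x ^+ 2 + y ^+ 2) - Num.sqrt (x' ^+ 2 + y' ^+ 2)) ^+ 2 <=
  (x - x') ^+ 2 + (y - y') ^+ 2.
Proof.
have A0 : 0 <= x ^+ 2 + y ^+ 2 by rewrite addr_ge0 ?sqr_ge0.
have B0 : 0 <= x' ^+ 2 + y' ^+ 2 by rewrite addr_ge0 ?sqr_ge0.
rewrite sqrrB !sqr_sqrtr// -sqrtrM//.
have : x * x' + y * y' <= Num.sqrt ((x ^+ 2 + y ^+ 2) * (x' ^+ 2 + y' ^+ 2)).
  apply: le_trans (ler_norm _) _; rewrite -sqrtr_sqr ler_sqrt; last exact: mulr_ge0.
  rewrite -subr_ge0; have := sqr_ge0 (x * y' - y * x').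
  by congr (0 <= _); ring.
rewrite !expr2; set s := Num.sqrt _; lra.
Qed.

(* Set to [0] on [r <= 0], which no [eucl x] with [x != 0] reaches, so that
   bounds and convergence hold for all [r]. *)
Definition modulus (u : radial R) (r : R) : R :=
  if 0 < r then Num.sqrt (re_p u r ^+ 2 + im_p u r ^+ 2) else 0.

Lemma modulus_ge0 u r : 0 <= modulus u r.
Proof. by rewrite /modulus; case: ifP => // _; exact: sqrtr_ge0. Qed.

Lemma sqr_modulus u r : 0 < r ->
  modulus u r ^+ 2 = re_p u r ^+ 2 + im_p u r ^+ 2.
Proof. by move=> r0; rewrite /modulus r0 sqr_sqrtr// addr_ge0 ?sqr_ge0. Qed.

Variables (u : radial R) (T : R).
Hypotheses (du : radial_deriv (re_p u) (dre_p u))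
  (dv : radial_deriv (im_p u) (dim_p u)).
Let q r := r * (dre_p u r ^+ 2 + dim_p u r ^+ 2).
Hypothesis qT : (\int[leb]_(r in `]0%R, +oo[) (q r)%:E <= T%:E)%E.

Let mq : measurable_fun [set: mR] (q : mR -> mR).
Proof.
move: du dv => [_ [m1 _]] [_ [m2 _]].
by apply: measurable_funM => //; apply: measurable_funD; exact: measurable_funX.
Qed.

Let q_ge0 r : 0 <= r -> 0 <= q r.
Proof. by move=> r0; rewrite mulr_ge0// addr_ge0 ?sqr_ge0. Qed.

Lemma modulus_increment a b : 0 < a -> a < b ->
  ((a * (modulus u b - modulus u a) ^+ 2 / (b - a))%:E <=
   \int[leb]_(r in `[a, b[) (q r)%:E)%E.
Proof.
move=> a0 ab; have b0 := lt_trans a0 ab.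
have := leeD (deriv_increment du a0 ab) (deriv_increment dv a0 ab).
rewrite -ge0_integralD//; last 4 first.
- by move=> r; rewrite /= in_itv/= => /andP[ar _]; rewrite lee_fin mulr_ge0 ?sqr_ge0// (le_trans (ltW a0)).
- apply/measurable_EFinP; apply: measurable_funTS; apply: measurable_funM => //.
  by move: du => [_ [m1 _]]; exact: measurable_funX.
- by move=> r; rewrite /= in_itv/= => /andP[ar _]; rewrite lee_fin mulr_ge0 ?sqr_ge0// (le_trans (ltW a0)).
- apply/measurable_EFinP; apply: measurable_funTS; apply: measurable_funM => //.
  by move: dv => [_ [m1 _]]; exact: measurable_funX.
under eq_integral do rewrite -EFinD -mulrDr.
apply: le_trans; rewrite -EFinD lee_fin -mulrDl ler_pM2r ?invr_gt0 ?subr_gt0//.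
rewrite -mulrDr ler_pM2l// /modulus a0 b0.
exact: sqr_sqrtB_le.
Qed.

Lemma modulus_equicont a b : 0 < a -> a < b ->
  a * (modulus u b - modulus u a) ^+ 2 <= (b - a) * T.
Proof.
move=> a0 ab; rewrite -ler_pdivrMl ?subr_gt0// mulrC -lee_fin.
apply: le_trans (modulus_increment a0 ab) _; apply: le_trans qT.
apply: ge0_subset_integral => //.
- by apply/measurable_EFinP; exact: measurable_funTS.
- by move=> r; rewrite /= in_itv/= andbT => r0; rewrite lee_fin q_ge0// ltW.
- by move=> r; rewrite /= !in_itv/= => /andP[ar _]; rewrite (lt_le_trans a0).
Qed.

Lemma modulus_energy j N : energy (modulus u) j N <= T.
Proof.
have T0 : 0 <= T.
  rewrite -lee_fin; apply: le_trans qT; apply: integral_ge0 => r.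
  by rewrite /= in_itv/= andbT => r0; rewrite lee_fin q_ge0// ltW.
case: N => [|N]; first by rewrite /energy big_geq.
have M0 : 0 < 2 ^+ j :> R by rewrite exprn_gt0.
(* The cell that touches the origin has weight [0], so the integral can start at [1 / 2 ^+ j], where
   increments are controlled. *)
suff : ((energy (modulus u) j N.+1)%:E <=
    \int[leb]_(r in `[(1 / 2 ^+ j)%R, (N.+1%:R / 2 ^+ j)%R[) (q r)%:E)%E.
  rewrite -lee_fin => /le_trans; apply; apply: le_trans qT.
  apply: ge0_subset_integral => //.
  - by apply/measurable_EFinP; exact: measurable_funTS.
  - by move=> r; rewrite /= in_itv/= andbT => r0; rewrite lee_fin q_ge0// ltW.
  - by move=> r; rewrite /= !in_itv/= andbT => /andP[ar _]; rewrite (lt_le_trans _ ar)// divr_gt0.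
elim: N => [|N IH].
  rewrite /energy big_nat1 mul0r; apply: integral_ge0 => r.
  rewrite /= in_itv/= => /andP[ar _].
  by rewrite lee_fin q_ge0// (le_trans _ ar)// ltW// divr_gt0.
have c1 : 1 / 2 ^+ j <= N.+1%:R / 2 ^+ j :> R by rewrite ler_pM2r ?invr_gt0// ler1n.
have c2 : N.+1%:R / 2 ^+ j < N.+2%:R / 2 ^+ j :> R by rewrite ltr_pM2r ?invr_gt0// ltr_nat.
have ge0 r : 1 / 2 ^+ j <= r -> (0 <= (q r)%:E)%E.
  by move=> ar; rewrite lee_fin q_ge0// (le_trans _ ar)// ltW// divr_gt0.
rewrite (@itv_bndbnd_setU _ _ _ (BLeft (N.+1%:R / 2 ^+ j))); last 2 first.
- by rewrite bnd_simp.
- by rewrite bnd_simp ltW.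
rewrite ge0_integral_setU//=; last 3 first.
- by apply/measurable_EFinP; exact: measurable_funTS.
- by move=> r []; rewrite /= in_itv/= => /andP[ar _]; apply: ge0 => //; rewrite (le_trans c1).
- apply/disj_setPS => r /= []; rewrite !in_itv/= => /andP[_ h1] /andP[h2 _].
  by move: h1; rewrite ltNge h2.
rewrite /energy big_nat_recr//= EFinD; apply: leeD; first exact: IH.
apply: le_trans (modulus_increment _ c2); last by rewrite divr_gt0.
rewrite lee_fin le_eqVlt; apply/orP; left; apply/eqP.
rewrite -mulrBl -natrB ?leqnSn// subSnn /cell; field.
by rewrite gt_eqF.
Qed.

Variable T' : R.
Hypothesis pT' : (\int[leb]_(r in `]0%R, +oo[)
  (r * (modulus u r ^+ 2 / r ^+ 2))%:E <= T'%:E)%E.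

Lemma measurable_modulus : measurable_fun [set: mR] (modulus u : mR -> mR).
Proof.
move: du dv => [m1 _] [m2 _].
apply: measurable_fun_ifT => //.
  exact: measurable_fun_ltr.
have ms : measurable_fun [set: R] (@Num.sqrt R).
  by apply: continuous_measurable_fun; apply: sqrt_continuous.
by apply: (measurableT_comp ms); apply: measurable_funD; exact: measurable_funX.
Qed.

(** Averaging over [[r, 2 * r[]: there the modulus differs from its value at [r] by at most the
    square root of [T], while the centrifugal integral controls the mean of its square. Both
    quantities are scale invariant, hence a bound free of [r]. *)
Lemma modulus_bound r : 0 < r -> modulus u r ^+ 2 <= 4 * T' + 2 * T.
Proof.
move=> r0; pose p s := s * (modulus u s ^+ 2 / s ^+ 2).
have r2 : r < 2 * r by rewrite ltr_pMl// ltr1n.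
have mp : measurable_fun [set: mR] (p : mR -> mR).
  apply: measurable_funM => //; apply: measurable_funM.
    by apply: measurable_funX; exact: measurable_modulus.
  by apply: (measurableT_comp (@measurable_invr R)); exact: measurable_funX.
have p0 s : 0 < s -> 0 <= p s.
  by move=> s0; rewrite mulr_ge0 ?divr_ge0 ?sqr_ge0// ltW.
have : (\int[leb]_(s in `[r, (2 * r)%R[) (cst (modulus u r ^+ 2)%:E s) <=
   \int[leb]_(s in `[r, (2 * r)%R[) ((4 * r)%:E * (p s)%:E + (2 * T)%:E))%E.
  apply: ge0_le_integral => //.
  - by move=> s _; rewrite lee_fin sqr_ge0.
  - apply: measurable_funTS; apply: emeasurable_funD => //.
    by apply: measurable_funeM; exact/measurable_EFinP.
  - move=> s; rewrite /= in_itv/= => /andP[rs s2]; rewrite lee_fin.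
    have s0 : 0 < s by exact: lt_le_trans rs.
    have h : (modulus u s - modulus u r) ^+ 2 <= T.
      move: rs; rewrite le_eqVlt => /predU1P[<-|rs].
        by rewrite subrr expr0n/= (le_trans (energy_ge0 (modulus u) 0 0))// modulus_energy.
      rewrite -(ler_pM2l r0); apply: le_trans (modulus_equicont r0 rs) _.
      have T0 : 0 <= T by rewrite (le_trans (energy_ge0 (modulus u) 0 0))// modulus_energy.
      by rewrite ler_wpM2r// lerBlDr; lra.
    have -> : p s = modulus u s ^+ 2 / s by rewrite /p; field; rewrite gt_eqF.
    have : modulus u s ^+ 2 <= 2 * r * (modulus u s ^+ 2 / s).
      by rewrite mulrA -mulrAC ler_peMl ?sqr_ge0// ler_pdivlMr// mul1r ltW.
    (* This square is [2 * Y ^+ 2 + 2 * (Y - X) ^+ 2 - X ^+ 2], for the values [X] at [r] and [Y] at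
       [s]. *)
    have := sqr_ge0 (2 * modulus u s - modulus u r).
    by move: h; set X := modulus u r; set Y := modulus u s; rewrite !expr2; lra.
rewrite integral_cst//= lebesgue_measure_itv/= lte_fin r2 -EFinB -EFinM.
rewrite ge0_integralD//; last 3 first.
- move=> s; rewrite /= in_itv/= => /andP[rs _].
  by rewrite -EFinM lee_fin mulr_ge0 ?p0 ?mulr_ge0// ?ltW// (lt_le_trans r0).
- by apply: measurable_funTS; apply: measurable_funeM; exact/measurable_EFinP.
- by move=> s _; rewrite lee_fin mulr_ge0// (le_trans (energy_ge0 (modulus u) 0 0))// modulus_energy.
rewrite ge0_integralZl_EFin//; last 3 first.
- by move=> s; rewrite /= in_itv/= => /andP[rs _]; rewrite lee_fin p0// (lt_le_trans r0).
- by apply/measurable_EFinP; exact: measurable_funTS.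
- by rewrite mulr_ge0// ltW.
rewrite integral_cst//= lebesgue_measure_itv/= lte_fin r2 -EFinB => h.
have := le_trans h (leeD (lee_wpmul2l _ (_ : _ <= T'%:E)%E) (lexx _)).
rewrite -!EFinM -EFinD !lee_fin.
have -> : 2 * r - r = r by ring.
move=> hh; have {}hh : modulus u r ^+ 2 * r <= 4 * r * T' + 2 * T * r.
  apply: hh; first by rewrite mulr_ge0// ltW.
  apply: le_trans pT'; apply: ge0_subset_integral => //.
  - by apply/measurable_EFinP; exact: measurable_funTS.
  - by move=> s; rewrite /= in_itv/= andbT => s0; rewrite lee_fin p0.
  - by move=> s; rewrite /= !in_itv/= => /andP[rs _]; rewrite (lt_le_trans r0).
by rewrite -(ler_pM2r r0); lra.
Qed.

End energy_estimates.

(** * The logarithmic potential *)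

Section log_kernel.
Context {R : realType}.
Notation leb := (@lebesgue_measure R).
Notation mR := (measurableTypeR R).
Notation mR2 := (mR * mR)%type.
Implicit Types (x y : R * R) (t : R).

Lemma euclN x : eucl (- x) = eucl x.
Proof. by rewrite /eucl /= !sqrrN. Qed.

Lemma eucl_triangle x y : eucl (x + y) <= eucl x + eucl y.
Proof.
case: x y => [x1 x2] [y1 y2]; rewrite -(@ler_pXn2r _ 2) ?nnegrE ?addr_ge0 ?eucl_ge0//.
have A0 : 0 <= x1 ^+ 2 + x2 ^+ 2 by rewrite addr_ge0 ?sqr_ge0.
have B0 : 0 <= y1 ^+ 2 + y2 ^+ 2 by rewrite addr_ge0 ?sqr_ge0.
rewrite /eucl /= [leRHS]sqrrD (sqr_sqrtr A0) (sqr_sqrtr B0) -(sqrtrM _ A0).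
rewrite sqr_sqrtr ?addr_ge0 ?sqr_ge0//.
have : x1 * y1 + x2 * y2 <= Num.sqrt ((x1 ^+ 2 + x2 ^+ 2) * (y1 ^+ 2 + y2 ^+ 2)).
  apply: le_trans (ler_norm _) _; rewrite -sqrtr_sqr ler_sqrt; last exact: mulr_ge0.
  rewrite -subr_ge0; have := sqr_ge0 (x1 * y2 - x2 * y1).
  by congr (0 <= _); ring.
set s := Num.sqrt _; rewrite !expr2; lra.
Qed.

(** The convention [ln 0 = 0] makes [lnp] and [lnm] vanish at [0], so the estimates also hold at
    coinciding points [x = y]. *)
Definition lnp t : R := Num.max 0 (ln t).
Definition lnm t : R := Num.max 0 (- ln t).

Lemma lnp_ge0 t : 0 <= lnp t. Proof. by rewrite le_max lexx. Qed.
Lemma lnm_ge0 t : 0 <= lnm t. Proof. by rewrite le_max lexx. Qed.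

Lemma ln_lnpm t : ln t = lnp t - lnm t.
Proof. by rewrite /lnp /lnm; case: (ltP 0 (ln t)); case: (ltP 0 (- ln t)); lra. Qed.

Lemma le_lnp s t : 0 <= s -> s <= t -> lnp s <= lnp t.
Proof.
rewrite le_eqVlt => /predU1P[<- _|s0 st]; first by rewrite /lnp ln0// maxxx lnp_ge0.
rewrite /lnp ge_max le_max lexx/= le_max ler_ln ?posrE ?st ?orbT//.
exact: lt_le_trans st.
Qed.

(** From [|x - y| <= (1 + |x|) * (1 + |y|)]; the kernel is thus bounded by a sum of functions of one
    variable, which the logarithmic weight integrates. *)
Lemma lnp_le x y : lnp (eucl (x - y)) <= ln (1 + eucl x) + ln (1 + eucl y).
Proof.
have [x0 y0] := (eucl_ge0 x, eucl_ge0 y).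
have h : eucl (x - y) <= (1 + eucl x) * (1 + eucl y).
  have := eucl_triangle x (- y); rewrite euclN.
  have : 0 <= eucl x * eucl y by exact: mulr_ge0.
  lra.
apply: le_trans (le_lnp (eucl_ge0 _) h) _.
rewrite -lnM ?posrE ?ltr_pwDl// /lnp ge_max lexx andbT ln_ge0//.
by rewrite mulr_ege1// lerDl.
Qed.

Lemma lnp_ge x y : lnp (eucl x) <= lnp (eucl (x - y)) + lnp (eucl (x + y)).
Proof.
have : eucl x <= Num.max (eucl (x - y)) (eucl (x + y)).
  have := eucl_triangle (x - y) (x + y).
  have -> : x - y + (x + y) = (2 * x.1, 2 * x.2).
    by case: x y => [x1 x2] [y1 y2]; congr pair => /=; ring.
  rewrite eucl_scale// le_max; case: leP => //= h1 h2; lra.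
rewrite le_max => /orP[] /(le_lnp (eucl_ge0 _)) h.
  by apply: le_trans h _; rewrite lerDl lnp_ge0.
by apply: le_trans h _; rewrite lerDr lnp_ge0.
Qed.

Lemma lnm_le (e t : R) : 0 < e -> e <= 1 ->
  lnm t <= lnm t * (t < e)%R%:R + ln e^-1.
Proof.
move=> e0 e1.
have l0 : 0 <= ln e^-1 by rewrite ln_ge0// -[leLHS]invr1 lef_pV2 ?posrE.
have [te|et] := ltP t e; first by rewrite mulr1 lerDl.
rewrite mulr0 add0r /lnm ge_max l0/= lnV ?posrE// lerN2.
by rewrite ler_ln ?posrE// (lt_le_trans e0).
Qed.

Lemma lnm_small t : 0 < t -> t < 1 -> t * lnm t <= 1.
Proof.
move=> t0 t1; rewrite /lnm maxr_pMr ?(ltW t0)// mulr0 ge_max ler01/=.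
rewrite -lnV ?posrE// -ler_pdivlMl// mulr1.
by rewrite ltW// ln_sublinear// invr_gt0.
Qed.

Lemma measurable_lnp : measurable_fun [set: mR] (lnp : mR -> mR).
Proof. by apply: measurable_maxr => //; exact: measurable_ln. Qed.

Lemma measurable_lnm : measurable_fun [set: mR] (lnm : mR -> mR).
Proof. by apply: measurable_maxr => //; apply: measurableT_comp => //; exact: measurable_ln. Qed.

Lemma measurable_lt_const (e : R) : measurable_fun [set: mR] ((fun t => (t < e)%R%:R) : mR -> mR).
Proof.
have -> : (fun t : R => (t < e)%R%:R : R) = \1_(`]-oo, e[%classic : set R).
  by apply/funext => t; rewrite indicE mem_setE in_itv.
exact: measurable_indic.
Qed.

(** In polar coordinates the factor [t] absorbs the logarithm, by [lnm_small]. The linear order in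
    [e] is not the true one, but the absorption only needs a bound that tends to [0] with [e]. *)
Lemma integral_lnm_small (e : R) : 0 < e -> e <= 1 ->
  (\int[leb2]_z (lnm (eucl z) * (eucl z < e)%R%:R)%:E <= (2 * disk_area * e)%:E)%E.
Proof.
move=> e0 e1; have da0 : 0 < 2 * @disk_area R by rewrite mulr_gt0 ?disk_area_gt0.
have mf : measurable_fun [set: mR] ((fun t => lnm t * (t < e)%R%:R) : mR -> mR).
  by apply: measurable_funM; [exact: measurable_lnm|exact: measurable_lt_const].
rewrite (integral_radial (f := fun t => (lnm t * (t < e)%R%:R)%:E)); last 2 first.
- exact/measurable_EFinP.
- by move=> t; rewrite lee_fin mulr_ge0// lnm_ge0.
pose F : R -> \bar R := (EFin \o cst (2 * disk_area)) \_ `]0, e[.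
apply: (@le_trans _ _ (\int[leb]_(t in `]0%R, +oo[) F t)%E).
  apply: ge0_le_integral => //.
  - move=> t; rewrite /= in_itv/= andbT => t0.
    by rewrite -EFinM lee_fin mulr_ge0 ?mulr_ge0 ?lnm_ge0 ?disk_area_gt0// ltW// disk_area_gt0.
  - apply: measurable_funTS; apply: emeasurable_funM; apply/measurable_EFinP => //.
  - apply: measurable_funTS.
    rewrite /F; apply/(measurable_restrictT (EFin \o cst (2 * disk_area) : mR -> \bar R) (measurable_itv `]0, e[)).
    by apply/measurable_EFinP; exact: measurable_cst.
  - move=> t; rewrite /= in_itv/= andbT => t0.
    rewrite /F patchE mem_setE in_itv/= t0/= -EFinM; case: ltP => te; last by rewrite !mulr0.
    rewrite mulr1 lee_fin -(mulrA _ (t : R)).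
    by apply: ler_piMr; [exact: ltW|rewrite lnm_small// (lt_le_trans te)].
rewrite /F -integral_mkcondr.
rewrite (_ : `]0, +oo[ `&` `]0, e[ = `]0, e[%classic :> set R); last first.
  rewrite setIidr// => t; rewrite /= !in_itv/= => /andP[->] //.
rewrite (eq_integral (cst (2 * disk_area)%:E))//.
by rewrite integral_cst//= lebesgue_measure_itv/= lte_fin e0 oppr0 adde0 -EFinM.
Qed.

Definition lnm_mass : R := fine (\int[leb2]_z (lnm (eucl z))%:E)%E.

Lemma integral_lnm : (\int[leb2]_z (lnm (eucl z))%:E = lnm_mass%:E)%E.
Proof.
rewrite /lnm_mass fineK// ge0_fin_numE; last first.
  by apply: integral_ge0 => z _; rewrite lee_fin lnm_ge0.
apply: le_lt_trans (ltry (2 * disk_area * 1)).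
apply: le_trans (integral_lnm_small ltr01 (lexx 1)).
rewrite le_eqVlt; apply/orP; left; apply/eqP; apply: eq_integral => z _.
congr EFin; case: ltP => h; first by rewrite mulr1.
by rewrite mulr0 /lnm max_l// oppr_le0 ln_ge0.
Qed.

End log_kernel.

(** * Double integrals of the logarithm against a bounded density *)

Section potential.
Context {R : realType}.
Notation leb := (@lebesgue_measure R).
Notation mR := (measurableTypeR R).
Notation mR2 := (mR * mR)%type.
Notation M4 := (@leb2 R \x @leb2 R)%E.
Implicit Types (x y : R * R) (k A B P : R * R -> R).

Lemma measurable_sub2 : measurable_fun [set: mR2 * mR2]
  ((fun z : (R * R) * (R * R) => z.1 - z.2) : mR2 * mR2 -> mR2).
Proof.
have m1 : measurable_fun [set: mR2 * mR2] (fst : mR2 * mR2 -> mR2) by exact: measurable_fst.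
have m2 : measurable_fun [set: mR2 * mR2] (snd : mR2 * mR2 -> mR2) by exact: measurable_snd.
have f1 : measurable_fun [set: mR2] (fst : mR2 -> mR) by exact: measurable_fst.
have f2 : measurable_fun [set: mR2] (snd : mR2 -> mR) by exact: measurable_snd.
apply/measurable_fun_pairP; split => /=.
  have h : measurable_fun [set: mR2 * mR2] ((fun z => (z.1).1 - (z.2).1) : mR2 * mR2 -> mR).
    by apply: measurable_funB; [exact: (measurableT_comp f1 m1)|exact: (measurableT_comp f1 m2)].
  exact: h.
have h : measurable_fun [set: mR2 * mR2] ((fun z => (z.1).2 - (z.2).2) : mR2 * mR2 -> mR).
  by apply: measurable_funB; [exact: (measurableT_comp f2 m1)|exact: (measurableT_comp f2 m2)].
exact: h.
Qed.

Lemma measurable_subl x : measurable_fun [set: mR2] ((fun y => x - y) : mR2 -> mR2).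
Proof.
have f1 : measurable_fun [set: mR2] (fst : mR2 -> mR) by exact: measurable_fst.
have f2 : measurable_fun [set: mR2] (snd : mR2 -> mR) by exact: measurable_snd.
by apply/measurable_fun_pairP; split => /=; apply: measurable_funB.
Qed.

Lemma measurable_kernel k A B : measurable_fun [set: mR2] (k : mR2 -> mR) ->
  measurable_fun [set: mR2] (A : mR2 -> mR) ->
  measurable_fun [set: mR2] (B : mR2 -> mR) ->
  measurable_fun [set: mR2 * mR2]
    ((fun z : (R * R) * (R * R) => A z.1 * k (z.1 - z.2) * B z.2) : mR2 * mR2 -> mR).
Proof.
move=> mk mA mB.
have m1 : measurable_fun [set: mR2 * mR2] (fst : mR2 * mR2 -> mR2) by exact: measurable_fst.
have m2 : measurable_fun [set: mR2 * mR2] (snd : mR2 * mR2 -> mR2) by exact: measurable_snd.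
apply: measurable_funM; last exact: (measurableT_comp mB m2).
apply: measurable_funM; first exact: (measurableT_comp mA m1).
exact: (measurableT_comp mk measurable_sub2).
Qed.

Section kernel.
Variables (k A B : R * R -> R).
Hypotheses (mk : measurable_fun [set: mR2] (k : mR2 -> mR))
  (mA : measurable_fun [set: mR2] (A : mR2 -> mR))
  (mB : measurable_fun [set: mR2] (B : mR2 -> mR))
  (k0 : forall x, 0 <= k x) (A0 : forall x, 0 <= A x) (B0 : forall x, 0 <= B x).

Lemma measurable_kernel_section x :
  measurable_fun [set: mR2] ((fun y => k (x - y) * B y) : mR2 -> mR).
Proof.
by apply: measurable_funM => //; exact: (measurableT_comp mk (measurable_subl x)).
Qed.

Lemma tonelli_kernel :
  (\int[M4]_z (A z.1 * k (z.1 - z.2)%R * B z.2)%:E =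
   \int[leb2]_x ((A x)%:E * \int[leb2]_y (k (x - y)%R * B y)%:E))%E.
Proof.
rewrite fubini_tonelli1; last 2 first.
- by apply/measurable_EFinP; exact: measurable_kernel.
- by move=> z; rewrite lee_fin !mulr_ge0.
apply: eq_integral => x _; rewrite /fubini_F.
rewrite -ge0_integralZl_EFin//; last 2 first.
- by move=> y _; rewrite lee_fin mulr_ge0.
- by apply/measurable_EFinP; exact: measurable_kernel_section.
by apply: eq_integral => y _; rewrite -EFinM mulrA.
Qed.

Lemma measurable_inner :
  measurable_fun [set: mR2] (fun x => \int[leb2]_y (k (x - y)%R * B y)%:E)%E.
Proof.
have m1 : measurable_fun [set: mR2] ((fun=> 1) : mR2 -> mR) by [].
pose f (z : mR2 * mR2) : \bar R := (1 * k (z.1 - z.2) * B z.2)%:E.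
rewrite (_ : (fun x => _) = fubini_F (@leb2 R) f); last first.
  by apply/funext => x; apply: eq_integral => y _; rewrite /f /= mul1r.
apply: measurable_fun_fubini_tonelli_F.
  by apply/measurable_EFinP; exact: (measurable_kernel mk m1 mB).
by move=> z; rewrite lee_fin mul1r mulr_ge0.
Qed.

Lemma tonelli_kernel_le (c : R * R -> R) :
  measurable_fun [set: mR2] (c : mR2 -> mR) -> (forall x, 0 <= c x) ->
  (forall x, \int[leb2]_y (k (x - y)%R * B y)%:E <= (c x)%:E)%E ->
  (\int[M4]_z (A z.1 * k (z.1 - z.2)%R * B z.2)%:E <=
   \int[leb2]_x (A x * c x)%:E)%E.
Proof.
move=> mc c0 kc; rewrite tonelli_kernel; apply: ge0_le_integral => //.
- move=> x _; rewrite mule_ge0 ?lee_fin//; apply: integral_ge0 => y _.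
  by rewrite lee_fin mulr_ge0.
- by apply: emeasurable_funM; [exact/measurable_EFinP|exact: measurable_inner].
- by apply/measurable_EFinP; exact: measurable_funM.
- by move=> x _; rewrite EFinM lee_wpmul2l ?lee_fin.
Qed.

End kernel.

Variables (P : R * R -> R) (C lam a : R).
Hypotheses (mP : measurable_fun [set: mR2] (P : mR2 -> mR))
  (P0 : forall x, 0 <= P x) (PC : forall x, P x <= C)
  (Peven : forall x, P (- x) = P x)
  (intP : (\int[leb2]_x (P x)%:E = lam%:E)%E)
  (intlnP : (\int[leb2]_x (ln (1 + eucl x)%R * P x)%:E = a%:E)%E).

Let K : R := @lnm_mass R.

Let C0 : 0 <= C. Proof. by apply: le_trans (PC 0). Qed.

Let lam0 : 0 <= lam.
Proof. by rewrite -lee_fin -intP; apply: integral_ge0 => x _; rewrite lee_fin. Qed.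

Let lne_ge0 x : 0 <= ln (1 + eucl x).
Proof. by rewrite ln_ge0// lerDl eucl_ge0. Qed.

Let a0 : 0 <= a.
Proof. by rewrite -lee_fin -intlnP; apply: integral_ge0 => x _; rewrite lee_fin mulr_ge0. Qed.

Let mlne : measurable_fun [set: mR2] ((fun x => ln (1 + eucl x)) : mR2 -> mR).
Proof.
have ml : measurable_fun [set: mR] (@ln R : mR -> mR) by exact: measurable_ln.
apply: (measurableT_comp ml); apply: measurable_funD => //.
exact: measurable_eucl.
Qed.

Let mkp : measurable_fun [set: mR2] ((lnp \o @eucl R) : mR2 -> mR).
Proof. exact: (measurableT_comp measurable_lnp measurable_eucl). Qed.

Let mkm : measurable_fun [set: mR2] ((lnm \o @eucl R) : mR2 -> mR).
Proof. exact: (measurableT_comp measurable_lnm measurable_eucl). Qed.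

Let kp0 x : 0 <= (lnp \o eucl) x. Proof. exact: lnp_ge0. Qed.
Let km0 x : 0 <= (lnm \o eucl) x. Proof. exact: lnm_ge0. Qed.

Lemma inner_lnp_le x : (\int[leb2]_y (lnp (eucl (x - y)%R) * P y)%:E <=
  (ln (1 + eucl x) * lam + a)%:E)%E.
Proof.
rewrite EFinD EFinM -intP -intlnP.
rewrite -ge0_integralZl_EFin//; last 2 first.
- by move=> y _; rewrite lee_fin.
- exact/measurable_EFinP.
rewrite -ge0_integralD//; last 4 first.
- by move=> y _; rewrite -EFinM lee_fin mulr_ge0.
- by apply: measurable_funeM; exact/measurable_EFinP.
- by move=> y _; rewrite lee_fin mulr_ge0.
- by apply/measurable_EFinP; exact: measurable_funM.
apply: ge0_le_integral => //.
- by move=> y _; rewrite lee_fin mulr_ge0// lnp_ge0.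
- by apply/measurable_EFinP; exact: (measurable_kernel_section mkp mP).
- apply: emeasurable_funD; first by apply: measurable_funeM; exact/measurable_EFinP.
  by apply/measurable_EFinP; exact: measurable_funM.
- by move=> y _; rewrite -EFinM -EFinD lee_fin -mulrDl ler_wpM2r// lnp_le.
Qed.

Lemma integral_lnp_lty :
  (\int[M4]_z (P z.1 * lnp (eucl (z.1 - z.2)%R) * P z.2)%:E < +oo)%E.
Proof.
apply: le_lt_trans (ltry (a * lam + a * lam)).
have mc : measurable_fun [set: mR2] ((fun x => ln (1 + eucl x) * lam + a) : mR2 -> mR).
  by apply: measurable_funD => //; apply: measurable_funM.
have c0 x : 0 <= ln (1 + eucl x) * lam + a by rewrite addr_ge0// mulr_ge0.
apply: le_trans (tonelli_kernel_le mkp mP mP kp0 P0 P0 mc c0 inner_lnp_le) _.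
under eq_integral do rewrite mulrDr EFinD mulrA [P _ * _]mulrC EFinM [X in (_ + X)%E]EFinM.
rewrite ge0_integralD//; last 4 first.
- by move=> y _; rewrite -EFinM lee_fin !mulr_ge0.
- by apply: emeasurable_funM => //; apply/measurable_EFinP; exact: measurable_funM.
- by move=> y _; rewrite -EFinM lee_fin mulr_ge0.
- by apply: emeasurable_funM => //; exact/measurable_EFinP.
rewrite ge0_integralZr//; last 2 first.
- by apply/measurable_EFinP; exact: measurable_funM.
- by move=> y _; rewrite lee_fin mulr_ge0.
rewrite ge0_integralZr//; last 2 first.
- exact/measurable_EFinP.
- by move=> y _; rewrite lee_fin.
by rewrite intP intlnP -!EFinM -EFinD lee_fin [lam * a]mulrC.
Qed.

(** Reflection and translation invariance evaluate the inner integral, so the value depends on [P]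
    only through its mass. It is the constant that makes the potential nonnegative, common to a
    whole minimizing sequence. *)
Lemma integral_lnm_const :
  (\int[M4]_z (P z.1 * lnm (eucl (z.1 - z.2)%R) * C)%:E = (C * K * lam)%:E)%E.
Proof.
have mC : measurable_fun [set: mR2] ((fun=> C) : mR2 -> mR) by [].
rewrite (tonelli_kernel mkm mP mC km0 P0 (fun=> C0)).
transitivity (\int[leb2]_x ((P x)%:E * (C * K)%:E))%E.
  apply: eq_integral => x _; congr (_ * _)%E.
  under eq_integral do rewrite EFinM.
  rewrite ge0_integralZr//=; last 2 first.
  - by apply/measurable_EFinP; exact: (measurableT_comp mkm (measurable_subl x)).
  - by move=> y _; rewrite lee_fin lnm_ge0.
  rewrite (ge0_integral_reflect x (f := fun y => (lnm (eucl y))%:E)).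
  - by rewrite integral_lnm -EFinM mulrC.
  - exact/measurable_EFinP.
  - by move=> y; rewrite lee_fin lnm_ge0.
rewrite ge0_integralZr//=; last 3 first.
- exact/measurable_EFinP.
- by move=> y _; rewrite lee_fin.
- rewrite lee_fin mulr_ge0// fine_ge0//; apply: integral_ge0 => y _.
  by rewrite lee_fin lnm_ge0.
by rewrite intP -EFinM mulrC.
Qed.

Let integrable_ge0 (f : (R * R) * (R * R) -> R) :
  measurable_fun [set: mR2 * mR2] (f : mR2 * mR2 -> mR) -> (forall z, 0 <= f z) ->
  (\int[M4]_z (f z)%:E < +oo)%E -> M4.-integrable setT (fun z => (f z)%:E).
Proof.
move=> mf f0 foo; apply/integrableP; split; first exact/measurable_EFinP.
by under eq_integral do rewrite gee0_abs ?lee_fin//.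
Qed.

Let mfp := measurable_kernel mkp mP mP.
Let mfm := measurable_kernel mkm mP mP.

Let integrable_lnp :
  M4.-integrable setT (fun z => (P z.1 * lnp (eucl (z.1 - z.2)%R) * P z.2)%:E).
Proof.
apply: integrable_ge0 => //; last exact: integral_lnp_lty.
by move=> z; rewrite !mulr_ge0 ?lnp_ge0.
Qed.

Let integrable_lnmC :
  M4.-integrable setT (fun z => (P z.1 * lnm (eucl (z.1 - z.2)%R) * C)%:E).
Proof.
apply: integrable_ge0.
- exact: (measurable_kernel mkm mP (@measurable_cst _ _ mR2 mR setT C)).
- by move=> z; rewrite !mulr_ge0 ?lnm_ge0.
- by rewrite integral_lnm_const ltry.
Qed.

Let integrable_lnm :
  M4.-integrable setT (fun z => (P z.1 * lnm (eucl (z.1 - z.2)%R) * P z.2)%:E).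
Proof.
apply: le_integrable integrable_lnmC => //; first exact/measurable_EFinP.
move=> z _; rewrite !gee0_abs ?lee_fin ?mulr_ge0 ?lnm_ge0//.
by rewrite ler_wpM2l// mulr_ge0// lnm_ge0.
Qed.

Definition pot : \bar R :=
  (\int[leb2]_x \int[leb2]_y (ln (eucl (x - y)%R) * P x * P y)%:E)%E.

Let pot_split z : ln (eucl (z.1 - z.2)%R) * P z.1 * P z.2 =
  P z.1 * lnp (eucl (z.1 - z.2)) * P z.2 - P z.1 * lnm (eucl (z.1 - z.2)) * P z.2.
Proof. by rewrite ln_lnpm; ring. Qed.

(** The kernel changes sign, so iterated and double integral agree only under integrability: the
    logarithmic weight controls the positive part, the bound [C] the negative one. *)
Lemma integrable_pot :
  M4.-integrable setT (fun z => (ln (eucl (z.1 - z.2)%R) * P z.1 * P z.2)%:E).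
Proof.
rewrite (_ : (fun z => _) = (fun z => (P z.1 * lnp (eucl (z.1 - z.2)%R) * P z.2)%:E
   - (P z.1 * lnm (eucl (z.1 - z.2)%R) * P z.2)%:E)%E); last first.
  by apply/funext => z; rewrite pot_split EFinB.
exact: integrableB.
Qed.

Lemma potE : pot = (\int[M4]_z (ln (eucl (z.1 - z.2)%R) * P z.1 * P z.2)%:E)%E.
Proof. by rewrite -(integral12_prod_meas1 integrable_pot). Qed.

Lemma pot_fin_num : pot \is a fin_num.
Proof. by rewrite potE; exact: integrable_fin_num integrable_pot. Qed.

(** The added term is the negative part with [P z.2] replaced by its upper bound [C]; it
    overcompensates and leaves an integrand fit for Fatou's lemma. *)
Lemma pot_shift_ge0 (z : (R * R) * (R * R)) :
  0 <= ln (eucl (z.1 - z.2)%R) * P z.1 * P z.2 + P z.1 * lnm (eucl (z.1 - z.2)%R) * C.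
Proof.
have h1 : 0 <= P z.1 * lnp (eucl (z.1 - z.2)) * P z.2 by rewrite !mulr_ge0 ?lnp_ge0.
have : 0 <= P z.1 * lnm (eucl (z.1 - z.2)) * (C - P z.2).
  by rewrite !mulr_ge0 ?lnm_ge0// subr_ge0.
by move: h1; rewrite pot_split mulrBr; lra.
Qed.

Lemma pot_shift :
  (pot + (C * K * lam)%:E =
   \int[M4]_z (ln (eucl (z.1 - z.2)%R) * P z.1 * P z.2 +
     P z.1 * lnm (eucl (z.1 - z.2)%R) * C)%:E)%E.
Proof.
by rewrite potE -integral_lnm_const -integralD//; exact: integrable_pot.
Qed.

Let measurable_addl x : measurable_fun [set: mR2] ((fun y => x + y) : mR2 -> mR2).
Proof.
have f1 : measurable_fun [set: mR2] (fst : mR2 -> mR) by exact: measurable_fst.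
have f2 : measurable_fun [set: mR2] (snd : mR2 -> mR) by exact: measurable_snd.
by apply/measurable_fun_pairP; split => /=; apply: measurable_funD.
Qed.

(* Averaging over [y] and [-y], as one of [|x - y|], [|x + y|] is at least [|x|]. *)
Lemma inner_lnp_ge x :
  ((lam / 2 * lnp (eucl x))%:E <= \int[leb2]_y (lnp (eucl (x - y)%R) * P y)%:E)%E.
Proof.
set I := (\int[leb2]_y _)%E.
have mk1 : measurable_fun [set: mR2] ((fun y => lnp (eucl (x - y)) * P y) : mR2 -> mR).
  exact: (measurable_kernel_section mkp mP x).
have mk2 : measurable_fun [set: mR2] ((fun y => lnp (eucl (x + y)) * P y) : mR2 -> mR).
  by apply: measurable_funM => //; exact: (measurableT_comp mkp (measurable_addl x)).
have II : (I = \int[leb2]_y (lnp (eucl (x + y)%R) * P y)%:E)%E.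
  rewrite /I -[RHS](ge0_integral_reflect 0 (f := fun y => (lnp (eucl (x + y)%R) * P y)%:E)).
  - by apply: eq_integral => y _; rewrite sub0r Peven.
  - exact/measurable_EFinP.
  - by move=> y; rewrite lee_fin mulr_ge0// lnp_ge0.
have I0 : (0 <= I)%E.
  by apply: integral_ge0 => y _; rewrite lee_fin mulr_ge0// lnp_ge0.
have : ((lam * lnp (eucl x))%:E <= I + I)%E.
  rewrite {2}II /I -ge0_integralD//=; last 4 first.
  - by move=> y _; rewrite lee_fin mulr_ge0 ?lnp_ge0.
  - exact/measurable_EFinP.
  - by move=> y _; rewrite lee_fin mulr_ge0 ?lnp_ge0.
  - exact/measurable_EFinP.
  rewrite mulrC EFinM -intP -ge0_integralZl_EFin ?lnp_ge0//; last 2 first.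
  - by move=> y _; rewrite lee_fin.
  - exact/measurable_EFinP.
  apply: ge0_le_integral => //.
  - by move=> y _; rewrite -EFinM lee_fin mulr_ge0// lnp_ge0.
  - by apply: measurable_funeM; exact/measurable_EFinP.
  - by apply: emeasurable_funD; exact/measurable_EFinP.
  - by move=> y _; rewrite -EFinM -EFinD lee_fin -mulrDl ler_wpM2r// lnp_ge.
case: I {II} I0 => [i|_ _|//]; last by rewrite leey.
by move=> _; rewrite -EFinD !lee_fin; lra.
Qed.

(** Within distance [e] the density is at most [C], and farther away the kernel is at most
    [ln e^-1]. So [C], later a multiple of the kinetic energy, gets a coefficient that is small with
    [e]. *)
Lemma inner_lnm_le (e : R) x : 0 < e -> e <= 1 ->
  (\int[leb2]_y (lnm (eucl (x - y)%R) * P y)%:E <=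
   (C * (2 * disk_area * e) + ln e^-1 * lam)%:E)%E.
Proof.
move=> e0 e1.
have l0 : 0 <= ln e^-1 by rewrite ln_ge0// -[leLHS]invr1 lef_pV2 ?posrE.
pose s y := lnm (eucl y) * (eucl y < e)%R%:R.
have s0 y : 0 <= s y by rewrite mulr_ge0 ?lnm_ge0.
have ms : measurable_fun [set: mR2] (s : mR2 -> mR).
  apply: measurable_funM; first exact: mkm.
  exact: (measurableT_comp (measurable_lt_const e) measurable_eucl).
have msx : measurable_fun [set: mR2] ((fun y => s (x - y)) : mR2 -> mR).
  exact: (measurableT_comp ms (measurable_subl x)).
apply: (@le_trans _ _ (\int[leb2]_y (C%:E * (s (x - y)%R)%:E + (ln e^-1)%:E * (P y)%:E))%E).
  apply: ge0_le_integral => //.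
  - by move=> y _; rewrite lee_fin mulr_ge0// lnm_ge0.
  - by apply/measurable_EFinP; exact: (measurable_kernel_section mkm mP x).
  - by apply: emeasurable_funD; apply: measurable_funeM; exact/measurable_EFinP.
  - move=> y _; rewrite -!EFinM -EFinD lee_fin /s.
    apply: (@le_trans _ _ ((s (x - y) + ln e^-1) * P y)).
      by rewrite ler_wpM2r// lnm_le.
    by rewrite mulrDl lerD2r mulrC ler_wpM2r.
rewrite ge0_integralD//; last 4 first.
- by move=> y _; rewrite -EFinM lee_fin mulr_ge0.
- by apply: measurable_funeM; exact/measurable_EFinP.
- by move=> y _; rewrite -EFinM lee_fin mulr_ge0.
- by apply: measurable_funeM; exact/measurable_EFinP.
rewrite ge0_integralZl_EFin//; last 2 first.
- by move=> y _; rewrite lee_fin.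
- exact/measurable_EFinP.
rewrite ge0_integralZl_EFin//; last 2 first.
- by move=> y _; rewrite lee_fin.
- exact/measurable_EFinP.
rewrite intP EFinD [X in (_ <= _ + X)%E]EFinM; apply: leeD => //.
rewrite EFinM; apply: lee_wpmul2l; first by rewrite lee_fin.
rewrite (ge0_integral_reflect x (f := fun y => (s y)%:E)).
- exact: integral_lnm_small.
- exact/measurable_EFinP.
- by move=> y; rewrite lee_fin.
Qed.

Lemma pot_lower (e : R) : 0 < e -> e <= 1 ->
  ((lam / 2)%:E * \int[leb2]_x (lnp (eucl x) * P x)%:E
   - (lam * (C * (2 * disk_area * e) + ln e^-1 * lam))%:E <= pot)%E.
Proof.
move=> e0 e1.
have l0 : 0 <= ln e^-1 by rewrite ln_ge0// -[leLHS]invr1 lef_pV2 ?posrE.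
have -> : pot = (\int[M4]_z (P z.1 * lnp (eucl (z.1 - z.2)%R) * P z.2)%:E
   - \int[M4]_z (P z.1 * lnm (eucl (z.1 - z.2)%R) * P z.2)%:E)%E.
  by rewrite potE -integralB//; apply: eq_integral => z _; rewrite pot_split EFinB.
apply: leeB.
  rewrite (tonelli_kernel mkp mP mP kp0 P0 P0) -ge0_integralZl_EFin//; last 3 first.
  - by move=> y _; rewrite lee_fin mulr_ge0// lnp_ge0.
  - by apply/measurable_EFinP; exact: measurable_funM.
  - by rewrite divr_ge0.
  apply: ge0_le_integral => //.
  - by move=> y _; rewrite -EFinM lee_fin !mulr_ge0 ?lnp_ge0 ?divr_ge0.
  - by apply: measurable_funeM; apply/measurable_EFinP; exact: measurable_funM.
  - by apply: emeasurable_funM; [exact/measurable_EFinP|exact: (measurable_inner mkp mP kp0 P0)].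
  - move=> x _; rewrite -EFinM mulrA mulrC EFinM; apply: lee_wpmul2l; first by rewrite lee_fin.
    exact: inner_lnp_ge.
pose c := C * (2 * disk_area * e) + ln e^-1 * lam.
have c0 : 0 <= c.
  by rewrite addr_ge0 ?mulr_ge0// ltW// disk_area_gt0.
have := tonelli_kernel_le mkm mP mP km0 P0 P0 (@measurable_cst _ _ mR2 mR setT c) (fun=> c0)
  (fun x => inner_lnm_le x e0 e1).
move=> /le_trans; apply.
under eq_integral do rewrite mulrC EFinM.
rewrite ge0_integralZl_EFin//; last 2 first.
- by move=> y _; rewrite lee_fin.
- exact/measurable_EFinP.
by rewrite intP -EFinM lee_fin mulrC.
Qed.

End potential.

(** * Energies in terms of the modulus, and coercivity *)

Section reduction.
Context {R : realType}.
Notation leb := (@lebesgue_measure R).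
Notation mR := (measurableTypeR R).
Notation mR2 := (mR * mR)%type.
Implicit Types (x y : R * R).

Lemma leb2_set0 : leb2 [set (0 : R * R)] = 0%E.
Proof.
have -> : [set (0 : R * R)] = [set 0] `*` [set 0].
  by apply/seteqP; split => -[x y] /=; [move=> [-> ->]|move=> [-> ->]].
by rewrite leb2X// lebesgue_measure_set1 mul0e.
Qed.

Lemma eucl_gt0 x : x != 0 -> 0 < eucl x.
Proof.
case: x => x1 x2 h; rewrite /eucl sqrtr_gt0 /=.
rewrite lt0r addr_ge0 ?sqr_ge0// andbT paddr_eq0 ?sqr_ge0// !sqrf_eq0.
by apply: contra h => /andP[/eqP -> /eqP ->].
Qed.

Lemma eucl0 : eucl (0 : R * R) = 0.
Proof. by rewrite /eucl /= expr0n/= addr0 sqrtr0. Qed.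

Let mset0 : measurable [set (0 : mR2)].
Proof.
have -> : [set (0 : R * R)] = [set 0] `*` [set 0].
  by apply/seteqP; split => -[x y] /=; [move=> [-> ->]|move=> [-> ->]].
exact: measurableX.
Qed.

(** [abs2u u] and [sq (modulus u)] can differ at the origin, where [modulus] is [0] by definition;
    this lemma and the next show that a single point does not matter. *)
Lemma measurable_off0 (f g : R * R -> \bar R) :
  measurable_fun [set: mR2] (g : mR2 -> \bar R) ->
  (forall x, x != 0 -> f x = g x) ->
  measurable_fun [set: mR2] (f : mR2 -> \bar R).
Proof.
move=> mg fg; rewrite -(setvU [set (0 : mR2)]); apply/measurable_funU => //.
  exact: measurableC.
split; last exact: measurable_fun_set1.
apply: (eq_measurable_fun g); last exact: measurable_funTS.
by move=> x; rewrite inE/= => /eqP x0; rewrite fg.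
Qed.

Lemma eq_integral_off0 (f g : R * R -> \bar R) :
  measurable_fun [set: mR2] (g : mR2 -> \bar R) ->
  (forall x, x != 0 -> f x = g x) ->
  (\int[leb2]_x f x = \int[leb2]_x g x)%E.
Proof.
move=> mg fg; apply: ae_eq_integral => //; first exact: measurable_off0 fg.
exists [set 0]; split => //; first exact: leb2_set0.
move=> x /= /not_implyP[_ h]; apply: contrapT => /eqP x0.
by apply: h; rewrite fg.
Qed.

Definition sq (w : R -> R) x : R := w (eucl x) ^+ 2.

Lemma measurable_sq (w : R -> R) : measurable_fun [set: mR] (w : mR -> mR) ->
  measurable_fun [set: mR2] (sq w : mR2 -> mR).
Proof. by move=> mw; apply: measurable_funX; exact: (measurableT_comp mw measurable_eucl). Qed.

Lemma abs2u_off0 (u : radial R) x : x != 0 -> abs2u u x = sq (modulus u) x.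
Proof. by move=> x0; rewrite /sq sqr_modulus// eucl_gt0. Qed.

Lemma pot_off0 (Q P : R * R -> R) :
  measurable_fun [set: mR2] (P : mR2 -> mR) -> (forall x, x != 0 -> Q x = P x) ->
  measurable_fun [set: mR2] ((fun x => \int[leb2]_y (ln (eucl (x - y)%R) * P x * P y)%:E)%E : mR2 -> \bar R) ->
  (\int[leb2]_x \int[leb2]_y (ln (eucl (x - y)%R) * Q x * Q y)%:E = pot P)%E.
Proof.
move=> mP QP mi; apply: eq_integral_off0 => // x x0; rewrite QP//.
apply: eq_integral_off0; last by move=> y y0; rewrite QP.
apply/measurable_EFinP; apply: measurable_funM => //; apply: measurable_funM => //.
have ml : measurable_fun [set: mR] (@ln R : mR -> mR) by exact: measurable_ln.
exact: (measurableT_comp ml (measurableT_comp measurable_eucl (measurable_subl x))).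
Qed.

Lemma integral_sum4_lty (f1 f2 f3 f4 : R * R -> R) :
  measurable_fun [set: mR2] (f1 : mR2 -> mR) -> measurable_fun [set: mR2] (f2 : mR2 -> mR) ->
  measurable_fun [set: mR2] (f3 : mR2 -> mR) -> measurable_fun [set: mR2] (f4 : mR2 -> mR) ->
  (forall x, 0 <= f1 x) -> (forall x, 0 <= f2 x) ->
  (forall x, 0 <= f3 x) -> (forall x, 0 <= f4 x) ->
  (\int[leb2]_x (f1 x + f2 x + f3 x + f4 x)%:E =
   \int[leb2]_x (f1 x)%:E + \int[leb2]_x (f2 x)%:E +
   \int[leb2]_x (f3 x)%:E + \int[leb2]_x (f4 x)%:E)%E.
Proof.
move=> m1 m2 m3 m4 p1 p2 p3 p4.
under eq_integral do rewrite !EFinD.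
have e1 x : [set: mR2] x -> (0 <= (f1 x)%:E)%E by rewrite lee_fin.
have e2 x : [set: mR2] x -> (0 <= (f2 x)%:E)%E by rewrite lee_fin.
have e3 x : [set: mR2] x -> (0 <= (f3 x)%:E)%E by rewrite lee_fin.
have e4 x : [set: mR2] x -> (0 <= (f4 x)%:E)%E by rewrite lee_fin.
have E1 : measurable_fun [set: mR2] (fun x => (f1 x)%:E) by exact/measurable_EFinP.
have E2 : measurable_fun [set: mR2] (fun x => (f2 x)%:E) by exact/measurable_EFinP.
have E3 : measurable_fun [set: mR2] (fun x => (f3 x)%:E) by exact/measurable_EFinP.
have E4 : measurable_fun [set: mR2] (fun x => (f4 x)%:E) by exact/measurable_EFinP.
rewrite ge0_integralD//; last 2 first.
- by move=> x _; rewrite !adde_ge0 ?lee_fin.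
- by apply: emeasurable_funD => //; exact: emeasurable_funD.
rewrite ge0_integralD//; last 2 first.
- by move=> x _; rewrite !adde_ge0 ?lee_fin.
- exact: emeasurable_funD.
by rewrite ge0_integralD.
Qed.

Definition centrifugal (m : nat) x : R := m%:R ^+ 2 / eucl x ^+ 2.

Lemma centrifugal_ge0 m x : 0 <= centrifugal m x.
Proof. by rewrite divr_ge0 ?sqr_ge0. Qed.

Lemma measurable_centrifugal m : measurable_fun [set: mR2] (centrifugal m : mR2 -> mR).
Proof.
apply: measurable_funM => //; apply: (measurableT_comp (@measurable_invr R)).
by apply: measurable_funX; exact: measurable_eucl.
Qed.

Lemma measurable_lne : measurable_fun [set: mR2] ((fun x => ln (1 + eucl x)) : mR2 -> mR).
Proof.
have ml : measurable_fun [set: mR] (@ln R : mR -> mR) by exact: measurable_ln.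
apply: (measurableT_comp ml); apply: measurable_funD => //.
exact: measurable_eucl.
Qed.

Lemma lne_ge0 x : 0 <= ln (1 + eucl x).
Proof. by rewrite ln_ge0// lerDl eucl_ge0. Qed.

Lemma measurable_inner_pot (P : R * R -> R) (C lam a : R) :
  measurable_fun [set: mR2] (P : mR2 -> mR) -> (forall x, 0 <= P x) -> (forall x, P x <= C) ->
  (\int[leb2]_x (P x)%:E = lam%:E)%E ->
  (\int[leb2]_x (ln (1 + eucl x)%R * P x)%:E = a%:E)%E ->
  measurable_fun [set: mR2] ((fun x => \int[leb2]_y (ln (eucl (x - y)%R) * P x * P y)%:E)%E : mR2 -> \bar R).
Proof.
move=> mP P0 PC iP ilnP.
exact: (measurable_fubini_F (integrable_pot mP P0 PC iP ilnP)).
Qed.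

Lemma fin_real (I : \bar R) : (0 <= I)%E -> (I < +oo)%E -> I = (fine I)%:E.
Proof. by move=> I0 Ioo; rewrite fineK// ge0_fin_numE. Qed.

Lemma adde4_lty (a b c d : \bar R) : (0 <= a -> 0 <= b -> 0 <= c -> 0 <= d ->
  a + b + c + d < +oo -> [/\ a < +oo, b < +oo & d < +oo])%E.
Proof.
case: a => [a| |]//; case: b => [b| |]//; case: c => [c| |]//; case: d => [d| |]//.
by move=> _ _ _ _ _; split; exact: ltry.
Qed.

(** The integrals of a function of finite energy, as real numbers. [T] is the radial integral
    without the factor [2 * disk_area], to match [energy]; the other three are integrals over the
    plane. *)
Record admissible (m : nat) (u : radial R) (lam T A a : R) : Prop := Admissible {
  adm_re : radial_deriv (re_p u) (dre_p u) ;
  adm_im : radial_deriv (im_p u) (dim_p u) ;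
  adm_T : (\int[leb]_(r in `]0%R, +oo[)
    (r * (dre_p u r ^+ 2 + dim_p u r ^+ 2))%:E = T%:E)%E ;
  adm_A : (\int[leb2]_x (centrifugal m x * sq (modulus u) x)%:E = A%:E)%E ;
  adm_lam : (\int[leb2]_x (sq (modulus u) x)%:E = lam%:E)%E ;
  adm_a : (\int[leb2]_x (ln (1 + eucl x)%R * sq (modulus u) x)%:E = a%:E)%E
}.

Lemma sq_ge0 w x : 0 <= sq w x. Proof. exact: sqr_ge0. Qed.

Let mabs2 (f g : R -> R) : measurable_fun [set: mR] (f : mR -> mR) ->
  measurable_fun [set: mR] (g : mR -> mR) ->
  measurable_fun [set: mR2] ((fun x => f (eucl x) ^+ 2 + g (eucl x) ^+ 2) : mR2 -> mR).
Proof.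
by move=> mf mg; apply: measurable_funD; apply: measurable_funX;
  [exact: (measurableT_comp mf measurable_eucl)|exact: (measurableT_comp mg measurable_eucl)].
Qed.

(** Unlike the other weights, this one needs no exceptional point: division by [0] gives [0], so
    [centrifugal m] vanishes at the origin. *)
Lemma centrifugal_abs2u m u x :
  centrifugal m x * abs2u u x = centrifugal m x * sq (modulus u) x.
Proof.
have [->|x0] := eqVneq x 0; last by rewrite abs2u_off0.
by rewrite /centrifugal eucl0 expr0n/= invr0 mulr0 !mul0r.
Qed.

Lemma in_Xms_admissible (m : nat) (u : radial R) (lam : R) :
  in_Xms m u -> Nmass u = lam%:E -> exists T A a, admissible m u lam T A a.
Proof.
move=> [re [im fin]] Nu.
have mre : measurable_fun [set: mR] (re_p u : mR -> mR) by case: re.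
have mim : measurable_fun [set: mR] (im_p u : mR -> mR) by case: im.
have mdre : measurable_fun [set: mR] (dre_p u : mR -> mR) by case: re => _ [].
have mdim : measurable_fun [set: mR] (dim_p u : mR -> mR) by case: im => _ [].
have mw : measurable_fun [set: mR2] (sq (modulus u) : mR2 -> mR).
  by apply: measurable_sq; exact: measurable_modulus.
have mu2 : measurable_fun [set: mR2] (abs2u u : mR2 -> mR) by exact: mabs2.
have mdu2 : measurable_fun [set: mR2] (abs2du u : mR2 -> mR) by exact: mabs2.
have u20 x : 0 <= abs2u u x by rewrite addr_ge0 ?sqr_ge0.
have du20 x : 0 <= abs2du u x by rewrite addr_ge0 ?sqr_ge0.
have := @integral_sum4_lty (abs2du u) (fun x => centrifugal m x * abs2u u x) (abs2u u)
  (fun x => ln (1 + eucl x) * abs2u u x).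
move=> /(_ _ _ _ _ _ _ _ _) E4; move: fin; rewrite E4 //; last 4 first.
- by apply: measurable_funM => //; exact: measurable_centrifugal.
- by apply: measurable_funM => //; exact: measurable_lne.
- by move=> x; rewrite mulr_ge0 ?centrifugal_ge0.
- by move=> x; rewrite mulr_ge0 ?lne_ge0.
set I1 := (\int[leb2]_x (abs2du u x)%:E)%E.
set I2 := (\int[leb2]_x (centrifugal m x * abs2u u x)%:E)%E.
set I3 := (\int[leb2]_x (abs2u u x)%:E)%E.
set I4 := (\int[leb2]_x (ln (1 + eucl x) * abs2u u x)%:E)%E.
have p1 : (0 <= I1)%E by apply: integral_ge0 => x _; rewrite lee_fin.
have p2 : (0 <= I2)%E by apply: integral_ge0 => x _; rewrite lee_fin mulr_ge0 ?centrifugal_ge0.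
have p3 : (0 <= I3)%E by apply: integral_ge0 => x _; rewrite lee_fin.
have p4 : (0 <= I4)%E by apply: integral_ge0 => x _; rewrite lee_fin mulr_ge0 ?lne_ge0.
move=> /(adde4_lty p1 p2 p3 p4)[f1 f2 f4].
have da0 : 0 < 2 * @disk_area R by rewrite mulr_gt0 ?disk_area_gt0.
exists (fine I1 / (2 * disk_area)), (fine I2), (fine I4); split => //.
- have mq : measurable_fun [set: mR] ((fun r => (dre_p u r ^+ 2 + dim_p u r ^+ 2)) : mR -> mR).
    by apply: measurable_funD; exact: measurable_funX.
  have := @integral_radial R (fun r => (dre_p u r ^+ 2 + dim_p u r ^+ 2)%:E).
  move=> /(_ _ _) h.
  have {}h : (I1 = \int[leb]_(r in `]0%R, +oo[) ((2 * disk_area)%:E *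
     (r * (dre_p u r ^+ 2 + dim_p u r ^+ 2))%:E))%E.
    rewrite /I1 [LHS]h//; first by apply: eq_integral => r _; rewrite -!EFinM mulrA.
    - exact/measurable_EFinP.
    - by move=> r; rewrite lee_fin addr_ge0 ?sqr_ge0.
  move: h; rewrite ge0_integralZl_EFin//; last 3 first.
  + by move=> r; rewrite /= in_itv/= andbT => r0; rewrite lee_fin mulr_ge0 ?addr_ge0 ?sqr_ge0// ltW.
  + by apply: measurable_funTS; apply/measurable_EFinP; exact: measurable_funM.
  + exact: ltW.
  move=> h; rewrite mulrC EFinM -fin_real// h muleA -EFinM mulVf ?gt_eqF//.
  by rewrite mul1e.
- by rewrite -fin_real//; apply: eq_integral => x _; rewrite centrifugal_abs2u.
- rewrite -Nu; apply/esym/eq_integral_off0; first exact/measurable_EFinP.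
  by move=> x x0; rewrite abs2u_off0.
- rewrite -fin_real//; apply/esym/eq_integral_off0.
    by apply/measurable_EFinP; apply: measurable_funM => //; exact: measurable_lne.
  by move=> x x0; rewrite abs2u_off0.
Qed.

Section consequences.
Variables (m : nat) (u : radial R) (lam T A a : R).
Hypotheses (m0 : (0 < m)%N) (adm : admissible m u lam T A a).
Let w := modulus u.
Let c1 : R := 2 * disk_area.

Let c10 : 0 < c1. Proof. by rewrite mulr_gt0 ?disk_area_gt0. Qed.

Let mw : measurable_fun [set: mR] (w : mR -> mR).
Proof. by apply: measurable_modulus; [exact: adm_re adm|exact: adm_im adm]. Qed.

Let mP : measurable_fun [set: mR2] (sq w : mR2 -> mR).
Proof. exact: measurable_sq. Qed.

Lemma adm_T_ge0 : 0 <= T.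
Proof.
rewrite -lee_fin -(adm_T adm); apply: integral_ge0 => r.
by rewrite /= in_itv/= andbT => r0; rewrite lee_fin mulr_ge0 ?addr_ge0 ?sqr_ge0// ltW.
Qed.

Lemma adm_A_ge0 : 0 <= A.
Proof.
rewrite -lee_fin -(adm_A adm); apply: integral_ge0 => x _.
by rewrite lee_fin mulr_ge0 ?centrifugal_ge0 ?sq_ge0.
Qed.

Lemma adm_radial_bound :
  (\int[leb]_(r in `]0%R, +oo[) (r * (w r ^+ 2 / r ^+ 2))%:E <= (A / c1)%:E)%E.
Proof.
pose f r := m%:R ^+ 2 / r ^+ 2 * w r ^+ 2.
have f0 r : 0 <= f r by rewrite mulr_ge0 ?divr_ge0 ?sqr_ge0.
have mi : measurable_fun [set: mR] ((fun r => (r ^+ 2)^-1) : mR -> mR).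
  by apply: (measurableT_comp (@measurable_invr R)); exact: measurable_funX.
have mf : measurable_fun [set: mR] (f : mR -> mR).
  by apply: measurable_funM; [exact: measurable_funM|exact: measurable_funX].
have h : (A%:E = \int[leb]_(r in `]0%R, +oo[) (c1%:E * (r * f r)%:E))%E.
  rewrite -(adm_A adm) (integral_radial (f := fun r => (f r)%:E)).
  - apply: eq_integral => r _; rewrite -[RHS]EFinM -[LHS]EFinM; congr EFin.
    exact: esym (mulrA c1 (r : R) (f r)).
  - exact/measurable_EFinP.
  - by move=> r; rewrite lee_fin.
rewrite mulrC EFinM h ge0_integralZl_EFin//; last 3 first.
- by move=> r; rewrite /= in_itv/= andbT => r0; rewrite lee_fin mulr_ge0// ltW.
- by apply: measurable_funTS; apply/measurable_EFinP; exact: measurable_funM.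
- exact: ltW.
rewrite muleA -EFinM mulVf ?gt_eqF// mul1e.
apply: ge0_le_integral => //.
- by move=> r; rewrite /= in_itv/= andbT => r0; rewrite lee_fin mulr_ge0 ?(ltW r0)// divr_ge0 ?sqr_ge0.
- apply: measurable_funTS; apply/measurable_EFinP; apply: measurable_funM => //.
  by apply: measurable_funM => //; exact: measurable_funX.
- by apply: measurable_funTS; apply/measurable_EFinP; exact: measurable_funM.
- move=> r; rewrite /= in_itv/= andbT => r0; rewrite lee_fin ler_wpM2l ?(ltW r0)//.
  have -> : f r = m%:R ^+ 2 * (w r ^+ 2 / r ^+ 2) by rewrite /f mulrAC mulrA.
  rewrite ler_peMl ?divr_ge0 ?sqr_ge0//.
  by rewrite exprn_ege1// ler1n.
Qed.

Let C := 4 * (A / c1) + 2 * T.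

Lemma adm_C_ge0 : 0 <= C.
Proof. by rewrite addr_ge0// mulr_ge0 ?divr_ge0 ?adm_A_ge0 ?adm_T_ge0// ltW. Qed.

Lemma adm_modulus_bound r : w r ^+ 2 <= C.
Proof.
have [r0|r0] := ltP 0 r; last by rewrite /w /modulus ltNge r0/= expr0n/= adm_C_ge0.
have hT : (\int[leb]_(r in `]0%R, +oo[)
    (r * (dre_p u r ^+ 2 + dim_p u r ^+ 2))%:E <= T%:E)%E by rewrite (adm_T adm).
exact: (modulus_bound (adm_re adm) (adm_im adm) hT adm_radial_bound r0).
Qed.

Lemma sq_even (v : R -> R) x : sq v (- x) = sq v x.
Proof. by rewrite /sq euclN. Qed.

Lemma adm_pot_fin_num : pot (sq w) \is a fin_num.
Proof.
exact: (pot_fin_num mP (sq_ge0 _) (fun x => adm_modulus_bound _) (adm_lam adm) (adm_a adm)).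
Qed.

Lemma adm_Em (gamma : R) :
  Em gamma m u = ((c1 * T + A)%:E + (gamma / (4 * pi))%:E * pot (sq w))%E.
Proof.
have mdre : measurable_fun [set: mR] (dre_p u : mR -> mR) by case: (adm_re adm) => _ [].
have mdim : measurable_fun [set: mR] (dim_p u : mR -> mR) by case: (adm_im adm) => _ [].
have hk : (\int[leb2]_x (abs2du u x + (m%:R ^+ 2 / eucl x ^+ 2) * abs2u u x)%:E =
    (c1 * T + A)%:E)%E.
  under eq_integral do rewrite -/(centrifugal m _) centrifugal_abs2u EFinD.
  rewrite ge0_integralD//; last 4 first.
  - by move=> x _; rewrite lee_fin addr_ge0 ?sqr_ge0.
  - by apply/measurable_EFinP; exact: mabs2.
  - by move=> x _; rewrite lee_fin mulr_ge0 ?centrifugal_ge0 ?sq_ge0.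
  - by apply/measurable_EFinP; apply: measurable_funM => //; exact: measurable_centrifugal.
  rewrite (adm_A adm) EFinD; congr (_ + _)%E.
  rewrite EFinM -(adm_T adm).
  rewrite (integral_radial (f := fun r => (dre_p u r ^+ 2 + dim_p u r ^+ 2)%:E)); last 2 first.
  - by apply/measurable_EFinP; apply: measurable_funD; exact: measurable_funX.
  - by move=> r; rewrite lee_fin addr_ge0 ?sqr_ge0.
  rewrite -ge0_integralZl_EFin//; last 3 first.
  - by move=> r; rewrite /= in_itv/= andbT => r0; rewrite lee_fin mulr_ge0 ?addr_ge0 ?sqr_ge0// ltW.
  - apply: measurable_funTS; apply/measurable_EFinP; apply: measurable_funM => //.
    by apply: measurable_funD; exact: measurable_funX.
  - exact: ltW.
  by apply: eq_integral => r _; rewrite -!EFinM mulrA.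
have hp := pot_off0 mP (@abs2u_off0 u) (measurable_inner_pot mP (sq_ge0 _)
  (fun x => adm_modulus_bound _) (adm_lam adm) (adm_a adm)).
by rewrite /Em hp hk.
Qed.

Lemma adm_lnp : exists2 L : R, 0 <= L &
  (\int[leb2]_x (lnp (eucl x) * sq w x)%:E = L%:E)%E.
Proof.
have I0 : (0 <= \int[leb2]_x (lnp (eucl x) * sq w x)%:E)%E.
  by apply: integral_ge0 => x _; rewrite lee_fin mulr_ge0 ?lnp_ge0 ?sq_ge0.
exists (fine (\int[leb2]_x (lnp (eucl x) * sq w x)%:E)%E); first exact: fine_ge0.
rewrite -fin_real//; apply: le_lt_trans (ltry a); rewrite -(adm_a adm).
apply: ge0_le_integral => //.
- by move=> x _; rewrite lee_fin mulr_ge0 ?lnp_ge0 ?sq_ge0.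
- apply/measurable_EFinP; apply: measurable_funM => //.
  exact: (measurableT_comp measurable_lnp measurable_eucl).
- by apply/measurable_EFinP; apply: measurable_funM => //; exact: measurable_lne.
- move=> x _; rewrite lee_fin ler_wpM2r ?sq_ge0//.
  rewrite /lnp ge_max lne_ge0/=.
  have := eucl_ge0 x; rewrite le_eqVlt => /predU1P[<-|x0]; first by rewrite ln0// addr0 ln1.
  by rewrite ler_ln ?posrE ?ltr_wpDl// lerDr.
Qed.

End consequences.

(* The attractive part of the logarithm costs at most half of the kinetic
   energy, up to a constant depending only on [gamma] and [lam]. *)
Lemma coercive (gamma lam : R) : 0 < gamma -> 0 < lam -> exists B : R,
  forall (m : nat) (u : radial R) (T A a L : R), (0 < m)%N ->
    admissible m u lam T A a ->
    (\int[leb2]_x (lnp (eucl x) * sq (modulus u) x)%:E = L%:E)%E ->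
    exists2 E : R, Em gamma m u = E%:E &
      (2 * disk_area * T + A) / 2 + gamma / (4 * pi) * lam / 2 * L - B <= E.
Proof.
move=> gamma0 lam0; pose g := gamma / (4 * pi).
have g0 : 0 < g by rewrite divr_gt0// mulr_gt0// pi_gt0.
(* The near part of the negative logarithm costs at most [g * lam * 4 * (2 * disk_area * T + A) *
   e], and this [e] makes it at most half of [2 * disk_area * T + A]. [pot_lower] asks for
   [e <= 1]. *)
pose e := Num.min 1 ((8 * g * lam)^-1).
have k0 : 0 < 8 * g * lam by rewrite mulr_gt0// mulr_gt0.
have e0 : 0 < e by rewrite /e lt_min ltr01/= invr_gt0.
have e1 : e <= 1 by rewrite /e ge_min lexx.
have e2 : e * (8 * g * lam) <= 1.
  by rewrite -(ler_pdivlMr _ _ k0) mul1r /e ge_min lexx orbT.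
exists (g * (lam * (ln e^-1 * lam))) => m u T A a L m0 adm hL.
have mw : measurable_fun [set: mR] (modulus u : mR -> mR).
  by apply: measurable_modulus; [exact: adm_re adm|exact: adm_im adm].
have := pot_lower (measurable_sq mw) (sq_ge0 _) (fun x => adm_modulus_bound m0 adm _)
  (sq_even _) (adm_lam adm) (adm_a adm) e0 e1.
rewrite hL (adm_Em m0 adm).
have := adm_pot_fin_num m0 adm; case: (pot _) => // v _.
rewrite -EFinM -EFinB lee_fin => hv; rewrite -EFinM -EFinD.
exists (2 * disk_area * T + A + gamma / (4 * pi) * v) => //.
rewrite -/g.
have c0 : 0 < 2 * @disk_area R by rewrite mulr_gt0 ?disk_area_gt0.
have T0 := adm_T_ge0 adm; have A0 := adm_A_ge0 adm.
move: (2 * disk_area) c0 hv => c c0 hv.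
have {}hv : g * (lam / 2 * L - lam * ((4 * (A / c) + 2 * T) * (c * e) + ln e^-1 * lam)) <= g * v.
  by rewrite ler_pM2l.
have : (4 * (A / c) + 2 * T) * (c * e) <= 4 * (c * T + A) * e.
  have -> : (4 * (A / c) + 2 * T) * (c * e) = (4 * A + 2 * (c * T)) * e.
    by field; rewrite gt_eqF.
  rewrite ler_pM2r//.
  have : 0 <= c * T by rewrite mulr_ge0// ltW.
  by lra.
rewrite -(ler_pM2l lam0) -(ler_pM2l g0) => h1.
have : (c * T + A) * (e * (8 * g * lam)) <= (c * T + A) * 1.
  by rewrite ler_wpM2l// addr_ge0// mulr_ge0// ltW.
move: hv h1; rewrite !mulrBr !mulrDr; lra.
Qed.

End reduction.
(** * Compactness and passage to the limit *)

Section compactness.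
Context {R : realType}.

(** By Tychonoff's theorem the sequences [x n] cluster at some [p] in a product of segments. Beyond
    [n] some [k n] has its first [n + 1] coordinates within [1 / (n + 1)] of [p]. The map [k] need
    not increase: [n <= k n] already carries limits over. *)
Lemma diagonal_subsequence (x : nat -> nat -> R) (b : nat -> R) :
  (forall n i, `|x n i| <= b i) ->
  exists (k : nat -> nat) (p : nat -> R), (forall n, (n <= k n)%N) /\
    forall i, x (k n) i @[n --> \oo] --> p i.
Proof.
move=> xb.
have := @tychonoff nat (fun=> R : topologicalType) (fun i => `[- b i, b i]%classic)
  (fun i => @segment_compact R _ _).
move=> /(_ (x n @[n --> \oo]) _ _).
case.
  by exists 0%N => // n _ i; rewrite /= in_itv/= -ler_norml.
move=> p [_ clp].
have H n : exists k, (n <= k)%N /\ forall i, (i <= n)%N -> `|x k i - p i| < n.+1%:R^-1.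
  pose V := [set f : nat -> R | forall i : 'I_n.+1, `|f i - p i| < n.+1%:R^-1].
  pose K : topologicalType := prod_topology (fun _ : nat => R : topologicalType).
  have FK : Filter (@nbhs K K p) by exact: (@nbhs_filter K p).
  have nV : @nbhs K K p V.
    have pr i : @nbhs K K p [set f | `|(f : nat -> R) i - p i| < n.+1%:R^-1].
      apply: (@proj_continuous nat (fun=> R : topologicalType) i p
        [set y : R | `|y - p i| < n.+1%:R^-1]).
      apply/nbhs_ballP; exists n.+1%:R^-1; first by rewrite /= invr_gt0 ltr0n.
      by move=> y; rewrite /ball/= distrC.
    exact: (@filter_forall (nat -> R) 'I_n.+1 _ _ FK (fun i => pr (nat_of_ord i))).
  have [|f [[k nk <-] Vk]] := clp [set x k | k in [set k | (n <= k)%N]] V _ nV.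
    by exists n => // k /= nk; exists k.
  exists k; split => // i le_in.
  by have := Vk (inord i); rewrite inordK.
have [k Hk] := choice H; exists k, p; split; first by move=> n; have [] := Hk n.
move=> i; apply/cvgrPdist_lt => e e0.
near=> n; rewrite distrC; apply: (@lt_trans _ _ n.+1%:R^-1).
  by have [_] := Hk n; apply; near: n; exact: nbhs_infty_ge.
by near: n; exact: near_infty_natSinv_lt (PosNum e0).
Unshelve. all: by end_near. Qed.

Lemma equicontinuous_cvg (w : nat -> R -> R) (T : R) :
  (forall n a b, 0 < a -> a < b -> a * (w n b - w n a) ^+ 2 <= (b - a) * T) ->
  (forall n r, r <= 0 -> w n r = 0) ->
  (forall q : rat, cvgn (w ^~ (ratr q))) ->
  forall r, cvgn (w ^~ r).
Proof.
move=> wT w0 wq r; have [r0|r0] := leP r 0.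
  by apply/cvg_ex; exists 0; under eq_cvg do rewrite w0//; exact: cvg_cst.
apply/cauchy_cvgP/cauchy_exP => e e0.
have T0 : 0 <= T.
  have := wT 0%N 1 2 ltr01 (ltr1n _ 2); rewrite mul1r -(natrB _ (isT : 1 <= 2)%N) mul1r.
  by apply: le_trans; exact: sqr_ge0.
(* At distance less than [d] to the right of [r], equicontinuity keeps the values within [e / 2],
   uniformly in [n]; [T + 1] avoids dividing by [0]. *)
pose d := r * (e / 2) ^+ 2 / (T + 1).
have d0 : 0 < d by rewrite /d divr_gt0 ?mulr_gt0 ?exprn_gt0 ?divr_gt0// ltr_wpDl.
have [q] := rat_in_itvoo (ltr_pwDr d0 (lexx r)); rewrite in_itv/= => /andP[rq qd].
have /cvg_ex[l ql] := wq q.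
exists l; move/cvgrPdist_lt : ql => /(_ (e / 2)); rewrite divr_gt0// => /(_ isT).
apply: filterS => n h; rewrite /ball/=.
have : `|w n (ratr q) - w n r| < e / 2.
  rewrite -(@ltr_pXn2r _ 2)// ?nnegrE ?normr_ge0 ?divr_ge0 ?(ltW e0)//.
  rewrite real_normK ?num_real// -(ltr_pM2l r0).
  apply: le_lt_trans (wT n _ _ r0 rq) _.
  apply: (@le_lt_trans _ _ (d * T)); first by rewrite ler_wpM2r// lerBlDl ltW.
  rewrite /d mulrAC ltr_pdivrMr ?ltr_wpDl// ltr_pM2l ?ltrDl//.
  by rewrite mulr_gt0 ?exprn_gt0 ?divr_gt0.
have -> : l - w n r = (l - w n (ratr q)) + (w n (ratr q) - w n r) by ring.
by move=> h2; rewrite [e]splitr (le_lt_trans (ler_normD _ _))// ltrD.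
Qed.

Lemma equicontinuous_subsequence (w : nat -> R -> R) (C T : R)
    (s : nat -> nat -> R) (b : nat -> R) :
  (forall n r, `|w n r| <= C) ->
  (forall n a b, 0 < a -> a < b -> a * (w n b - w n a) ^+ 2 <= (b - a) * T) ->
  (forall n r, r <= 0 -> w n r = 0) ->
  (forall n i, `|s n i| <= b i) ->
  exists (k : nat -> nat) (p : R -> R) (t : nat -> R), [/\ forall n, (n <= k n)%N,
    forall r, w (k n) r @[n --> \oo] --> p r &
    forall i, s (k n) i @[n --> \oo] --> t i].
Proof.
move=> wC wT w0 sb.
pose q i : R := ratr (odflt (0 : rat) (unpickle i)).
(* One diagonal argument serves both demands: even indices carry the values at rationals, odd
   indices the numerical sequences. *)
pose x n i := if odd i then s n i./2 else w n (q i./2).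
have [|k [p [nk xp]]] := @diagonal_subsequence x (fun i => if odd i then b i./2 else C).
  by move=> n i; rewrite /x; case: ifP.
have wk r : cvgn (fun n => w (k n) r).
  apply: (@equicontinuous_cvg (fun n => w (k n)) T) => [n|n|y].
  - exact: wT.
  - exact: w0.
  apply/cvg_ex; exists (p (pickle y).*2).
  by have := xp (pickle y).*2; rewrite /x odd_double doubleK /q pickleK.
exists k, (fun r => limn (fun n => w (k n) r)), (fun i => p i.*2.+1); split => //.
by move=> i; have := xp i.*2.+1; rewrite /x/= odd_double/= uphalf_double.
Qed.

End compactness.

(** * Mass, weights and potential under pointwise limits *)

Section profile_limits.
Context {R : realType}.
Notation mR := (measurableTypeR R).
Notation mR2 := (mR * mR)%type.
Notation M4 := (@leb2 R \x @leb2 R)%E.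
Implicit Types x : R * R.

Lemma ln1D_le (t : R) : 0 <= t -> ln (1 + t) <= ln 2 + lnp t.
Proof.
move=> t0; have [t1|t1] := leP t 1.
  rewrite -[leLHS]addr0 lerD ?lnp_ge0// ler_ln ?posrE ?ltr_wpDr//; lra.
have t0' : 0 < t by exact: lt_trans t1.
have -> : lnp t = ln t by rewrite /lnp; apply/max_idPr; rewrite ln_ge0// ltW.
rewrite -lnM ?posrE// ler_ln ?posrE ?mulr_gt0 ?ltr_wpDr//; lra.
Qed.

Variables (P_ : nat -> R * R -> R) (P : R * R -> R) (C lam : R) (a L : nat -> R) (K : R).
Hypotheses (mP_ : forall n, measurable_fun [set: mR2] (P_ n : mR2 -> mR))
  (P_0 : forall n x, 0 <= P_ n x) (P_C : forall n x, P_ n x <= C)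
  (iP_ : forall n, (\int[leb2]_x (P_ n x)%:E = lam%:E)%E)
  (ilnP_ : forall n, (\int[leb2]_x (ln (1 + eucl x)%R * P_ n x)%:E = (a n)%:E)%E)
  (ilnpP_ : forall n, (\int[leb2]_x (lnp (eucl x) * P_ n x)%:E = (L n)%:E)%E)
  (LK : forall n, L n <= K)
  (PP : forall x, P_ n x @[n --> \oo] --> P x).

Lemma limit_measurable : measurable_fun [set: mR2] (P : mR2 -> mR).
Proof. by apply: measurable_fun_cvg mP_ _ => x _; exact: PP. Qed.
Let mP := limit_measurable.

Lemma limit_ge0 x : 0 <= P x.
Proof. by apply: (cvgr_to_ge (@PP x)); apply: nearW => n; exact: P_0. Qed.
Let P0 := limit_ge0.

Lemma limit_le x : P x <= C.
Proof. by apply: (cvgr_to_le (@PP x)); apply: nearW => n; exact: P_C. Qed.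
Let PC := limit_le.

Lemma fatou_weighted (h : R * R -> R) (c : R^nat) (l : R) :
  measurable_fun [set: mR2] (h : mR2 -> mR) -> (forall x, 0 <= h x) ->
  (forall n, \int[leb2]_x (h x * P_ n x)%:E <= (c n)%:E)%E ->
  c n @[n --> \oo] --> l ->
  (\int[leb2]_x (h x * P x)%:E <= l%:E)%E.
Proof.
move=> mh h0 hc cl; apply: (@fatou_le _ mR2 R leb2 _ (fun n x => (h x * P_ n x)%:E) _ c) => //.
- move=> n; apply/measurable_EFinP.
  have : measurable_fun [set: mR2] ((fun x => h x * P_ n x) : mR2 -> mR).
    by apply: measurable_funM => //; exact: mP_.
  exact.
- apply/measurable_EFinP.
  have : measurable_fun [set: mR2] ((fun x => h x * P x) : mR2 -> mR) by exact: measurable_funM.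
  exact.
- by move=> n x _; rewrite lee_fin mulr_ge0.
- by move=> x _; rewrite lee_fin mulr_ge0.
- apply: aeW => x _; apply: cvg_le_limn_einf; apply: cvg_EFin; first exact: nearW.
  by apply: cvgM (@PP x); exact: cvg_cst.
Qed.

Let mlnp : measurable_fun [set: mR2] ((fun x => lnp (eucl x)) : mR2 -> mR).
Proof. exact: (measurableT_comp measurable_lnp measurable_eucl). Qed.

Lemma limit_lnp : (\int[leb2]_x (lnp (eucl x) * P x)%:E <= K%:E)%E.
Proof.
apply: (@fatou_weighted _ (fun=> K)) => //; last exact: cvg_cst.
- by move=> x; exact: lnp_ge0.
- by move=> n; rewrite ilnpP_ lee_fin.
Qed.

Lemma limit_mass_le : (\int[leb2]_x (P x)%:E <= lam%:E)%E.
Proof.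
have := @fatou_weighted (fun=> 1) (fun=> lam) lam.
under eq_integral do rewrite mul1r.
apply => //; last exact: cvg_cst.
by move=> n; under eq_integral do rewrite mul1r; rewrite iP_.
Qed.

(* The logarithmic weight is tight: on [eucl x >= expR e^-1] it dominates [e^-1]. *)
Lemma limit_mass_ge (e : R) : 0 < e ->
  (lam%:E <= \int[leb2]_x (P x)%:E + (e * K)%:E)%E.
Proof.
move=> e0; pose r := expR e^-1.
have r0 : 0 < r by exact: expR_gt0.
have C0 : 0 <= C by apply: le_trans (P_C 0%N (0, 0)).
(* [h Q] dominates [Q]: through [C] inside the disk, and outside because [e * lnp] is at least [1]
   there. Fatou's lemma for [h Q - Q] then bounds the mass of the limit from below. *)
pose h (Q : R * R -> R) x := C * (eucl x < r)%R%:R + e * lnp (eucl x) * Q x.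
pose f Q x := h Q x - Q x.
have mlt : measurable_fun [set: mR2] ((fun x => (eucl x < r)%R%:R) : mR2 -> mR).
  exact: (measurableT_comp (measurable_lt_const r) measurable_eucl).
have mh Q : measurable_fun [set: mR2] (Q : mR2 -> mR) ->
    measurable_fun [set: mR2] (h Q : mR2 -> mR).
  move=> mQ; apply: measurable_funD; first exact: measurable_funM.
  by apply: measurable_funM => //; exact: measurable_funM.
have mf Q : measurable_fun [set: mR2] (Q : mR2 -> mR) ->
    measurable_fun [set: mR2] (f Q : mR2 -> mR).
  by move=> mQ; apply: measurable_funB => //; exact: mh.
have f0 Q x : (forall x, 0 <= Q x) -> (forall x, Q x <= C) -> 0 <= f Q x.
  move=> Q0 QC; rewrite /f /h subr_ge0; case: ltP => xr.
    by rewrite mulr1 (le_trans (QC x))// lerDl !mulr_ge0 ?lnp_ge0// ltW.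
  rewrite mulr0 add0r ler_peMl// -ler_pdivrMl// mulr1 /lnp le_max.
  by apply/orP; right; rewrite -ler_expR lnK// posrE (lt_le_trans r0).
have ih Q : measurable_fun [set: mR2] (Q : mR2 -> mR) -> (forall x, 0 <= Q x) ->
    (\int[leb2]_x (h Q x)%:E = (C * (r ^+ 2 * disk_area))%:E +
      e%:E * \int[leb2]_x (lnp (eucl x) * Q x)%:E)%E.
  move=> mQ Q0; under eq_integral do rewrite EFinD EFinM -mulrA (EFinM e).
  rewrite ge0_integralD//; last 4 first.
  - by move=> x _; rewrite -EFinM lee_fin mulr_ge0.
  - by apply: measurable_funeM; exact/measurable_EFinP.
  - by move=> x _; rewrite -EFinM lee_fin !mulr_ge0 ?lnp_ge0// ltW.
  - by apply: measurable_funeM; apply/measurable_EFinP; exact: measurable_funM.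
  rewrite ge0_integralZl_EFin//; last exact/measurable_EFinP.
  rewrite ge0_integralZl_EFin//; last 3 first.
  - by move=> x _; rewrite lee_fin mulr_ge0 ?lnp_ge0.
  - by apply/measurable_EFinP; exact: measurable_funM.
  - exact: ltW.
  congr (_ + _)%E; rewrite EFinM; congr (_ * _)%E.
  rewrite -(leb2_disk r0) -[X in leb2 X]setIT.
  rewrite -(@integral_indic _ mR2 R leb2 setT measurableT); last exact: measurable_disk.
  apply: eq_integral => x _; rewrite indicE; congr (_%:R)%:E.
  by rewrite mem_setE.
have fh Q : measurable_fun [set: mR2] (Q : mR2 -> mR) -> (forall x, 0 <= Q x) ->
    (forall x, Q x <= C) -> (\int[leb2]_x (f Q x)%:E + \int[leb2]_x (Q x)%:E =
    \int[leb2]_x (h Q x)%:E)%E.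
  move=> mQ Q0 QC; rewrite -ge0_integralD//.
  - by apply: eq_integral => x _; rewrite -EFinD /f subrK.
  - by move=> x _; rewrite lee_fin f0.
  - by apply/measurable_EFinP; exact: mf.
  - by move=> x _; rewrite lee_fin.
  - exact/measurable_EFinP.
pose c := C * (r ^+ 2 * disk_area) + e * K - lam.
have fc : (\int[leb2]_x (f P x)%:E <= c%:E)%E.
  apply: (@fatou_le _ mR2 R leb2 _ (fun n x => (f (P_ n) x)%:E) _ (fun=> c)) => //.
  - by move=> n; apply/measurable_EFinP; exact: mf.
  - by apply/measurable_EFinP; exact: mf.
  - by move=> n x _; rewrite lee_fin f0.
  - by move=> x _; rewrite lee_fin f0.
  - apply: aeW => x _; apply: cvg_le_limn_einf; apply: cvg_EFin; first exact: nearW.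
    rewrite /f /h; apply: cvgB => //; apply: cvgD; first exact: cvg_cst.
    by apply: cvgM (@PP x); exact: cvg_cst.
  - move=> n; have := fh _ (mP_ n) (P_0 n) (P_C n); rewrite ih// iP_ ilnpP_.
    case: (\int[leb2]_x (f (P_ n) x)%:E)%E => // i.
    rewrite -EFinM -!EFinD => -[hi]; rewrite lee_fin /c.
    have : e * L n <= e * K by rewrite ler_pM2l.
    by move: hi; lra.
  - exact: cvg_cst.
have i0 : (0 <= \int[leb2]_x (P x)%:E)%E by apply: integral_ge0 => x _; rewrite lee_fin.
have f0' : (0 <= \int[leb2]_x (f P x)%:E)%E.
  by apply: integral_ge0 => x _; rewrite lee_fin f0.
have l0 : (0 <= \int[leb2]_x (lnp (eucl x) * P x)%:E)%E.
  by apply: integral_ge0 => x _; rewrite lee_fin mulr_ge0 ?lnp_ge0.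
have := fh _ mP P0 PC; rewrite ih//.
move: fc f0' i0 l0.
case: (\int[leb2]_x (f P x)%:E)%E => // i; case: (\int[leb2]_x (P x)%:E)%E => // j.
  rewrite -(EFinD j) !lee_fin => hi _ _; case: (\int[leb2]_x _)%E => // [l|].
    rewrite lee_fin -(EFinM e) -!EFinD => l0 -[].
    have : 0 <= e * l by rewrite mulr_ge0// ltW.
    by move: hi; rewrite /c; lra.
  by rewrite gt0_muley ?lte_fin.
by move=> _ _ _ _; rewrite leey.
Qed.

Lemma limit_mass : (\int[leb2]_x (P x)%:E = lam%:E)%E.
Proof.
have i0 : (0 <= \int[leb2]_x (P x)%:E)%E by apply: integral_ge0 => x _; rewrite lee_fin.
move: i0 limit_mass_le limit_mass_ge; case: (\int[leb2]_x (P x)%:E)%E => // j _.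
rewrite lee_fin => jl h; congr EFin; apply/eqP; rewrite eq_le jl/=.
apply/ler_addgt0Pr => e e0.
have K1 : 0 < `|K| + 1 by rewrite ltr_wpDl.
have := h (e / (`|K| + 1)); rewrite divr_gt0// => /(_ isT).
rewrite -EFinD lee_fin => /le_trans; apply; rewrite lerD2l.
rewrite mulrAC ler_pdivrMr// ler_pM2l//.
by rewrite (le_trans (ler_norm K))// lerDl.
Qed.

Lemma limit_lne : exists b, (\int[leb2]_x (ln (1 + eucl x)%R * P x)%:E = b%:E)%E.
Proof.
set I := (\int[leb2]_x _)%E.
exists (fine I); apply: fin_real.
  by apply: integral_ge0 => x _; rewrite lee_fin mulr_ge0 ?lne_ge0.
apply: (@le_lt_trans _ _ (\int[leb2]_x ((ln 2)%:E * (P x)%:E + (lnp (eucl x) * P x)%:E))%E).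
  apply: ge0_le_integral => //.
  - by move=> x _; rewrite lee_fin mulr_ge0 ?lne_ge0.
  - by apply/measurable_EFinP; apply: measurable_funM => //; exact: measurable_lne.
  - apply: emeasurable_funD; first by apply: measurable_funeM; exact/measurable_EFinP.
    by apply/measurable_EFinP; exact: measurable_funM.
  - move=> x _; rewrite -EFinM -EFinD lee_fin -mulrDl ler_wpM2r//.
    by rewrite ln1D_le// eucl_ge0.
have l2 : 0 <= ln 2 :> R by rewrite ln_ge0// ler1n.
rewrite ge0_integralD//; last 4 first.
- by move=> x _; rewrite -EFinM lee_fin mulr_ge0.
- by apply: measurable_funeM; exact/measurable_EFinP.
- by move=> x _; rewrite lee_fin mulr_ge0 ?lnp_ge0.
- by apply/measurable_EFinP; exact: measurable_funM.
rewrite ge0_integralZl_EFin//; last 2 first.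
- by move=> x _; rewrite lee_fin.
- exact/measurable_EFinP.
rewrite limit_mass -EFinM; apply: le_lt_trans (ltry (ln 2 * lam + K)).
by rewrite EFinD leeD2l// limit_lnp.
Qed.

Lemma limit_pot (v : nat -> R) (l : R) :
  (forall n, pot (P_ n) = (v n)%:E) -> v n @[n --> \oo] --> l -> (pot P <= l%:E)%E.
Proof.
move=> pv vl.
have [b ilnP] := limit_lne.
(* The same constant makes the potentials of the sequence and of the limit nonnegative; for the
   limit this relies on its mass being [lam] again. *)
rewrite -(@leeD2rE _ (C * lnm_mass * lam)%:E)//.
rewrite (pot_shift mP P0 PC limit_mass ilnP) -EFinD.
have mln : measurable_fun [set: mR2] ((fun x => ln (eucl x)) : mR2 -> mR).
  have ml : measurable_fun [set: mR] (@ln R : mR -> mR) by exact: measurable_ln.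
  exact: (measurableT_comp ml measurable_eucl).
have mlnm : measurable_fun [set: mR2] ((fun x => lnm (eucl x)) : mR2 -> mR).
  exact: (measurableT_comp measurable_lnm measurable_eucl).
pose F (Q : R * R -> R) (z : (R * R) * (R * R)) :=
  ln (eucl (z.1 - z.2)) * Q z.1 * Q z.2 + Q z.1 * lnm (eucl (z.1 - z.2)) * C.
have mF (Q : R * R -> R) : measurable_fun [set: mR2] (Q : mR2 -> mR) ->
    measurable_fun [set: mR2 * mR2] ((fun z => (F Q z)%:E) : mR2 * mR2 -> \bar R).
  move=> mQ; apply/measurable_EFinP.
  rewrite (_ : F Q = fun z => Q z.1 * ln (eucl (z.1 - z.2)) * Q z.2 +
    Q z.1 * lnm (eucl (z.1 - z.2)) * cst C z.2).
    apply: measurable_funD.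
      exact: (@measurable_kernel _ (fun x => ln (eucl x))).
    exact: (@measurable_kernel _ (fun x => lnm (eucl x))).
  by apply/funext => z; rewrite /F; congr (_ + _); ring.
apply: (@fatou_le _ (mR2 * mR2)%type R M4 _ (fun n z => (F (P_ n) z)%:E) _
    (fun n => v n + C * lnm_mass * lam)) => //.
- by move=> n; exact: mF.
- exact: mF.
- by move=> n z _; rewrite lee_fin; apply: pot_shift_ge0.
- by move=> z _; rewrite lee_fin; apply: pot_shift_ge0.
- apply: aeW => z _; apply: cvg_le_limn_einf; apply: cvg_EFin; first exact: nearW.
  rewrite /F; apply: cvgD; apply: cvgM => //; [apply: cvgM => //|apply: cvgM => //|];
    exact: cvg_cst.
- move=> n; have := pot_shift (mP_ n) (P_0 n) (P_C n) (iP_ n) (ilnP_ n).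
  by rewrite pv -EFinD => <-.
- by apply: cvgD => //; exact: cvg_cst.
Qed.

End profile_limits.

(** * A competitor of finite energy *)

Section real_profiles.
Context {R : realType}.
Notation leb := (@lebesgue_measure R).
Notation mR := (measurableTypeR R).
Notation mR2 := (mR * mR)%type.
Implicit Types v g : R -> R.

Definition real_radial v g : radial R := Radial v (fun=> 0) g (fun=> 0).

Lemma radial_deriv0 : radial_deriv (fun=> 0 : R) (fun=> 0).
Proof.
split; first exact: measurable_cst; split; first exact: measurable_cst.
move=> a b _ _; split; first exact: integrable0.
by rewrite subrr integral0.
Qed.

Lemma modulus_real_radial v g : (forall r, 0 <= v r) -> (forall r, r <= 0 -> v r = 0) ->
  modulus (real_radial v g) = v.
Proof.
move=> v0 vn; apply/funext => r; rewrite /modulus; case: ltP => r0; last by rewrite vn.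
by rewrite /= expr0n/= addr0 sqrtr_sqr ger0_norm.
Qed.

Lemma real_radial_in_Xms (m : nat) v g (S A lam a : R) :
  radial_deriv v g ->
  (\int[leb]_(r in `]0%R, +oo[) (r * g r ^+ 2)%:E <= S%:E)%E ->
  (\int[leb2]_x (centrifugal m x * sq v x)%:E <= A%:E)%E ->
  (\int[leb2]_x (sq v x)%:E = lam%:E)%E ->
  (\int[leb2]_x (ln (1 + eucl x)%R * sq v x)%:E = a%:E)%E ->
  in_Xms m (real_radial v g) /\ Nmass (real_radial v g) = lam%:E.
Proof.
move=> vg gS vA vlam va; have [mv [mg _]] := vg.
have mv2 : measurable_fun [set: mR2] (sq v : mR2 -> mR) by exact: measurable_sq.
have e1 x : abs2u (real_radial v g) x = sq v x by rewrite /abs2u/= expr0n/= addr0.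
have e2 x : abs2du (real_radial v g) x = sq g x by rewrite /abs2du/= expr0n/= addr0.
split; last by rewrite /Nmass; under eq_integral do rewrite e1.
split; first exact: vg.
split; first exact: radial_deriv0.
under eq_integral do rewrite e1 e2 -/(centrifugal m _).
rewrite integral_sum4_lty//; last 7 first.
- exact: measurable_sq.
- by apply: measurable_funM => //; exact: measurable_centrifugal.
- by apply: measurable_funM => //; exact: measurable_lne.
- by move=> x; exact: sq_ge0.
- by move=> x; rewrite mulr_ge0 ?centrifugal_ge0 ?sq_ge0.
- by move=> x; exact: sq_ge0.
- by move=> x; rewrite mulr_ge0 ?lne_ge0 ?sq_ge0.
rewrite vlam va; apply: (@le_lt_trans _ _ ((2 * disk_area * S)%:E + A%:E + lam%:E + a%:E)%E).
  rewrite leeD2r// leeD2r//; apply: leeD => //.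
  rewrite (integral_radial (f := fun r => (g r ^+ 2)%:E)); last 2 first.
  - by apply/measurable_EFinP; exact: measurable_funX.
  - by move=> r; rewrite lee_fin sqr_ge0.
  have c0 : 0 <= 2 * @disk_area R by rewrite mulr_ge0// ltW// disk_area_gt0.
  under eq_integral do rewrite -EFinM -(mulrA (2 * disk_area)) EFinM.
  rewrite ge0_integralZl_EFin//.
  - by rewrite [leRHS](EFinM (2 * disk_area)) lee_wpmul2l.
  - by move=> r; rewrite /= in_itv/= andbT => r0; rewrite lee_fin mulr_ge0 ?sqr_ge0// ltW.
  - apply: measurable_funTS; apply/measurable_EFinP; apply: measurable_funM => //.
    exact: measurable_funX.
by rewrite -!EFinD ltry.
Qed.

(** Supported in [[1, 3]], away from the origin, where the centrifugal weight is singular, and from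
    infinity, where the logarithm is unbounded. *)
Definition hat (r : R) : R := Num.max 0 (1 - `|r - 2|).

Lemma hat_ge0 r : 0 <= hat r. Proof. by rewrite le_max lexx. Qed.

Lemma hat_le1 r : hat r <= 1.
Proof. by rewrite ge_max ler01/= gerBl. Qed.

Lemma hat_out r : r <= 1 \/ 3 <= r -> hat r = 0.
Proof.
move=> h; apply/max_idPl; rewrite subr_le0.
by case: h => h; [rewrite ler0_norm; lra|rewrite ger0_norm; lra].
Qed.

Lemma hat_lip r s : `|hat s - hat r| <= `|s - r|.
Proof.
have h : forall s r, hat s - hat r <= `|s - r|.
  move=> {}s {}r; rewrite lerBlDl /hat ge_max addr_ge0 ?hat_ge0//=.
  apply: (@le_trans _ _ ((1 - `|r - 2|) + `|s - r|)); last by rewrite lerD2r le_max lexx orbT.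
  have := ler_normD (r - s) (s - 2); rewrite distrC.
  have -> : r - s + (s - 2) = r - 2 by ring.
  lra.
by rewrite ler_norml h andbT lerNl opprB distrC h.
Qed.

Lemma hat_continuous : continuous hat.
Proof.
move=> r; apply/cvgrPdist_lt => e e0; near=> s.
apply: le_lt_trans (hat_lip _ _) _; near: s.
by apply: cvgr_dist_lt => //; exact: cvg_id.
Unshelve. all: by end_near. Qed.

(** At most [3 * 2 ^ j] cells contribute, each with weight at most [3 * 2 ^ j] and increment at most
    [|c| / 2 ^ j]. Hence [9 * c ^+ 2] at every level. *)
Lemma hat_energy (c : R) j N : energy (fun r => c * hat r) j N <= 9 * c ^+ 2.
Proof.
have M0 : 0 < 2 ^+ j :> R by exact: exp2_gt0.
pose q := 3 * c ^+ 2 / 2 ^+ j.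
have q0 : 0 <= q by apply: divr_ge0; [apply: mulr_ge0 => //; exact: sqr_ge0|exact: ltW].
have term l : l%:R * cell (fun r => c * hat r) j l ^+ 2 <= (l < 3 * 2 ^ j)%N%:R * q.
  have [lt3|ge3] := ltnP l (3 * 2 ^ j); last first.
    have l3 : 3 <= l%:R / 2 ^+ j :> R.
      by rewrite ler_pdivlMr// -natrX -natrM ler_nat.
    have l3' : 3 <= l.+1%:R / 2 ^+ j :> R.
      by apply: le_trans l3 _; rewrite ler_pM2r ?invr_gt0// ler_nat.
    by rewrite /cell !hat_out; [rewrite subrr expr0n/= mulr0 mul0r|right|right].
  rewrite mul1r /cell -mulrBr exprMn.
  have h : (hat (l.+1%:R / 2 ^+ j) - hat (l%:R / 2 ^+ j)) ^+ 2 <= (2 ^+ j)^-1 ^+ 2 :> R.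
    rewrite -real_normK ?num_real// ler_pXn2r ?nnegrE ?invr_ge0 ?(ltW M0)//.
    apply: le_trans (hat_lip _ _) _.
    by rewrite -mulrBl -natrB// subSnn mul1r ger0_norm// invr_ge0 ltW.
  apply: (@le_trans _ _ (3 * 2 ^+ j * (c ^+ 2 * (2 ^+ j)^-1 ^+ 2))).
    apply: ler_pM => //; first by rewrite mulr_ge0 ?sqr_ge0.
    - by rewrite -natrX -natrM ler_nat ltnW.
    - by rewrite ler_wpM2l ?sqr_ge0.
  rewrite le_eqVlt; apply/orP; left; apply/eqP; rewrite /q; field.
  by rewrite gt_eqF.
rewrite /energy; apply: le_trans (ler_sum _ (fun l _ => term l)) _.
rewrite -mulr_suml -natr_sum.
apply: (@le_trans _ _ ((3 * 2 ^ j)%N%:R * q)).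
  rewrite ler_wpM2r// ler_nat.
  have [N3|/ltnW N3] := leqP N (3 * 2 ^ j).
    apply: leq_trans N3; rewrite -[leqRHS](subn0 N) -[leqRHS]muln1 -sum_nat_const_nat.
    by apply: leq_sum => l _; case: (_ < _)%N.
  rewrite (big_cat_nat _ N3)//=.
  have -> : (\sum_(3 * 2 ^ j <= l < N) (l < 3 * 2 ^ j))%N = 0%N.
    by rewrite big_nat_cond big1// => l /andP[/andP[h _] _]; rewrite ltnNge h.
  rewrite addn0 -[leqRHS](subn0 (3 * 2 ^ j)%N) -[leqRHS]muln1 -sum_nat_const_nat.
  by apply: leq_sum => l _; case: (_ < _)%N.
rewrite le_eqVlt; apply/orP; left; apply/eqP; rewrite /q natrM natrX; field.
by rewrite gt_eqF.
Qed.

Let mhat : measurable_fun [set: mR] (hat : mR -> mR).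
Proof. by apply: continuous_measurable_fun; exact: hat_continuous. Qed.

Lemma hat_mass : exists2 N : R, 0 < N & (\int[leb2]_x (sq hat x)%:E = N%:E)%E.
Proof.
have I0 : (0 <= \int[leb2]_x (sq hat x)%:E)%E.
  by apply: integral_ge0 => x _; rewrite lee_fin sq_ge0.
have Ioo : (\int[leb2]_x (sq hat x)%:E <= (3 ^+ 2 * disk_area)%:E)%E.
  rewrite -(leb2_disk (ltr0n _ 3)) -[X in leb2 X]setIT.
  rewrite -(@integral_indic _ mR2 R leb2 setT measurableT); last exact: measurable_disk.
  apply: ge0_le_integral => //.
  - by move=> x _; rewrite lee_fin sq_ge0.
  - by apply/measurable_EFinP; exact: measurable_sq.
  - by apply/measurable_EFinP; apply: measurable_indic; exact: measurable_disk.
  - move=> x _; rewrite lee_fin indicE /sq.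
    have [x3|x3] := ltP (eucl x) 3; first by rewrite mem_set// exprn_ile1 ?hat_ge0 ?hat_le1.
    by rewrite hat_out; [rewrite expr0n ler0n|right].
(* On [[3 / 2, 5 / 2]], of length [1], the radius is at least [3 / 2] and the tent at least
   [1 / 2]. *)
have h : ((2 * disk_area * (3 / 2) * (1 / 4))%:E <= \int[leb2]_x (sq hat x)%:E)%E.
  rewrite (integral_radial (f := fun r => (hat r ^+ 2)%:E)); last 2 first.
  - by apply/measurable_EFinP; exact: measurable_funX.
  - by move=> r; rewrite lee_fin sqr_ge0.
  have d0 := @disk_area_gt0 R.
  have mf : measurable_fun [set: mR] ((fun r => (2 * disk_area * r)%:E * (hat r ^+ 2)%:E)%E : mR -> \bar R).
    apply: emeasurable_funM; apply/measurable_EFinP; first exact: measurable_funM.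
    exact: measurable_funX.
  apply: (@le_trans _ _ (\int[leb]_(r in `[(3 / 2)%R, (5 / 2)%R]) ((2 * disk_area * r)%:E * (hat r ^+ 2)%:E))%E).
    apply: (@le_trans _ _ (\int[leb]_(r in `[(3 / 2)%R, (5 / 2)%R]) cst (2 * disk_area * (3 / 2) * (1 / 4))%:E r)%E).
      rewrite integral_cst//= lebesgue_measure_itv/= lte_fin.
      have -> : (3 / 2 < 5 / 2 :> R) by lra.
      rewrite -EFinB -EFinM lee_fin; set k := 2 * _ * _ * _; lra.
    apply: ge0_le_integral => //.
    - by move=> r _; rewrite /= lee_fin !mulr_ge0 ?divr_ge0// ltW.
    - exact: measurable_funTS.
    - move=> r; rewrite /= in_itv/= => /andP[r1 r2]; rewrite -EFinM lee_fin.
      have hr : 1 / 2 <= hat r.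
        rewrite /hat le_max; apply/orP; right.
        have : `|r - 2| <= 1 / 2 by rewrite ler_norml; lra.
        by lra.
      apply: ler_pM => //.
      - by rewrite !mulr_ge0 ?divr_ge0// ltW.
      - by rewrite ler_wpM2l// mulr_ge0// ltW.
      - have -> : 1 / 4 = (1 / 2) ^+ 2 :> R by field.
        by rewrite ler_pXn2r// nnegrE ?divr_ge0 ?hat_ge0.
  apply: ge0_subset_integral => //.
  - exact: measurable_funTS.
  - move=> r; rewrite /= in_itv/= andbT => r0.
    apply: mule_ge0; rewrite lee_fin ?sqr_ge0//.
    by apply: mulr_ge0; [apply: mulr_ge0 => //; exact: ltW|exact: ltW].
  - by move=> r; rewrite /= !in_itv/= andbT => /andP[r1 _]; lra.
move: I0 Ioo h; case: (\int[leb2]_x _)%E => // N _ _; rewrite lee_fin => hN.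
exists N => //; apply: lt_le_trans hN.
by rewrite !mulr_gt0 ?divr_gt0 ?disk_area_gt0.
Qed.

Lemma in_Xms_mass_nonempty (m : nat) (lam : R) : 0 < lam ->
  exists u : radial R, in_Xms m u /\ Nmass u = lam%:E.
Proof.
move=> lam0; have [N N0 hN] := hat_mass.
pose c := Num.sqrt (lam / N); pose v r := c * hat r.
have mv : measurable_fun [set: mR] (v : mR -> mR) by exact: measurable_funM.
have mv2 : measurable_fun [set: mR2] (sq v : mR2 -> mR) by exact: measurable_sq.
have cv : continuous v.
  move=> r; apply: cvgM; first exact: cvg_cst.
  exact: hat_continuous.
(* The derivative of the tent comes from the dyadic criterion, so the kink points need no
   treatment. *)
have [g [vg gS]] := energy_bound_deriv mv (fun r _ => cv r) (hat_energy c).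
have vE x : sq v x = c ^+ 2 * sq hat x by rewrite /sq exprMn.
have vlam : (\int[leb2]_x (sq v x)%:E = lam%:E)%E.
  under eq_integral do rewrite vE EFinM.
  rewrite ge0_integralZl_EFin ?sqr_ge0//; last 2 first.
  - by move=> x _; rewrite lee_fin sq_ge0.
  - by apply/measurable_EFinP; exact: measurable_sq.
  rewrite hN -EFinM /c sqr_sqrtr ?divr_ge0 ?(ltW lam0) ?(ltW N0)//.
  by rewrite divfK ?gt_eqF.
(* A weight matters only on the support of the tent, so its integral is at most its bound there
   times the mass. *)
have bound (h : R * R -> R) (k : R) : measurable_fun [set: mR2] (h : mR2 -> mR) ->
    (forall x, 0 <= h x) -> 0 <= k -> (forall x, 1 < eucl x -> eucl x < 3 -> h x <= k) ->
    (\int[leb2]_x (h x * sq v x)%:E <= (k * lam)%:E)%E.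
  move=> mh h0 k0 hk; rewrite EFinM -vlam -ge0_integralZl_EFin//; last 2 first.
  - by move=> x _; rewrite lee_fin sq_ge0.
  - by apply/measurable_EFinP.
  apply: ge0_le_integral => //.
  - by move=> x _; rewrite lee_fin mulr_ge0 ?sq_ge0.
  - by apply/measurable_EFinP; exact: measurable_funM.
  - by apply: measurable_funeM; exact/measurable_EFinP.
  - move=> x _; rewrite -EFinM lee_fin.
    have z : hat (eucl x) = 0 -> h x * sq v x <= k * sq v x.
      by move=> hx; rewrite /sq /v hx mulr0 expr0n/= !mulr0.
    have [x1|x1] := leP (eucl x) 1; first by apply: z; rewrite hat_out//; left.
    have [x3|x3] := leP 3 (eucl x); first by apply: z; rewrite hat_out//; right.
    by rewrite ler_wpM2r ?sq_ge0 ?hk.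
have b1 : (\int[leb2]_x (centrifugal m x * sq v x)%:E <= (m%:R ^+ 2 * lam)%:E)%E.
  apply: bound => [| | |x x1 _]; first exact: measurable_centrifugal.
  - by move=> x; exact: centrifugal_ge0.
  - exact: sqr_ge0.
  rewrite /centrifugal ler_piMr ?sqr_ge0// invf_le1 ?exprn_gt0 ?(lt_trans ltr01)//.
  by rewrite exprn_ege1// ltW.
have b2 : (\int[leb2]_x (ln (1 + eucl x)%R * sq v x)%:E <= (ln 4 * lam)%:E)%E.
  apply: bound => [| | |x x1 x3]; first exact: measurable_lne.
  - by move=> x; exact: lne_ge0.
  - by rewrite ln_ge0// ler1n.
  by rewrite ler_ln ?posrE//; lra.
exists (real_radial v g).
apply: (real_radial_in_Xms vg gS b1 vlam); apply: fin_real.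
  by apply: integral_ge0 => x _; rewrite lee_fin mulr_ge0 ?lne_ge0 ?sq_ge0.
exact: le_lt_trans b2 (ltry _).
Qed.

End real_profiles.

(** * The minimizer *)

Lemma holder_continuous (R : realType) (w : R -> R) (T : R) :
  (forall a b, 0 < a -> a < b -> a * (w b - w a) ^+ 2 <= (b - a) * T) ->
  forall r, 0 < r -> {for r, continuous w}.
Proof.
move=> wT r r0; have r20 : 0 < r / 2 by rewrite divr_gt0.
have T0 : 0 <= T.
  have := wT 1 2 ltr01 (ltr1n _ 2); rewrite mul1r -(natrB _ (isT : 1 <= 2)%N) mul1r.
  by apply: le_trans; exact: sqr_ge0.
(* The smaller of [r] and [s] exceeds [r / 2], so one constant serves on both sides of [r]. *)
have h s : r / 2 < s -> (r / 2) * (w r - w s) ^+ 2 <= `|r - s| * T.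
  move=> rs; have s0 : 0 < s by exact: lt_trans rs.
  have le2 a x : r / 2 <= a -> r / 2 * x ^+ 2 <= a * x ^+ 2.
    by move=> ra; rewrite ler_wpM2r ?sqr_ge0.
  have [sr|sr|->] := ltgtP s r; last by rewrite !subrr expr0n/= mulr0 normr0 mul0r.
    rewrite ger0_norm ?subr_ge0 ?(ltW sr)//.
    by apply: le_trans (wT _ _ s0 sr); apply: le2; exact: ltW.
  rewrite distrC ger0_norm ?subr_ge0 ?(ltW sr)//.
  apply: le_trans (wT _ _ r0 sr); rewrite -sqrrN opprB; apply: le2.
  by rewrite ler_pdivrMr// ler_peMr ?ler1n// ltW.
apply/cvgrPdist_lt => e e0.
pose d := r / 2 * e ^+ 2 / (T + 1).
have d0 : 0 < d by rewrite /d divr_gt0 ?mulr_gt0 ?exprn_gt0 ?divr_gt0// ltr_wpDl.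
near=> s; rewrite -(@ltr_pXn2r _ 2)// ?nnegrE ?normr_ge0 ?(ltW e0)//.
rewrite real_normK ?num_real// -(ltr_pM2l r20).
apply: le_lt_trans (h _ _) _.
  near: s; apply: lt_nbhsr.
  by rewrite ltr_pdivrMr// ltr_pMr// ltr1n.
apply: (@le_lt_trans _ _ (d * T)).
  apply: ler_wpM2r; first exact: T0.
  apply: ltW; near: s.
  apply: cvgr_dist_lt; last exact: d0.
  exact: cvg_id.
rewrite /d mulrAC ltr_pdivrMr ?ltr_wpDl// ltr_pM2l ?ltrDl//.
by rewrite mulr_gt0 ?exprn_gt0.
Unshelve. all: by end_near. Qed.

Lemma cvg_energy (R : realType) (w : nat -> R -> R) (p : R -> R) j N :
  (forall r, w n r @[n --> \oo] --> p r) ->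
  energy (w n) j N @[n --> \oo] --> energy p j N.
Proof.
move=> wp; elim: N => [|N IH].
  rewrite /energy big_geq//; under eq_fun do rewrite big_geq//.
  exact: cvg_cst.
rewrite /energy big_nat_recr//=; under eq_fun do rewrite big_nat_recr//=.
apply: cvgD; first exact: IH.
have h : cell (w n) j N @[n --> \oo] --> cell p j N by apply: cvgB; exact: wp.
apply: cvgM; first exact: cvg_cst.
by rewrite expr2; under eq_fun do rewrite expr2; exact: cvgM.
Qed.

Section minimization.
Context {R : realType}.
Notation leb := (@lebesgue_measure R).
Notation mR := (measurableTypeR R).
Variables (gamma lam : R) (m : nat).
Hypotheses (gamma0 : 0 < gamma) (lam0 : 0 < lam) (m0 : (0 < m)%N).
Let c1 : R := 2 * disk_area.
Let g := gamma / (4 * pi).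

Let c10 : 0 < c1. Proof. by rewrite mulr_gt0 ?disk_area_gt0. Qed.
Let g0 : 0 < g. Proof. by rewrite divr_gt0// mulr_gt0// pi_gt0. Qed.

Lemma em_le (u : radial R) : in_Xms m u -> Nmass u = lam%:E ->
  (em gamma m lam <= Em gamma m u)%E.
Proof. by move=> Xu Nu; apply: ereal_inf_lbound; exists u. Qed.

(** Coercivity bounds the infimum from below, and the rescaled tent keeps it from being [+oo]. *)
Lemma em_real : exists e : R, em gamma m lam = e%:E.
Proof.
have [B coer] := coercive gamma0 lam0.
have lower (u : radial R) : in_Xms m u -> Nmass u = lam%:E ->
    exists2 E : R, Em gamma m u = E%:E & - B <= E.
  move=> Xu Nu; have [T [A [a adm]]] := in_Xms_admissible Xu Nu.
  have [L L0 hL] := adm_lnp adm.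
  have [E EE h] := coer m u T A a L m0 adm hL.
  exists E => //; apply: le_trans h; rewrite lerDr addr_ge0//.
    by rewrite divr_ge0// addr_ge0 ?(adm_A_ge0 adm)// mulr_ge0 ?(adm_T_ge0 adm)// ltW.
  by rewrite mulr_ge0// divr_ge0// mulr_ge0// ltW.
have [u [Xu Nu]] := in_Xms_mass_nonempty m lam0.
have [E EE _] := lower u Xu Nu.
have up := em_le Xu Nu; rewrite EE in up.
have : ((- B)%:E <= em gamma m lam)%E.
  apply: le_ereal_inf_tmp => _ [v [Xv Nv] <-].
  by have [F -> FB] := lower v Xv Nv; rewrite lee_fin.
by case: (em gamma m lam) up => // e _ _; exists e.
Qed.

Lemma minimizing_sequence (e0 : R) : em gamma m lam = e0%:E ->
  exists (u : nat -> radial R) (T A a L E : nat -> R) (K : R), forall n,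
    [/\ admissible m (u n) lam (T n) (A n) (a n),
        (\int[leb2]_x (lnp (eucl x) * sq (modulus (u n)) x)%:E = (L n)%:E)%E,
        Em gamma m (u n) = (E n)%:E, e0 <= E n <= e0 + n.+1%:R^-1 &
        [/\ T n <= K, A n <= K & L n <= K]].
Proof.
move=> em0; have [B coer] := coercive gamma0 lam0.
have emfin : em gamma m lam \is a fin_num by rewrite em0.
(* Energies are at most [e0 + 1]; doubling clears the factor [1 / 2] in [coercive]. [K'] divides by
   the coefficients of [T], [A] and [L]. *)
pose K := 2 * (e0 + 1 + B).
pose K' := Num.max (K / c1) (Num.max K (K / (g * lam))).
(* [q] packs [(u, (T, A, a, L, E))], so that one use of choice produces all the sequences
   together. *)
have H n : exists q : radial R * (R * R * R * R * R),
   [/\ admissible m q.1 lam q.2.1.1.1.1 q.2.1.1.1.2 q.2.1.1.2,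
        (\int[leb2]_x (lnp (eucl x) * sq (modulus q.1) x)%:E = (q.2.1.2)%:E)%E,
        Em gamma m q.1 = (q.2.2)%:E, e0 <= q.2.2 <= e0 + n.+1%:R^-1 &
        [/\ q.2.1.1.1.1 <= K', q.2.1.1.1.2 <= K' & q.2.1.2 <= K']].
  have n0 : 0 < n.+1%:R^-1 :> R by rewrite invr_gt0 ltr0n.
  have [_ [u [Xu Nu] <-]] := lb_ereal_inf_adherent n0 emfin.
  rewrite -/(em gamma m lam) em0 => Elt.
  have [T [A [a adm]]] := in_Xms_admissible Xu Nu.
  have [L L0 hL] := adm_lnp adm.
  have [E EE h] := coer m u T A a L m0 adm hL.
  have e0E : e0 <= E by rewrite -lee_fin -em0 -EE; exact: em_le.
  have Ee0 : E <= e0 + n.+1%:R^-1 by move: Elt; rewrite EE -EFinD lte_fin => /ltW.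
  have n1 : n.+1%:R^-1 <= 1 :> R by rewrite invf_le1 ?ler1n.
  exists (u, (T, A, a, L, E)); split => //=; first by rewrite e0E.
  have T0 : 0 <= c1 * T by rewrite mulr_ge0 ?(adm_T_ge0 adm)// ltW.
  have A0 := adm_A_ge0 adm.
  have gl : 0 < g * lam by exact: mulr_gt0.
  have gL0 : 0 <= g * lam * L by apply: mulr_ge0 => //; exact: ltW.
  have : c1 * T + A + g * lam * L <= K.
    move: h; rewrite -/c1 -/g /K.
    have -> : g * lam / 2 * L = g * lam * L / 2 by rewrite mulrAC.
    move: (c1 * T) (g * lam * L) (n.+1%:R^-1) Ee0 n1 => X Y i Ei i1 h; lra.
  move=> hK; rewrite /K' !le_max !ler_pdivlMr// ![_ * c1]mulrC ![L * _]mulrC.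
  by split; apply/orP; [left|right; apply/orP; left|right; apply/orP; right]; lra.
have [q Hq] := choice H.
exists (fun n => (q n).1), (fun n => (q n).2.1.1.1.1), (fun n => (q n).2.1.1.1.2),
  (fun n => (q n).2.1.1.2), (fun n => (q n).2.1.2), (fun n => (q n).2.2), K'.
exact: Hq.
Qed.

Lemma minimizer_exists : exists u : radial R,
  in_Xms m u /\ (forall r : R, 0 < r -> 0 <= re_p u r /\ im_p u r = 0) /\
  Nmass u = lam%:E /\ Em gamma m u = em gamma m lam.
Proof.
have [e0 em0] := em_real.
have [u [T [A [a [L [E [K useq]]]]]]] := minimizing_sequence em0.
have adm n : admissible m (u n) lam (T n) (A n) (a n) by case: (useq n).
have K0 : 0 <= K by case: (useq 0%N) => _ _ _ _ [h _ _]; apply: le_trans h; exact: adm_T_ge0 (adm 0%N).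
pose C := 4 * (K / c1) + 2 * K; pose w n := modulus (u n).
have wC n r : w n r ^+ 2 <= C.
  apply: le_trans (adm_modulus_bound m0 (adm n) r) _.
  have [_ _ _ _ [TK AK _]] := useq n.
  by apply: lerD; rewrite ler_pM2l// ler_pM2r// invr_gt0.
have wT n x y : 0 < x -> x < y -> x * (w n y - w n x) ^+ 2 <= (y - x) * K.
  move=> x0 xy; have [_ _ _ _ [TK _ _]] := useq n.
  apply: (modulus_equicont (adm_re (adm n)) (adm_im (adm n))) => //.
  by rewrite (adm_T (adm n)) lee_fin.
have w0 n r : r <= 0 -> w n r = 0 by move=> r0; rewrite /w /modulus ltNge r0.
have wsC n r : `|w n r| <= Num.sqrt C by rewrite -sqrtr_sqr ler_wsqrtr.
(* Both kinetic values are made to converge along the subsequence. As the energies converge to [e0],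
   the potentials then converge too, and limits can be added where lower limits could not. *)
pose s n i := if i is 0%N then T n else A n.
have sK n i : `|s n i| <= K.
  have [_ _ _ _ [TK AK _]] := useq n.
  by case: i => [|i]/=; rewrite ger0_norm// ?(adm_T_ge0 (adm n)) ?(adm_A_ge0 (adm n)).
have [k [p [t [nk wp st]]]] := equicontinuous_subsequence wsC wT w0 sK.
have Tt : T (k n) @[n --> \oo] --> t 0%N by exact: (st 0%N).
have At : A (k n) @[n --> \oo] --> t 1%N by exact: (st 1%N).
have Ee : E (k n) @[n --> \oo] --> e0.
  have i0 : n.+1%:R^-1 @[n --> \oo] --> (0 : R) by exact: cvg_harmonic.
  have i1 : e0 + n.+1%:R^-1 @[n --> \oo] --> e0.
    by rewrite -[X in _ --> X]addr0; apply: cvgD i0; exact: cvg_cst.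
  apply: squeeze_cvgr (cvg_cst e0) i1; apply: nearW => n; case: (useq (k n)) => _ _ _ /andP[-> h] _.
  apply: le_trans h _; rewrite lerD2l lef_pV2 ?posrE ?ltr0n// ler_nat ltnS.
  exact: nk.
pose v n := (E (k n) - (c1 * T (k n) + A (k n))) / g.
pose l := (e0 - (c1 * t 0%N + t 1%N)) / g.
have vl : v n @[n --> \oo] --> l.
  apply: cvgM; last exact: cvg_cst.
  by apply: cvgB => //; apply: cvgD => //; apply: cvgM => //; exact: cvg_cst.
have pv n : pot (sq (w (k n))) = (v n)%:E.
  have := adm_Em m0 (adm (k n)) gamma; case: (useq (k n)) => _ _ -> _ _.
  have := adm_pot_fin_num m0 (adm (k n)); case: (pot _) => // y _.
  rewrite -EFinM -EFinD => -[]; rewrite -/c1 -/g /v => ->.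
  by congr EFin; field; rewrite gt_eqF.
have mw n : measurable_fun [set: mR] (w n : mR -> mR).
  by apply: measurable_modulus; [exact: adm_re (adm n)|exact: adm_im (adm n)].
have mp : measurable_fun [set: mR] (p : mR -> mR).
  by apply: (measurable_fun_cvg (fun n => mw (k n))) => r _; exact: wp.
have PP x : sq (w (k n)) x @[n --> \oo] --> sq p x.
  by rewrite /sq expr2; under eq_fun do rewrite expr2; apply: cvgM; exact: wp.
have mP n := measurable_sq (mw (k n)).
have P0 n x : 0 <= sq (w (k n)) x by exact: sq_ge0.
have PC n x : sq (w (k n)) x <= C by exact: wC.
have iP n := adm_lam (adm (k n)).
have ilnP n := adm_a (adm (k n)).
have ilnpP n : (\int[leb2]_x (lnp (eucl x) * sq (w (k n)) x)%:E = (L (k n))%:E)%E.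
  by case: (useq (k n)).
have LK n : L (k n) <= K by case: (useq (k n)) => _ _ _ _ [].
have plam := limit_mass mP P0 PC iP ilnpP LK PP.
have [b plne] := limit_lne mP P0 PC iP ilnpP LK PP.
have ppot := limit_pot mP P0 PC iP ilnP ilnpP LK PP pv vl.
have pcent : (\int[leb2]_x (centrifugal m x * sq p x)%:E <= (t 1%N)%:E)%E.
  apply: (fatou_weighted mP P0 PP (measurable_centrifugal m) (@centrifugal_ge0 _ m) _ At).
  by move=> n; rewrite (adm_A (adm (k n))).
have penergy j N : energy p j N <= t 0%N.
  have ce : energy (w (k n)) j N @[n --> \oo] --> energy p j N.
    exact: (cvg_energy (w := fun n => w (k n))).
  apply: (@ler_cvg_to _ _ _ _ _ _ _ _ ce Tt); apply: nearW => n.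
  apply: (modulus_energy (adm_re (adm (k n))) (adm_im (adm (k n)))).
  by rewrite (adm_T (adm (k n))).
have pK x y : 0 < x -> x < y -> x * (p y - p x) ^+ 2 <= (y - x) * K.
  move=> x0 xy.
  have h : w (k n) y - w (k n) x @[n --> \oo] --> p y - p x by apply: cvgB; exact: wp.
  have {}h : x * (w (k n) y - w (k n) x) ^+ 2 @[n --> \oo] --> x * (p y - p x) ^+ 2.
    apply: cvgM; first exact: cvg_cst.
    by rewrite expr2; under eq_fun do rewrite expr2; exact: cvgM.
  apply: (cvgr_to_le h).
  by apply: nearW => n; exact: wT.
have p0 r : 0 <= p r.
  by apply: (cvgr_to_ge (wp r)); apply: nearW => n; exact: modulus_ge0.
have pn r : r <= 0 -> p r = 0.
  move=> r0; apply/eqP; rewrite eq_le p0 andbT.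
  by apply: (cvgr_to_le (wp r)); apply: nearW => n; rewrite w0.
(* The limit profile gets its weak derivative only now, with radial energy at most the limit [t 0%N]
   of the [T (k n)]. *)
have [g' [pg' g'S]] := energy_bound_deriv mp (holder_continuous pK) penergy.
have [Xu Nu] := real_radial_in_Xms pg' g'S pcent plam plne.
exists (real_radial p g'); split => //; split; first by move=> r _; split => //=.
split => //; apply/eqP; rewrite eq_le em_le// andbT em0.
have [T' [A' [a' adm']]] := in_Xms_admissible Xu Nu.
have mE := modulus_real_radial g' p0 pn.
rewrite (adm_Em m0 adm') mE -/c1 -/g.
(* The three terms of the energy of [p] are bounded separately by the limits of their counterparts,
   and these limits add up to [e0] by the choice of [l]. *)
have T'le : T' <= t 0%N.
  rewrite -lee_fin -(adm_T adm'); apply: le_trans g'S; rewrite le_eqVlt; apply/orP; left.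
  by apply/eqP; apply: eq_integral => r _ /=; rewrite expr0n/= addr0.
have A'le : A' <= t 1%N by rewrite -lee_fin -(adm_A adm') mE.
have := adm_pot_fin_num m0 adm'; rewrite mE.
move: ppot; case: (pot _) => // y; rewrite lee_fin => yl _.
rewrite -EFinM -EFinD lee_fin.
have : g * y <= e0 - (c1 * t 0%N + t 1%N).
  by move: yl; rewrite /l ler_pdivlMr// mulrC.
have : c1 * T' <= c1 * t 0%N by rewrite ler_pM2l.
lra.
Qed.

End minimization.

Theorem theorem5p1 (R : realType) (gamma : R) (hgamma : 0 < gamma)
    (m : nat) (hm : (0 < m)%N) (lambda : R) (hlambda : 0 < lambda) :
  exists u : radial R,
    in_Xms m u /\
    (forall r : R, 0 < r -> 0 <= re_p u r /\ im_p u r = 0) /\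
    Nmass u = lambda%:E /\
    Em gamma m u = em gamma m lambda.
Proof. exact: minimizer_exists. Qed.
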